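(* Let $d\ge 2$ and $0<\alpha\le 2$ with $\alpha<d$, and let $E\subset\mathbb{R}^d$ be a compact set with finite Robin's constant $W_\alpha(E)$. If the sets of points $X_n=\{x_{k,n}\}_{k=1}^n\subset\mathbb{R}^d$, $n\ge 2$, satisfy $$\lim_{n\to\infty}\hat I_\alpha[\tau(X_n)]=W_\alpha(E)\qquad\text{and}\qquad \lim_{n\to\infty} m_E(X_n)=0,$$ then $$\tau(X_n)\stackrel{*}{\rightarrow}\mu_E\quad\text{as } n\to\infty.$$ Conversely, $\lim_{n\to\infty} m_E(X_n)=0$ holds for any sequence of sets $X_n=\{x_{k,n}\}_{k=1}^n\subset\mathbb{R}^d$, $n\in\mathbb{N}$, satisfying $\tau(X_n)\stackrel{*}{\rightarrow}\mu_E$ as $n\to\infty$.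
   Context: For $0<\alpha<d$ let $k_\alpha(x)=|x|^{\alpha-d}$, $x\in\mathbb{R}^d$, be the Riesz kernel, where $|\cdot|$ is the Euclidean norm (with $k_\alpha(0)=+\infty$). For a Borel measure $\mu$ with compact support, its energy is $I_\alpha[\mu]=\iint k_\alpha(x-y)\,d\mu(x)\,d\mu(y)$ and its potential is $U_\alpha^\mu(x)=\int k_\alpha(x-y)\,d\mu(y)$, $x\in\mathbb{R}^d$. Robin's constant of a compact set $E$ is $W_\alpha(E)=\inf_{\mu\in\mathcal{M}(E)}I_\alpha[\mu]$, where $\mathcal{M}(E)$ is the set of all positive unit (probability) Borel measures supported on $E$. If $W_\alpha(E)<\infty$, the infimum is attained by a unique measure $\mu_E\in\mathcal{M}(E)$, called the equilibrium measure, and one sets $g_E(x)=W_\alpha(E)-U_\alpha^{\mu_E}(x)$, $x\in\mathbb{R}^d$. For a set of $n$ points $X_n=\{x_{k,n}\}_{k=1}^n\subset\mathbb{R}^d$, the counting measure is $\tau(X_n)=\frac1n\sum_{k=1}^n\delta_{x_{k,n}}$, where $\delta_x$ is the unit point mass at $x$. The discrete energy (for $n\ge2$) is $$\hat I_\alpha[\tau(X_n)]=\frac{2}{n(n-1)}\sum_{1\le j<k\le n}k_\alpha(x_{j,n}-x_{k,n}).$$ Also $$m_E(X_n)=\frac1n\sum_{x_{k,n}\in E^c}g_E(x_{k,n}),$$ where $E^c=(\mathbb{R}^d\cup\{\infty\})\setminus E$, with $m_E(X_n)=0$ if $X_n\subset E$. The notation $\tau(X_n)\stackrel{*}{\rightarrow}\mu_E$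 means weak convergence: $\lim_{n\to\infty}\int\phi\,d\tau(X_n)=\int\phi\,d\mu_E$ for every continuous $\phi:\mathbb{R}^d\to\mathbb{R}$ with compact support. *)

(* Defs.v *)
From HB Require Import structures.
From mathcomp Require Import all_boot all_order all_algebra.
From mathcomp Require Import all_classical all_reals all_analysis.

Set Implicit Arguments.
Unset Strict Implicit.
Unset Printing Implicit Defensive.
Import Order.TTheory GRing.Theory Num.Theory.
Import numFieldNormedType.Exports.

Local Open Scope classical_set_scope.
Local Open Scope ring_scope.
Local Open Scope ereal_scope.

(* The norm carried by 'rV[R]_d in the library is the max norm; it induces the
   usual topology, hence the usual Borel sets. *)
Definition borel_rV (R : realType) (d : nat) :=
  g_sigma_algebraType (@open 'rV[R]_d).

Definition enorm (R : realType) (d : nat) (x : 'rV[R]_d) : R :=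
  Num.sqrt (\sum_(i < d) x ord0 i ^+ 2)%R.

(* The case split is needed because 0 `^ b = 0 for every b != 0. *)
Definition riesz (R : realType) (d : nat) (alpha : R) (x : 'rV[R]_d) : \bar R :=
  if x == 0%R then +oo else (enorm x `^ (alpha - d%:R))%:E.

Definition potential (R : realType) (d : nat) (alpha : R)
    (mu : {measure set (borel_rV R d) -> \bar R}) (x : 'rV[R]_d) : \bar R :=
  \int[mu]_y riesz alpha (x - y)%R.

Definition energy (R : realType) (d : nat) (alpha : R)
    (mu : {measure set (borel_rV R d) -> \bar R}) : \bar R :=
  \int[mu]_x \int[mu]_y riesz alpha (x - y : 'rV[R]_d)%R.

(* For closed E, being supported on E amounts to the complement being null. *)
Definition prob_on (R : realType) (d : nat) (E : set 'rV[R]_d) :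
    set (probability (borel_rV R d) R) :=
  [set mu | mu (~` E) = 0].

Definition robin (R : realType) (d : nat) (alpha : R) (E : set 'rV[R]_d) :
    \bar R :=
  ereal_inf [set energy alpha mu | mu in prob_on E].

Definition is_equilibrium (R : realType) (d : nat) (alpha : R)
    (E : set 'rV[R]_d) (mu : probability (borel_rV R d) R) : Prop :=
  prob_on E mu /\ energy alpha mu = robin alpha E.

Definition green (R : realType) (d : nat) (alpha : R) (E : set 'rV[R]_d)
    (muE : {measure set (borel_rV R d) -> \bar R}) (x : 'rV[R]_d) : \bar R :=
  robin alpha E - potential alpha muE x.

Definition counting_measure (R : realType) (d n : nat) (X : 'I_n -> 'rV[R]_d)
    (A : set (borel_rV R d)) : \bar R :=
  (n%:R^-1)%:E * \sum_(k < n) \d_(X k : borel_rV R d) A.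

Section counting_measure_instance.
Context (R : realType) (d n : nat) (X : 'I_n -> 'rV[R]_d).

Let counting_measure0 : counting_measure X set0 = 0.
Proof.
by rewrite /counting_measure big1 ?mule0// => k _; rewrite measure0.
Qed.

Let counting_measure_ge0 A : 0 <= counting_measure X A.
Proof.
by rewrite mule_ge0 ?lee_fin ?invr_ge0 ?ler0n//; apply: sume_ge0.
Qed.

Let invn_ge0 : (0 <= (n%:R^-1 : R))%R.
Proof. by rewrite invr_ge0 ler0n. Qed.

Let counting_measure_sigma_additive : semi_sigma_additive (counting_measure X).
Proof.
pose m (k : nat) : {measure set (borel_rV R d) -> \bar R} :=
  dirac (oapp X point (insub k) : borel_rV R d).
suff -> : counting_measure X = mscale (NngNum invn_ge0) (msum m n).
  exact: measure_semi_sigma_additive.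
apply/funext => A; rewrite /mscale /msum /counting_measure /=; congr (_ * _).
by apply: eq_bigr => k _; rewrite /m /= valK.
Qed.

HB.instance Definition _ := isMeasure.Build _ _ _ (counting_measure X)
  counting_measure0 counting_measure_ge0 counting_measure_sigma_additive.

End counting_measure_instance.

Definition discrete_energy (R : realType) (d n : nat) (alpha : R)
    (X : 'I_n -> 'rV[R]_d) : \bar R :=
  (2%:R / (n%:R * (n%:R - 1)))%:E *
  \sum_(j < n) \sum_(k < n | (j < k)%N) riesz alpha (X j - X k)%R.

Definition m_ext (R : realType) (d n : nat) (alpha : R) (E : set 'rV[R]_d)
    (muE : {measure set (borel_rV R d) -> \bar R}) (X : 'I_n -> 'rV[R]_d) :
    \bar R :=
  (n%:R^-1)%:E * \sum_(k < n | X k \notin E) green alpha E muE (X k).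

Definition compactly_supported (R : realType) (d : nat)
    (phi : 'rV[R]_d -> R) : Prop :=
  compact (closure [set x | phi x != 0%R]).

Definition weak_cvg (R : realType) (d : nat)
    (tau : nat -> {measure set (borel_rV R d) -> \bar R})
    (mu : {measure set (borel_rV R d) -> \bar R}) : Prop :=
  forall phi : 'rV[R]_d -> R, continuous phi -> compactly_supported phi ->
    (\int[tau n]_x (phi x)%:E) @[n --> \oo] --> \int[mu]_x (phi x)%:E.

(* Main.v *)
(* Write k for the Riesz kernel, u for the potential of muE, W for Robin's
   constant and q = d - alpha.

   Frostman's bound u <= W.  Varying muE inside E gives int u dnu >= W nu(E) for
   every nu of finite energy on E, hence u <= W muE-almost everywhere.  On a
   compact K carrying almost all of muE, the truncation errors of the potential
   are uniformly small, so that the truncated potential of muE|K is at most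
   W + small near K.  Off K its second differences are >= - O(h^4), because k
   is subharmonic for alpha <= 2, so the maximum principle propagates the bound.

   Converse.  With u_e the truncated potential and phi a cutoff equal to 1 on
   E, m_E(X_n) <= W - int phi u_e dtau_n -> W - int u_e dmuE, which is small.

   Direct part.  Let U be an ultrafilter finer than the filter at infinity.  As
   u <= W/2 off a large ball, m_E -> 0 forces the mass of tau_n to stay in a
   compact Q, and tau_n converges along U to a probability sigma on Q, built as
   the image of Lebesgue measure on [0, 1[ under a map coded by binary
   expansions.  Then int u dsigma >= W: on E by variation, off E because
   m_E -> 0.  Stereographic projection x -> x' to the unit sphere gives
   k(x - y) = 2^p w(x) w(y) (1 - <x', y'>)^-p with p = q/2 and
   w(x) = (1 + |x|^2)^-p.  Replacing 1 - z by 1 - r z, r < 1, and truncating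
   the binomial series gives a polynomial in <x', y'> with positive
   coefficients, below ((1 + r)/2)^-p k and close to k away from the diagonal.
   Hence the discrete energies bound the regularized energy of sigma by about
   W, and the regularized energy of sigma - muE is at most
   W - 2 int u dsigma + W <= 0 in the limit r -> 1.  It is a sum of positive
   multiples of squares of moments of w (sigma - muE) in the coordinates of x',
   so these moments all vanish, and sigma = muE by polynomial density. *)
Require Import Defs.
From HB Require Import structures.
From mathcomp Require Import all_boot all_order all_algebra.
From mathcomp Require Import all_classical all_reals all_analysis.
From mathcomp Require Import measurable_realfun.
From mathcomp Require Import ring lra.

Set Implicit Arguments.
Unset Strict Implicit.
Unset Printing Implicit Defensive.
Import Order.TTheory GRing.Theory Num.Theory.
Import numFieldNormedType.Exports.

Local Open Scope classical_set_scope.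
Local Open Scope ring_scope.

(** The potential u is only lower semicontinuous, so weak convergence cannot be tested on it. It is
    replaced throughout by truncated potentials, which are continuous, lie below u and increase to
    u. Positivity of the energy of a signed measure is classically read off the Fourier transform of
    the kernel. Here a signed measure never meets the singular kernel: for r < 1 and a finite order
    m the energy form is a finite sum of squares of moments, and r -> 1 is taken in scalar
    inequalities only. The regularized kernel is bounded, so the diagonal terms absent from the
    discrete energy cost only O(1/n). It is compared with the singular kernel on two sides: from
    above everywhere off the diagonal, and from below at a fixed truncation scale e on a bounded
    set. Hence e is always fixed before r. The condition alpha <= 2 enters through the maximum
    principle alone; the bound u <= W that it yields is then used for the sign of the summands of
    m_E, for tightness, and for the energy of muE. *)

Section real_valued_continuous.
Context {R : realType} {X : topologicalType}.
Implicit Types f g : X -> R.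

Lemma cts_cst (c : R) : continuous (fun _ : X => c).
Proof. by move=> x; exact: cvg_cst. Qed.

Lemma ctsD f g : continuous f -> continuous g -> continuous (fun x => f x + g x).
Proof. by move=> cf cg x; apply: cvgD; [exact: cf|exact: cg]. Qed.

Lemma ctsN f : continuous f -> continuous (fun x => - f x).
Proof. by move=> cf x; apply: cvgN; exact: cf. Qed.

Lemma ctsB f g : continuous f -> continuous g -> continuous (fun x => f x - g x).
Proof. by move=> cf cg; apply: ctsD => //; exact: ctsN. Qed.

Lemma ctsM f g : continuous f -> continuous g -> continuous (fun x => f x * g x).
Proof. by move=> cf cg x; apply: cvgM; [exact: cf|exact: cg]. Qed.

Lemma ctsV f : (forall x, f x != 0) -> continuous f ->
  continuous (fun x => (f x)^-1).
Proof. by move=> f0 cf x; apply: cvgV => //; exact: cf. Qed.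

Lemma ctsX f n : continuous f -> continuous (fun x => f x ^+ n).
Proof.
move=> cf; elim: n => [|n IH]; first exact: cts_cst.
by under eq_fun do rewrite exprS; exact: ctsM.
Qed.

Lemma cts_comp (h : R -> R) f : continuous h -> continuous f ->
  continuous (fun x => h (f x)).
Proof. by move=> ch cf x; apply: (@continuous_comp _ _ _ f h); [exact: cf|exact: ch]. Qed.

Lemma cts_max f g : continuous f -> continuous g ->
  continuous (fun x => Num.max (f x) (g x)).
Proof. by move=> cf cg x; apply: continuous_max; [exact: cf|exact: cg]. Qed.

Lemma cts_min f g : continuous f -> continuous g ->
  continuous (fun x => Num.min (f x) (g x)).
Proof. by move=> cf cg x; apply: continuous_min; [exact: cf|exact: cg]. Qed.

Lemma cts_closed_le f (c : R) : continuous f -> closed [set x | f x <= c].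
Proof.
move=> cf; have -> : [set x | f x <= c] = f @^-1` [set r | r <= c] by [].
by apply: preimage_closed; [move=> x _; exact: cf|exact: closed_le].
Qed.

End real_valued_continuous.

(** * Binomial series *)

Section binomial_series.
Context {R : realType}.
Implicit Types (p s z l : R) (m j : nat).

(** The coefficient of z^j in (1 - z)^-p: the rising factorial of p over j!. Its positivity for p >
    0 is what later makes the energy form a sum of positive multiples of squares. *)
Definition binc p j : R := \prod_(i < j) ((p + i%:R) / i.+1%:R).

Definition binpoly p m : {poly R} := \poly_(j < m) binc p j.

Definition binrem p m z : R := (1 - z) `^ (- p) - (binpoly p m).[z].

Lemma binc_gt0 p j : 0 < p -> 0 < binc p j.
Proof.
by move=> p0; apply: prodr_gt0 => i _; rewrite divr_gt0// ltr_wpDr.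
Qed.

(** Coefficientwise form of the derivative of (1 - z)^-p being p (1 - z)^-(p + 1). *)
Lemma bincS p j : j.+1%:R * binc p j.+1 = p * binc (p + 1) j.
Proof.
have E i : binc p i.+1 = binc p i * ((p + i%:R) / i.+1%:R).
  by rewrite /binc big_ord_recr.
have E1 i : binc (p + 1) i.+1 = binc (p + 1) i * ((p + 1 + i%:R) / i.+1%:R).
  by rewrite /binc big_ord_recr.
have H i : binc p i * (p + i%:R) = p * binc (p + 1) i.
  elim: i => [|i IH]; first by rewrite /binc !big_ord0; ring.
  rewrite E E1 mulrA mulrA -IH; have : i.+1%:R != 0 :> R by rewrite pnatr_eq0.
  by rewrite -natr1 => ?; field.
by rewrite E mulrC mulrA mulfVK ?pnatr_eq0.
Qed.

Lemma deriv_binpoly p m : (binpoly p m.+1)^`() = p *: binpoly (p + 1) m.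
Proof.
apply/polyP => i; rewrite coef_deriv coefZ !coef_poly ltnS.
case: ifP => _; last by rewrite mul0rn mulr0.
by rewrite -mulr_natl bincS.
Qed.

Lemma is_derive_binrem p m z : z < 1 ->
  is_derive z (1 : R) (binrem p m.+1) (p * binrem (p + 1) m z).
Proof.
move=> z1; rewrite /binrem.
have D1 : is_derive z (1 : R) (fun x : R => 1 - x) (-1).
  have D := is_deriveB (is_derive_cst (1 : R) z (1 : R)) (is_derive_id z (1 : R)).
  by apply: (is_derive_eq D); rewrite sub0r.
have P1 : 0 < 1 - z by rewrite subr_gt0.
have D2 := is_derive1_powR (- p) P1.
have D3 := @is_derive1_comp _ (@powR R ^~ (- p)) (fun x : R => 1 - x) z _ _ D2 D1.
have D4 := is_derive_poly (binpoly p m.+1) z.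
rewrite deriv_binpoly in D4.
have D5 := is_deriveB D3 D4.
apply: (is_derive_eq D5).
rewrite hornerZ /binrem /GRing.scale/= (_ : - (p + 1) = - p - 1); last by ring.
ring.
Qed.

(* Induction on m: the derivative in s of each side is p times the
   corresponding side for (p + 1, m - 1), and both vanish at s = 0. *)
Lemma binrem_scale p m s l : 0 < p -> 0 <= s < 1 -> `|l| <= 1 ->
  `|binrem p m (l * s)| <= `|l| ^+ m * binrem p m s.
Proof.
elim: m p s l => [|m IH] p s l p0 /andP[s0 s1] l1.
  rewrite /binrem /binpoly poly_def big_ord0 !horner0 !subr0 expr0 mul1r.
  have ls : l * s <= s.
    by rewrite (le_trans (ler_norm _))// normrM (ger0_norm s0) ler_piMl.
  have ls1 : 0 < 1 - l * s by rewrite subr_gt0 (le_lt_trans ls).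
  have s1' : 0 < 1 - s by rewrite subr_gt0.
  rewrite ger0_norm ?powR_ge0// !powRN lef_pV2 ?posrE ?powR_gt0//.
  by apply: (ge0_ler_powR (ltW p0)); rewrite ?nnegrE ?lerD2l ?lerN2//; exact: ltW.
(* Treating both signs e at once replaces the absolute value by a one-sided inequality, to which the
   mean value theorem applies. *)
suff H (e : R) : `|e| = 1 ->
    0 <= `|l| ^+ m.+1 * binrem p m.+1 s - e * binrem p m.+1 (l * s).
  rewrite ler_norml -subr_ge0 -[X in _ && X]subr_ge0; apply/andP; split.
    have := H (-1); rewrite normrN1 => /(_ erefl); lra.
  have := H 1; rewrite normr1 => /(_ erefl); lra.
move=> e1.
have [s00|sn0] := eqVneq s 0.
  have z0 : binrem p m.+1 0 = 0.
    rewrite /binrem subr0 powR1 horner_coef0 coef_poly ltn0Sn /binc big_ord0.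
    by rewrite subrr.
  by rewrite s00 mulr0 z0 !mulr0 subrr.
have spos : 0 < s by rewrite lt_neqAle eq_sym sn0.
pose h x := `|l| ^+ m.+1 * binrem p m.+1 x - e * binrem p m.+1 (l * x).
pose dh x := `|l| ^+ m.+1 * (p * binrem (p + 1) m x)
             - e * (l * (p * binrem (p + 1) m (l * x))).
have Dh x : 0 <= x <= s -> is_derive x (1 : R) h (dh x).
  move=> /andP[x0 xs].
  have x1 : x < 1 by rewrite (le_lt_trans xs).
  have lx1 : l * x < 1.
    by rewrite (le_lt_trans _ x1)// (le_trans (ler_norm _))// normrM
       (ger0_norm x0) ler_piMl.
  have D1 := is_derive_binrem p m x1.
  have D2 := is_derive_binrem p m lx1.
  have D3 : is_derive x (1 : R) (fun y : R => l * y) l.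
    have D := @is_deriveZ R R R id l x 1 1 (is_derive_id x 1).
    by apply: (is_derive_eq D); rewrite /GRing.scale/= mulr1.
  have D4 := @is_derive1_comp _ (binrem p m.+1) (fun y : R => l * y) x _ _ D2 D3.
  have D5 := is_deriveB (is_deriveZ (`|l| ^+ m.+1) D1) (is_deriveZ e D4).
  apply: (is_derive_eq D5).
  by rewrite /dh /GRing.scale/=; ring.
have [] := @MVT_segment R h dh 0 s s0.
- move=> x; rewrite in_itv/= => /andP[a b]; apply: Dh.
  by rewrite !ltW.
- apply/derivable_within_continuous => x; rewrite in_itv/= => Hx.
  by have [] := Dh _ Hx.
move=> c; rewrite in_itv/= => /andP[c0 cs].
have h0 : h 0 = 0.
  have z0 : binrem p m.+1 0 = 0.
    rewrite /binrem subr0 powR1 horner_coef0 coef_poly ltn0Sn /binc big_ord0.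
    by rewrite subrr.
  by rewrite /h mulr0 z0 !mulr0 subrr.
rewrite h0 !subr0 -/(h s) => ->.
rewrite mulr_ge0// /dh subr_ge0.
have p10 : 0 < p + 1 by rewrite ltr_wpDr.
have c01 : 0 <= c < 1 by rewrite c0 (le_lt_trans cs).
have := IH (p + 1) c l p10 c01 l1 => IHc.
rewrite (le_trans (ler_norm _))// !normrM e1 mul1r (gtr0_norm p0) exprS.
rewrite -!mulrA; apply: ler_wpM2l => //.
by rewrite [leRHS]mulrCA; apply: ler_wpM2l => //; exact: ltW.
Qed.

Lemma binrem_le p m s : 0 < p -> 0 <= s < 1 -> binrem p m s <= (1 - s) `^ (- p).
Proof.
move=> p0 /andP[s0 s1]; rewrite /binrem gerBl horner_poly.
apply: sumr_ge0 => i _.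
by rewrite mulr_ge0 ?exprn_ge0// ltW// binc_gt0.
Qed.

Lemma binomial_series_unif p r (e : R) : 0 < p -> 0 <= r < 1 -> 0 < e ->
  exists N, forall m, (N <= m)%N -> forall z, `|z| <= 1 ->
    `|(1 - r * z) `^ (- p) - \sum_(j < m) binc p j * r ^+ j * z ^+ j| <= e.
Proof.
move=> p0 /andP[r0 r1] e0.
(* A point strictly between r and 1: scaling from s down to r z gains the factor (r / s)^m,
   uniformly in |z| <= 1. *)
pose s := (1 + r) / 2.
have s0 : 0 < s by rewrite /s; lra.
have s1 : s < 1 by rewrite /s; lra.
have rs : r < s by rewrite /s; lra.
have l1 : 0 <= r / s < 1 by rewrite divr_ge0 ?(ltW s0)//= ltr_pdivrMr// mul1r.
pose C := (1 - s) `^ (- p).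
have C0 : 0 < C by rewrite powR_gt0// subr_gt0.
have : (r / s) ^+ n @[n --> \oo] --> 0.
  by apply: cvg_expr; rewrite ger0_norm; case/andP: l1.
move=> /cvgrPdist_le /(_ (e / C) (divr_gt0 e0 C0)) [N _ HN].
exists N => m Nm z z1.
have lz : `|r * z / s| <= r / s.
  rewrite -mulrA mulrCA normrM (@ger0_norm _ (r / s)); last by case/andP: l1.
  by rewrite ler_piMl//; case/andP: l1.
have := @binrem_scale p m s (r * z / s) p0.
rewrite (ltW s0) s1 => /(_ isT).
have lz1 : `|r * z / s| <= 1 by rewrite (le_trans lz)// ltW//; case/andP: l1.
move=> /(_ lz1); rewrite divfK ?gt_eqF// /binrem horner_poly.
under eq_bigr do rewrite exprMn mulrA.
move=> /le_trans; apply.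
have H : `|r * z / s| ^+ m <= e / C.
  have := HN _ Nm; rewrite /= sub0r normrN ger0_norm; last first.
    by rewrite exprn_ge0//; case/andP: l1.
  apply: le_trans; rewrite lerXn2r ?nnegrE//; by case/andP: l1.
have := binrem_le m p0 (_ : 0 <= s < 1); rewrite (ltW s0) s1 => /(_ isT) H2.
rewrite (le_trans (ler_wpM2l _ H2)) ?exprn_ge0// -/C.
by rewrite -ler_pdivlMr.
Qed.

(** [binrem_scale] at s = 1/2 with ratio 2 z: the constant is 2^4 times (1 - 1/2)^-p. *)
Lemma powR_taylor4 p z : 0 < p -> `|z| <= 1 / 2 ->
  (binpoly p 4).[z] - (16 * 2 `^ p) * z ^+ 4 <= (1 - z) `^ (- p).
Proof.
move=> p0 z2.
have h : 0 <= (1 / 2 : R) < 1 by apply/andP; split; lra.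
have := @binrem_scale p 4 (1 / 2) (2 * z) p0 h.
have -> : 2 * z * (1 / 2) = z by field.
have -> : `|2 * z| <= 1 by rewrite normrM normr_nat; lra.
move=> /(_ isT) H.
have := binrem_le 4 p0 h.
have -> : 1 - 1 / 2 = 2^-1 :> R by field.
have -> : (2^-1 : R) `^ (- p) = 2 `^ p.
  by rewrite -[X in X `^ _]powR_inv1// -powRrM mulrN mulN1r opprK.
move=> H2.
have : `|2 * z| ^+ 4 * binrem p 4 (1 / 2) <= `|2 * z| ^+ 4 * 2 `^ p.
  apply: ler_wpM2l; [exact: exprn_ge0|exact: H2].
move: H; have -> : `|2 * z| ^+ 4 = 16 * z ^+ 4.
  rewrite -normrX ger0_norm ?exprn_even_ge0//; ring.
move=> H H3; have := le_trans H H3.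
by rewrite ler_norml => /andP[+ _]; rewrite /binrem; lra.
Qed.

End binomial_series.

(** * Euclidean norm *)

Lemma lipschitz_continuous_norm {R : realType} (V : normedModType R)
    (f : V -> R) (C : R) :
  (forall x y, `|f x - f y| <= C * `|x - y|) -> continuous f.
Proof.
move=> fC x; apply/cvgrPdist_lt => e e0; near=> y.
pose D := `|C| + 1; have D0 : 0 < D by rewrite ltr_wpDl.
apply: (@le_lt_trans _ _ (D * `|x - y|)).
  rewrite (le_trans (fC x y))// ler_wpM2r// /D.
  by rewrite (le_trans (ler_norm C))// lerDl.
rewrite -ltr_pdivlMl//; near: y; apply: cvgr_dist_lt => //.
by rewrite mulr_gt0// invr_gt0 ltr_wpDl.
Unshelve. all: by end_near. Qed.

Section euclidean_norm.
Context {R : realType} {d : nat}.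
Implicit Types (x y z : 'rV[R]_d) (i : 'I_d).

Definition sqnorm x : R := \sum_(i < d) x ord0 i ^+ 2.

Definition dotv x y : R := \sum_(i < d) x ord0 i * y ord0 i.

Lemma sqnorm_ge0 x : 0 <= sqnorm x.
Proof. by apply: sumr_ge0 => i _; rewrite sqr_ge0. Qed.

Lemma enorm_ge0 x : 0 <= enorm x.
Proof. exact: sqrtr_ge0. Qed.

Lemma sqr_enorm x : enorm x ^+ 2 = sqnorm x.
Proof. by rewrite sqr_sqrtr// sqnorm_ge0. Qed.

Lemma enorm_eq0 x : (enorm x == 0) = (x == 0).
Proof.
apply/idP/idP => [|/eqP->]; last first.
  rewrite /enorm big1 ?sqrtr0// => i _.
  by rewrite mxE expr0n.
rewrite -sqrf_eq0 sqr_enorm psumr_eq0; last by move=> i _; rewrite sqr_ge0.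
move=> /allP H; apply/eqP/rowP => i; rewrite mxE.
by apply/eqP; rewrite -sqrf_eq0; apply: H; rewrite mem_index_enum.
Qed.

Lemma enorm_gt0 x : (0 < enorm x) = (x != 0).
Proof. by rewrite lt_def enorm_ge0 andbT enorm_eq0. Qed.

Lemma enormN x : enorm (- x) = enorm x.
Proof.
by congr Num.sqrt; apply: eq_bigr => i _; rewrite mxE sqrrN.
Qed.

Lemma enormB x y : enorm (x - y) = enorm (y - x).
Proof. by rewrite -enormN opprB. Qed.

Lemma sqnormD x y : sqnorm (x + y) = sqnorm x + 2 * dotv x y + sqnorm y.
Proof.
rewrite /sqnorm /dotv mulr_sumr -!big_split/=; apply: eq_bigr => i _.
by rewrite mxE; ring.
Qed.

(** Cauchy-Schwarz, by expanding |b x - a y|^2 >= 0 with a = |x| and b = |y|. *)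
Lemma dotv_le x y : dotv x y <= enorm x * enorm y.
Proof.
have [->|x0] := eqVneq x 0.
  by rewrite /dotv big1 ?mulr_ge0 ?enorm_ge0// => i _; rewrite mxE mul0r.
have [->|y0] := eqVneq y 0.
  by rewrite /dotv big1 ?mulr_ge0 ?enorm_ge0// => i _; rewrite mxE mulr0.
set a := enorm x; set b := enorm y.
have a0 : 0 < a by rewrite enorm_gt0.
have b0 : 0 < b by rewrite enorm_gt0.
have : 0 <= \sum_(i < d) (b * x ord0 i - a * y ord0 i) ^+ 2.
  by apply: sumr_ge0 => i _; rewrite sqr_ge0.
have -> : \sum_(i < d) (b * x ord0 i - a * y ord0 i) ^+ 2 =
    b ^+ 2 * sqnorm x - 2 * a * b * dotv x y + a ^+ 2 * sqnorm y.
  rewrite /sqnorm /dotv !mulr_sumr -sumrB -big_split/=.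
  by apply: eq_bigr => i _; ring.
rewrite -!sqr_enorm -/a -/b => H.
have : 0 <= (2 * a * b) * (a * b - dotv x y).
  by apply: (le_trans H); rewrite le_eqVlt; apply/orP; left; apply/eqP; ring.
by rewrite pmulr_rge0 ?subr_ge0// !mulr_gt0.
Qed.

Lemma ler_enormD x y : enorm (x + y) <= enorm x + enorm y.
Proof.
rewrite -(@ler_pXn2r _ 2)// ?nnegrE ?addr_ge0 ?enorm_ge0//.
rewrite sqr_enorm sqnormD sqrrD !sqr_enorm lerD2r lerD2l.
by rewrite -[in leRHS]mulr_natl ler_wpM2l// dotv_le.
Qed.

Lemma enorm_coord x i : `|x ord0 i| <= enorm x.
Proof.
rewrite -(@ler_pXn2r _ 2)// ?nnegrE ?enorm_ge0// sqr_enorm real_normK ?num_real//.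
by rewrite /sqnorm (bigD1 i)//= lerDl; apply: sumr_ge0 => j _; rewrite sqr_ge0.
Qed.

Lemma coord_le_norm x i : `|x ord0 i| <= `|x|.
Proof.
rewrite [leRHS]/Num.norm/= mx_normrE.
by rewrite (le_bigmax _ _ (ord0, i)).
Qed.

Lemma norm_le_enorm x : `|x| <= enorm x.
Proof.
rewrite [leLHS]/Num.norm/= mx_normrE; apply/bigmax_leP; split.
  exact: enorm_ge0.
by move=> [j i] _/=; rewrite ord1 enorm_coord.
Qed.

Lemma enorm_le_norm x : enorm x <= d%:R * `|x|.
Proof.
rewrite -(@ler_pXn2r _ 2)// ?nnegrE ?enorm_ge0 ?mulr_ge0// sqr_enorm.
have [d0|d0] := eqVneq d 0.
  rewrite /sqnorm big1 ?sqr_ge0// => i _.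
  by have := ltn_ord i; rewrite [X in (_ < X)%N]d0.
apply: (@le_trans _ _ (\sum_(i < d) `|x| ^+ 2)).
  apply: ler_sum => i _; rewrite -[leLHS]real_normK ?num_real//.
  by rewrite lerXn2r ?nnegrE ?coord_le_norm.
rewrite sumr_const card_ord -[leLHS]mulr_natl exprMn ler_wpM2r ?exprn_ge0//.
by rewrite expr2 ler_peMl// ler1n lt0n.
Qed.

End euclidean_norm.

(** * Borel measurability and continuity of the Euclidean norm *)

Section borel.
Context {R : realType} {d : nat}.
Notation T := (borel_rV R d).

Lemma open_measurable_rV (A : set T) :
  open (A : set 'rV[R]_d) -> measurable A.
Proof. by move=> oA; apply: sub_sigma_algebra. Qed.

Lemma closed_measurable_rV (A : set T) :
  closed (A : set 'rV[R]_d) -> measurable A.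
Proof.
move=> cA; rewrite -(setCK A); apply: measurableC; apply: open_measurable_rV.
exact: closed_openC.
Qed.

Lemma continuous_measurable_rV (f : 'rV[R]_d -> R) :
  continuous f -> measurable_fun [set: T] (f : T -> R).
Proof.
move=> /continuousP cf; apply: (measurability _ (RGenOpens.measurableE R)).
move=> _ [_ [a [b ->] <-]]; rewrite setTI; apply: open_measurable_rV.
exact/cf/interval_open.
Qed.

Lemma ler_dist_enorm (x y : 'rV[R]_d) : `|enorm x - enorm y| <= enorm (x - y).
Proof.
have := ler_enormD (x - y) y; have := ler_enormD (y - x) x.
rewrite !subrK (enormB y x) => H1 H2; rewrite ler_norml; apply/andP; split; lra.
Qed.

Lemma lipschitz_enorm_continuous (f : 'rV[R]_d -> R) (C : R) : 0 <= C ->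
  (forall x y, `|f x - f y| <= C * enorm (x - y)) -> continuous f.
Proof.
move=> C0 fC; apply: (@lipschitz_continuous_norm _ _ _ (C * d%:R)) => x y.
rewrite (le_trans (fC x y))// -mulrA ler_wpM2l//.
exact: enorm_le_norm.
Qed.

Lemma continuous_enorm : continuous (@enorm R d).
Proof.
apply: (@lipschitz_enorm_continuous _ 1) => // x y.
by rewrite mul1r ler_dist_enorm.
Qed.

Lemma measurable_coord i :
  measurable_fun [set: T] (fun x : T => (x : 'rV[R]_d) ord0 i).
Proof. by apply: continuous_measurable_rV; apply: coord_continuous. Qed.

(** Pairs carry the product sigma-algebra, which is not presented by open sets; measurability is
    therefore read off the coordinates. *)
Lemma measurable_sqnormB : measurable_fun [set: T * T]
  (fun z : T * T => sqnorm ((z.1 : 'rV[R]_d) - z.2)).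
Proof.
rewrite /sqnorm; apply: measurable_sum => i.
under eq_fun do rewrite !mxE.
apply: measurable_funX; apply: measurable_funB.
  exact: (measurableT_comp (measurable_coord i)).
exact: (measurableT_comp (measurable_coord i)).
Qed.

Lemma measurable_enormB : measurable_fun [set: T * T]
  (fun z : T * T => enorm ((z.1 : 'rV[R]_d) - z.2)).
Proof.
apply: (eq_measurable_fun (fun z : T * T =>
   sqnorm ((z.1 : 'rV[R]_d) - z.2) `^ 2^-1)).
  by move=> z _; rewrite powR12_sqrt ?sqnorm_ge0.
apply: (measurableT_comp (measurable_powR _)); exact: measurable_sqnormB.
Qed.

End borel.

(** * Energies and variation of the equilibrium measure *)

Lemma ge0_integral_mrestr {d0} {T : measurableType d0} {R : realType}
    (mu : {measure set T -> \bar R}) (D : set T) (mD : measurable D)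
    (f : T -> \bar R) : measurable_fun setT f -> (forall x, 0 <= f x)%E ->
  (\int[mrestr mu mD]_x f x = \int[mu]_(x in D) f x)%E.
Proof.
move=> mf f0.
rewrite (@ge0_negligible_integral _ _ _ _ setT (~` D))//=; last 2 first.
- exact: measurableC.
- by rewrite /mrestr setICl measure0.
rewrite setDE setCK setTI; apply: eq_measure_integral => A mA AD /=.
by rewrite /mrestr setIidl.
Qed.

Lemma ge0_integral_addscale {d0} {T : measurableType d0} {R : realType}
    (m1 m2 : {measure set T -> \bar R}) (t : {nonneg R}) (f : T -> \bar R) :
  measurable_fun setT f -> (forall x, 0 <= f x)%E ->
  (\int[measure_add m1 (mscale t m2)]_x f x =
   \int[m1]_x f x + t%:num%:E * \int[m2]_x f x)%E.
Proof.
by move=> mf f0; rewrite ge0_integral_measure_add// ge0_integral_mscale.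
Qed.

Lemma mnormalizeE {d0} {T : measurableType d0} {R : realType}
    (m : {measure set T -> \bar R}) (P : probability T R) (c : R) (A : set T) :
  0 < c -> m setT = c%:E -> mnormalize m P A = (m A * c^-1%:E)%E.
Proof. by move=> c0 mc; rewrite /= /mnormalize mc/= eqe gt_eqF. Qed.

Lemma ge0_integral_mnormalize {d0} {T : measurableType d0} {R : realType}
    (m : {measure set T -> \bar R}) (P : probability T R) (c : R)
    (f : T -> \bar R) :
  0 < c -> m setT = c%:E -> measurable_fun setT f -> (forall x, 0 <= f x)%E ->
  (\int[mnormalize m P]_x f x = c^-1%:E * \int[m]_x f x)%E.
Proof.
move=> c0 mc mf f0.
have ci0 : 0 <= c^-1 by rewrite invr_ge0 ltW.
transitivity (\int[mscale (NngNum ci0) m]_x f x)%E; last first.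
  by rewrite ge0_integral_mscale.
apply: eq_measure_integral.
by move=> A mA _; rewrite /= (mnormalizeE _ _ c0 mc) muleC.
Qed.

Section riesz_kernel.
Context {R : realType} {d : nat} (alpha : R).
Notation T := (borel_rV R d).
Local Open Scope ereal_scope.
Implicit Types (x y : 'rV[R]_d).

Lemma riesz_ge0 x : 0 <= riesz alpha x.
Proof. by rewrite /riesz; case: ifP => // _; rewrite lee_fin powR_ge0. Qed.

Lemma rieszN x : riesz alpha (- x)%R = riesz alpha x.
Proof. by rewrite /riesz oppr_eq0 enormN. Qed.

Lemma rieszB x y : riesz alpha (x - y)%R = riesz alpha (y - x)%R.
Proof. by rewrite -rieszN opprB. Qed.

Lemma measurable_riesz :
  measurable_fun [set: T * T] (fun z : T * T =>
    riesz alpha ((z.1 : 'rV[R]_d) - z.2)%R).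
Proof.
rewrite /riesz; apply: measurable_fun_ifT => //=.
  apply: (eq_measurable_fun (fun z : T * T =>
    enorm ((z.1 : 'rV[R]_d) - z.2)%R == 0%R)).
    by move=> z _; rewrite enorm_eq0.
  exact: (measurable_fun_eqr measurable_enormB).
apply/measurable_EFinP; apply: (measurableT_comp (measurable_powR _)).
exact: measurable_enormB.
Qed.

Lemma measurable_rieszr x : measurable_fun [set: T] (fun y : T =>
   riesz alpha (x - (y : 'rV[R]_d))%R).
Proof.
exact: (measurableT_comp measurable_riesz (pair1_measurable (x : T))).
Qed.

Lemma potential_ge0 (mu : {measure set T -> \bar R}) x :
  0 <= potential alpha mu x.
Proof. by apply: integral_ge0 => y _; exact: riesz_ge0. Qed.

Lemma measurable_potential (mu : {finite_measure set T -> \bar R}) :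
  measurable_fun [set: T] (potential alpha mu : T -> \bar R).
Proof.
exact: (@measurable_fun_fubini_tonelli_F _ _ T T R mu _ measurable_riesz
  (fun z => riesz_ge0 _)).
Qed.

Definition mutual (mu nu : {measure set T -> \bar R}) : \bar R :=
  \int[mu]_x potential alpha nu x.

Lemma mutualC (mu nu : {finite_measure set T -> \bar R}) :
  mutual mu nu = mutual nu mu.
Proof.
rewrite /mutual /potential.
have := @fubini_tonelli _ _ T T R mu nu _ measurable_riesz (fun z => riesz_ge0 _).
move=> /= ->; apply: eq_integral => y _; apply: eq_integral => x _.
exact: rieszB.
Qed.

Lemma mutual_ge0 (mu nu : {measure set T -> \bar R}) : 0 <= mutual mu nu.
Proof. by apply: integral_ge0 => x _; exact: potential_ge0. Qed.

Lemma energyE (mu : {measure set T -> \bar R}) : energy alpha mu = mutual mu mu.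
Proof. by []. Qed.

Section variation.
Context (E : set 'rV[R]_d) (muE : probability T R).
Hypothesis finW : robin alpha E < +oo.
Hypothesis eqE : is_equilibrium alpha E muE.

Lemma robin_fin_num : robin alpha E \is a fin_num.
Proof.
have [_ <-] := eqE; rewrite ge0_fin_numE ?mutual_ge0//.
by have [_ ->] := eqE.
Qed.

(* (muE + t nu) / (1 + t |nu|) competes with muE for all t > 0: let t -> 0. *)
Lemma variation (mE : measurable (E : set T))
    (nu : {finite_measure set T -> \bar R}) :
  nu (~` E) = 0 -> energy alpha nu < +oo ->
  robin alpha E * nu setT <= \int[nu]_x potential alpha muE x.
Proof.
move=> nuE Inu; have [muEE IE] := eqE.
rewrite -/(mutual nu muE).
have [|Uoo] := leP +oo (mutual nu muE); first by rewrite leye_eq => /eqP ->; rewrite leey.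
set th := fine (nu setT); set W := fine (robin alpha E).
set U := fine (mutual nu muE); set I := fine (energy alpha nu).
have WE : robin alpha E = W%:E by rewrite fineK// robin_fin_num.
have thE : nu setT = th%:E by rewrite fineK// fin_num_measure.
have UE : mutual nu muE = U%:E by rewrite fineK// ge0_fin_numE// mutual_ge0.
have IEn : mutual nu nu = I%:E by rewrite fineK// ge0_fin_numE// mutual_ge0.
have IEm : mutual muE muE = W%:E by rewrite -WE -IE.
have th0 : (0 <= th)%R by rewrite fine_ge0.
rewrite WE thE UE -EFinM lee_fin.
(* Minimality of muE, multiplied by the squared mass (1 + t th)^2 of the competitor. *)
have key (t : R) : (0 < t)%R -> (W * (1 + t * th) ^+ 2 <= W + 2 * t * U + t ^+ 2 * I)%R.
  move=> t0.
  pose m := measure_add muE (mscale (NngNum (ltW t0)) nu).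
  pose c := (1 + t * th)%R.
  have c0 : (0 < c)%R by rewrite ltr_wpDr// mulr_ge0// ltW.
  have mc : m setT = c%:E.
    have -> : m setT = muE setT + t%:E * nu setT by exact: measure_addE.
    by rewrite thE probability_setT -EFinM -EFinD.
  pose pi := mnormalize m muE.
  have piE : prob_on E pi.
    have mE0 : m (~` E) = 0.
      transitivity (muE (~` E) + t%:E * nu (~` E)); first exact: measure_addE.
      by have := muEE; rewrite /prob_on/= nuE => ->; rewrite mule0 adde0.
    transitivity (m (~` E) * c^-1%:E); first exact: mnormalizeE.
    by rewrite mE0 mul0e.
  have Wpi : robin alpha E <= energy alpha pi.
    by apply: ereal_inf_lbound; exists pi.
  have potpi x : potential alpha pi x =
      c^-1%:E * (potential alpha muE x + t%:E * potential alpha nu x).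
    rewrite /potential (ge0_integral_mnormalize _ c0)//; last 2 first.
    - exact: measurable_rieszr.
    - by move=> y; exact: riesz_ge0.
    rewrite ge0_integral_addscale//.
      exact: measurable_rieszr.
    by move=> y; exact: riesz_ge0.
  have potsum : measurable_fun [set: T]
      (fun x : T => potential alpha muE x + t%:E * potential alpha nu x).
    apply: emeasurable_funD; first exact: measurable_potential.
    by apply: measurable_funeM; exact: measurable_potential.
  have potsum0 x : 0 <= potential alpha muE x + t%:E * potential alpha nu x.
    by rewrite adde_ge0 ?mule_ge0 ?potential_ge0// lee_fin ltW.
  have Ipi : energy alpha pi = (c^-1 ^+ 2)%:E *
     (W%:E + 2%:E * t%:E * U%:E + (t ^+ 2)%:E * I%:E).
    rewrite energyE /mutual.
    under eq_integral do rewrite potpi.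
    have ci0 : 0 <= c^-1%:E by rewrite lee_fin invr_ge0 ltW.
    rewrite ge0_integralZl//.
    rewrite (ge0_integral_mnormalize _ c0)// muleA -EFinM -expr2; congr (_ * _).
    rewrite ge0_integral_addscale//.
    have split_int (rho : {finite_measure set T -> \bar R}) :
        \int[rho]_x (potential alpha muE x + t%:E * potential alpha nu x) =
        mutual rho muE + t%:E * mutual rho nu.
      rewrite ge0_integralD//.
      - rewrite ge0_integralZl//.
        + exact: measurable_potential.
        + by move=> x _; exact: potential_ge0.
        + by rewrite lee_fin ltW.
      - by move=> x _; exact: potential_ge0.
      - exact: measurable_potential.
      - by move=> x _; rewrite mule_ge0 ?potential_ge0// lee_fin ltW.
      - by apply: measurable_funeM; exact: measurable_potential.
    rewrite !split_int (mutualC muE nu) IEm UE IEn.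
    by rewrite -!(EFinM, EFinD); congr EFin; rewrite /=; ring.
  move: Wpi; rewrite WE Ipi -!(EFinM, EFinD) lee_fin exprVn.
  by rewrite ler_pdivlMl ?exprn_gt0// mulrC.
rewrite leNgt; apply/negP => H.
pose e := (W * th - U)%R.
have e0 : (0 < e)%R by rewrite subr_gt0.
have I0 : (0 <= I)%R by rewrite fine_ge0// mutual_ge0.
have W0 : (0 <= W)%R.
  by rewrite fine_ge0// -IE mutual_ge0.
(* This t is small enough for the first-order gain 2 t e to exceed the second-order term t^2 I. *)
have t0 : (0 < e / (I + 1))%R by rewrite divr_gt0// ltr_wpDl.
have := key _ t0; set t := (e / (I + 1))%R.
have tI : (t * I < e)%R.
  rewrite /t -mulrA gtr_pMr// ltr_pdivrMl ?mulr1 ?ltrDl// ltr_wpDl//.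
apply/negP; rewrite -ltNge.
have : (0 < t * (2 * e - t * I) + W * (t * th) ^+ 2)%R.
  have h1 : (0 <= W * (t * th) ^+ 2)%R by rewrite mulr_ge0 ?sqr_ge0.
  have h2 : (0 < t * (2 * e - t * I))%R by rewrite mulr_gt0// subr_gt0; lra.
  exact: ltr_wpDr.
rewrite /e; lra.
Qed.

End variation.

End riesz_kernel.

(** * Real-valued integrals of bounded measurable functions *)

Section bounded_integral.
Context {d0} {T : measurableType d0} {R : realType}.
Implicit Types (f g : T -> R) (mu : {finite_measure set T -> \bar R}).

(** Such functions are integrable for every finite measure, so linearity and monotonicity of the
    real-valued integral carry no other side condition. *)
Definition bmeas f :=
  measurable_fun setT f /\ exists M, forall x, `|f x| <= M.

Lemma bmeas_cst c : bmeas (fun=> c).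
Proof. by split; [exact: measurable_cst|exists `|c|]. Qed.

Lemma bmeasD f g : bmeas f -> bmeas g -> bmeas (fun x => f x + g x).
Proof.
move=> [mf [M Mf]] [mg [N Ng]]; split; first exact: measurable_funD.
by exists (M + N) => x; rewrite (le_trans (ler_normD _ _))// lerD.
Qed.

Lemma bmeasN f : bmeas f -> bmeas (fun x => - f x).
Proof.
move=> [mf [M Mf]]; split; first exact: measurableT_comp.
by exists M => x; rewrite normrN.
Qed.

Lemma bmeasB f g : bmeas f -> bmeas g -> bmeas (fun x => f x - g x).
Proof. by move=> bf bg; apply: bmeasD => //; exact: bmeasN. Qed.

Lemma bmeasM f g : bmeas f -> bmeas g -> bmeas (fun x => f x * g x).
Proof.
move=> [mf [M Mf]] [mg [N Ng]]; split; first exact: measurable_funM.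
by exists (M * N) => x; rewrite normrM ler_pM.
Qed.

Lemma bmeas_sum (I : Type) (s : seq I) (P : pred I) (F : I -> T -> R) :
  (forall i, bmeas (F i)) -> bmeas (fun x => \sum_(i <- s | P i) F i x).
Proof.
move=> bF; elim: s => [|i s IH].
  by under eq_fun do rewrite big_nil; exact: bmeas_cst.
under eq_fun do rewrite big_cons.
by case: (P i) => //; exact: bmeasD.
Qed.

Lemma bmeas_indic (A : set T) : measurable A -> bmeas (\1_A : T -> R).
Proof.
move=> mA; split; first exact: measurable_indic.
by exists 1 => x; rewrite indicE; case: (_ \in _); rewrite ?normr1 ?normr0.
Qed.

Lemma bmeas_integrable mu f : bmeas f -> mu.-integrable setT (EFin \o f).
Proof.
move=> [mf [M Mf]]; apply: measurable_bounded_integrable => //.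
  by rewrite ltey_eq fin_num_measure.
exists M; split; first exact: num_real.
by move=> y My x _; exact: (le_trans (Mf x) (ltW My)).
Qed.

Lemma bintE mu f : bmeas f -> (\int[mu]_x (f x)%:E)%E = (\int[mu]_x f x)%:E.
Proof.
by move=> bf; rewrite fineK//; apply: integrable_fin_num => //;
  exact: bmeas_integrable.
Qed.

Lemma bintD mu f g : bmeas f -> bmeas g ->
  \int[mu]_x (f x + g x) = \int[mu]_x f x + \int[mu]_x g x.
Proof. by move=> bf bg; rewrite RintegralD//; exact: bmeas_integrable. Qed.

Lemma bintB mu f g : bmeas f -> bmeas g ->
  \int[mu]_x (f x - g x) = \int[mu]_x f x - \int[mu]_x g x.
Proof. by move=> bf bg; rewrite RintegralB//; exact: bmeas_integrable. Qed.

Lemma bintZl mu f c : bmeas f ->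
  \int[mu]_x (c * f x) = c * \int[mu]_x f x.
Proof. by move=> bf; rewrite RintegralZl//; exact: bmeas_integrable. Qed.

Lemma bintZr mu f c : bmeas f ->
  \int[mu]_x (f x * c) = (\int[mu]_x f x) * c.
Proof. by move=> bf; rewrite RintegralZr//; exact: bmeas_integrable. Qed.

Lemma bint_cst mu c : \int[mu]_x c = c * fine (mu setT).
Proof. by rewrite Rintegral_cst. Qed.

Lemma bint_sum mu (I : Type) (s : seq I) (P : pred I) (F : I -> T -> R) :
  (forall i, bmeas (F i)) ->
  \int[mu]_x (\sum_(i <- s | P i) F i x) =
  \sum_(i <- s | P i) \int[mu]_x F i x.
Proof.
move=> bF; elim: s => [|i s IH].
  rewrite big_nil; under eq_Rintegral do rewrite big_nil.
  by rewrite bint_cst mul0r.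
rewrite big_cons -IH; under eq_Rintegral do rewrite big_cons.
case: (P i) => //; rewrite bintD//.
exact: bmeas_sum.
Qed.

Lemma bint_le mu f g : bmeas f -> bmeas g -> (forall x, f x <= g x) ->
  \int[mu]_x f x <= \int[mu]_x g x.
Proof. by move=> bf bg fg; apply: le_Rintegral => //; exact: bmeas_integrable. Qed.

Lemma bint_norm_le mu f C : bmeas f -> (forall x, `|f x| <= C) ->
  `|\int[mu]_x f x| <= C * fine (mu setT).
Proof.
move=> bf fC; rewrite ler_norml -bint_cst -mulrN1 -bintZr; last first.
  exact: bmeas_cst.
apply/andP; split; apply: bint_le => //; try exact: bmeas_cst.
  by move=> x; have := fC x; rewrite ler_norml => /andP[+ _]; rewrite mulrN1.
by move=> x; have := fC x; rewrite ler_norml => /andP[_].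
Qed.

End bounded_integral.

Section truncated_kernel.
Context {R : realType}.
Implicit Types (q e a b : R).

Lemma powRN_anti q a b : 0 <= q -> 0 < a -> a <= b -> b `^ (- q) <= a `^ (- q).
Proof.
move=> q0 a0 ab; have b0 : 0 < b by exact: lt_le_trans ab.
rewrite !powRN lef_pV2 ?posrE ?powR_gt0//.
by apply: (ge0_ler_powR q0); rewrite ?nnegrE//; exact: ltW.
Qed.

(** Mean value theorem: on [e, +oo[ the derivative of x^-q is largest in modulus at e. *)
Lemma powRN_lip q e a b : 0 <= q -> 0 < e -> e <= a -> e <= b ->
  `|a `^ (- q) - b `^ (- q)| <= q * e `^ (- q - 1) * `|a - b|.
Proof.
move=> q0 e0.
wlog ab : a b / a <= b.
  move=> H ea eb; case: (leP a b) => [|/ltW] ab; first exact: H.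
  by rewrite distrC (distrC a); exact: H.
move=> ea eb.
have [] := @MVT_segment R (@powR R ^~ (- q)) (fun x => - q * x `^ (- q - 1)) a b ab.
- move=> x; rewrite in_itv/= => /andP[ax _].
  by apply: is_derive1_powR; rewrite (lt_le_trans e0)// (le_trans ea)// ltW.
- apply/derivable_within_continuous => x; rewrite in_itv/= => /andP[ax _].
  have x0 : 0 < x by rewrite (lt_le_trans e0)// (le_trans ea).
  by have [] := is_derive1_powR (- q) x0.
move=> c; rewrite in_itv/= => /andP[ac cb] H.
rewrite distrC H normrM (distrC a) ler_wpM2r// normrM normrN (ger0_norm q0).
rewrite ler_wpM2l// ger0_norm ?powR_ge0// -opprD.
by apply: powRN_anti; rewrite ?addr_ge0// (le_trans ea).
Qed.

End truncated_kernel.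

Section bounded_integral_null.
Context {d0} {T : measurableType d0} {R : realType}.
Implicit Types (f g : T -> R) (mu : {finite_measure set T -> \bar R}).

Lemma bint_indic mu (A : set T) : measurable A ->
  \int[mu]_x (\1_A x : R) = fine (mu A).
Proof. by move=> mA; rewrite /Rintegral integral_indic// setIT. Qed.

Lemma bint_le_null mu (N : set T) f g : bmeas f -> bmeas g ->
  measurable N -> mu N = 0%E -> (forall x, ~ N x -> f x <= g x) ->
  \int[mu]_x f x <= \int[mu]_x g x.
Proof.
move=> bf bg mN N0 fg.
have bfg := bmeasB bf bg; have [_ [M fgM]] := bfg.
have bN := bmeas_indic (R := R) mN.
have -> : \int[mu]_x g x = \int[mu]_x (g x + M * \1_N x).
  rewrite bintD//; last by apply: bmeasM => //; exact: bmeas_cst.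
  by rewrite bintZl// bint_indic// N0 mulr0 addr0.
apply: bint_le => //.
  by apply: bmeasD => //; apply: bmeasM => //; exact: bmeas_cst.
move=> x; rewrite indicE; have [xN|xN] := boolP (x \in N).
  by rewrite mulr1 -lerBlDl (le_trans (ler_norm _)).
by rewrite mulr0 addr0 fg// => Nx; move: xN; rewrite mem_set.
Qed.

Lemma bint_eq_null mu (N : set T) f g : bmeas f -> bmeas g ->
  measurable N -> mu N = 0%E -> (forall x, ~ N x -> f x = g x) ->
  \int[mu]_x f x = \int[mu]_x g x.
Proof.
move=> bf bg mN N0 fg; apply/eqP; rewrite eq_le; apply/andP; split;
  apply: (bint_le_null _ _ mN N0) => // x Nx; by rewrite fg.
Qed.

End bounded_integral_null.

(** * Truncated potentials *)

Lemma near_natSinv_le {R : realType} (e : R) : 0 < e ->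
  \forall n \near \oo, n.+1%:R^-1 <= e.
Proof.
move=> e0; have := near_infty_natSinv_lt (PosNum e0).
by apply: filterS => n /= /ltW.
Qed.

Section truncated_potential.
Context {R : realType} {d : nat} (alpha : R).
Notation T := (borel_rV R d).
Notation q := (d%:R - alpha).
Hypothesis ad : alpha < d%:R.
Implicit Types (x y z : 'rV[R]_d) (e : R) (mu : {finite_measure set T -> \bar R}).

(** The Riesz kernel frozen inside the ball of radius e. Capping |x| rather than the value keeps it
    homogeneous in x and e jointly, which [kap_ratio] exploits. *)
Definition kap e x : R := Num.max (enorm x) e `^ (- q).

Let q0 : 0 < q. Proof. by rewrite subr_gt0. Qed.

Lemma kap_ge0 e x : 0 <= kap e x.
Proof. exact: powR_ge0. Qed.

Lemma kap_le e x : 0 < e -> kap e x <= e `^ (- q).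
Proof. by move=> e0; apply: powRN_anti => //; [exact: ltW|rewrite le_max lexx orbT]. Qed.

Lemma riesz_kap e x : 0 < e -> e <= enorm x -> riesz alpha x = (kap e x)%:E.
Proof.
move=> e0 ex; rewrite /riesz -enorm_eq0 gt_eqF ?(lt_le_trans e0)//.
by rewrite /kap (max_idPl ex) opprB.
Qed.

Lemma kap_riesz e x : 0 < e -> ((kap e x)%:E <= riesz alpha x)%E.
Proof.
move=> e0; rewrite /riesz; case: ifPn => [_|]; first by rewrite leey.
rewrite -enorm_gt0 => x0; rewrite lee_fin /kap -(opprB d%:R).
by apply: powRN_anti => //; [exact: ltW|rewrite le_max lexx].
Qed.

Lemma kap_anti e e' x : 0 < e' -> e' <= e -> kap e x <= kap e' x.
Proof.
move=> e0 ee; apply: powRN_anti; first exact: ltW.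
  by rewrite lt_max e0 orbT.
by rewrite ge_max !le_max lexx ee !orbT.
Qed.

Lemma kap_lip e x y : 0 < e ->
  `|kap e x - kap e y| <= q * e `^ (- q - 1) * enorm (x - y).
Proof.
move=> e0; have := @powRN_lip R q e (Num.max (enorm x) e) (Num.max (enorm y) e).
move=> /(_ (ltW q0) e0); rewrite !le_max lexx !orbT => /(_ isT isT) H.
apply: (le_trans H); apply: ler_wpM2l; first by rewrite mulr_ge0 ?powR_ge0// ltW.
apply: (le_trans _ (ler_dist_enorm x y)).
case: (leP (enorm x) e) => xe; case: (leP (enorm y) e) => ye.
- by rewrite subrr normr0.
- have xy := le_trans xe (ltW ye).
  by rewrite !ler0_norm ?subr_le0 ?(ltW ye)// !opprB lerD2l lerN2.
- have yx := le_trans ye (ltW xe).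
  by rewrite !ger0_norm ?subr_ge0 ?(ltW xe)// lerD2l lerN2.
- by [].
Qed.

(* The truncation error kap e - kap e' is a nonincreasing function of |x|,
   homogeneous of degree -q in (x, e, e'). *)
Lemma kap_ratio e e' x xb : 0 < e -> e <= e' -> enorm xb <= 2 * enorm x ->
  kap e x - kap e' x <= 2 `^ q * (kap (2 * e) xb - kap (2 * e') xb).
Proof.
move=> e0 ee xx; have e'0 : 0 < e' by exact: lt_le_trans ee.
pose s := enorm x; pose t := enorm xb / 2.
have ts : t <= s by rewrite /t ler_pdivrMr// mulrC.
have sc r : 0 < r -> 2 `^ q * kap (2 * r) xb = Num.max t r `^ (- q).
  move=> r0; have -> : Num.max t r = 2^-1 * Num.max (enorm xb) (2 * r).
    by rewrite maxr_pMr ?invr_ge0// mulKf// mulrC.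
  have m0 : 0 < Num.max (enorm xb) (2 * r) by rewrite lt_max mulr_gt0// orbT.
  rewrite powRM ?invr_ge0 ?(ltW m0)//; congr (_ * _).
  by rewrite -powR_inv1// -powRrM mulrN mulN1r opprK.
rewrite mulrBr !sc// /kap -/s.
have [es|se] := leP e' s.
  rewrite (max_idPl (le_trans ee es)) subrr subr_ge0.
  apply: powRN_anti; first exact: ltW.
    by rewrite lt_max e0 orbT.
  by rewrite ge_max !le_max lexx ee !orbT.
rewrite (max_idPr (le_trans ts (ltW se))) lerD2r.
apply: powRN_anti; first exact: ltW.
  by rewrite lt_max e0 orbT.
by rewrite ge_max !le_max lexx ts !orbT.
Qed.

Lemma bmeas_kap e x : 0 < e -> bmeas (fun y : T => kap e (x - (y : 'rV[R]_d))).
Proof.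
move=> e0; split; last first.
  by exists (e `^ (- q)) => y; rewrite ger0_norm ?kap_le ?kap_ge0.
apply: continuous_measurable_rV.
apply: (@lipschitz_enorm_continuous _ _ _ (q * e `^ (- q - 1))) => [|y y'].
  by rewrite mulr_ge0 ?powR_ge0 ?ltW.
rewrite (le_trans (kap_lip _ _ e0))// (_ : x - y - (x - y') = y' - y) 1?enormB//.
by rewrite opprB addrC addrA subrK.
Qed.

Definition tpot e mu x : R := \int[mu]_y kap e (x - (y : 'rV[R]_d)).

Lemma tpot_ge0 e mu x : 0 <= tpot e mu x.
Proof. by apply: Rintegral_ge0 => y _; exact: kap_ge0. Qed.

Lemma tpot_lip e mu x y : 0 < e ->
  `|tpot e mu x - tpot e mu y| <=
  q * e `^ (- q - 1) * fine (mu setT) * enorm (x - y).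
Proof.
move=> e0; rewrite /tpot -bintB; [|exact: bmeas_kap|exact: bmeas_kap].
rewrite mulrAC; apply: bint_norm_le.
  by apply: bmeasB; exact: bmeas_kap.
move=> z; rewrite (le_trans (kap_lip _ _ e0))//.
by rewrite (_ : x - z - (y - z) = x - y)// [- (y - _)]opprB addrA subrK.
Qed.

Lemma tpot_continuous e mu : 0 < e -> continuous (tpot e mu).
Proof.
move=> e0; apply: lipschitz_enorm_continuous => [|x y]; last exact: tpot_lip.
by rewrite !mulr_ge0 ?powR_ge0 ?fine_ge0// ltW.
Qed.

Lemma tpot_anti e e' mu x : 0 < e' -> e' <= e -> tpot e mu x <= tpot e' mu x.
Proof.
move=> e0 ee; apply: bint_le.
- by apply: bmeas_kap; exact: lt_le_trans ee.
- exact: bmeas_kap.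
- by move=> y; exact: kap_anti.
Qed.

Lemma tpot_le e mu x : 0 < e -> tpot e mu x <= e `^ (- q) * fine (mu setT).
Proof.
move=> e0; rewrite -bint_cst; apply: bint_le.
- exact: bmeas_kap.
- exact: bmeas_cst.
- by move=> y; exact: kap_le.
Qed.

Lemma bmeas_tpot e mu : 0 < e -> bmeas (tpot e mu : T -> R).
Proof.
move=> e0; split; first by apply: continuous_measurable_rV; exact: tpot_continuous.
by exists (e `^ (- q) * fine (mu setT)) => x; rewrite ger0_norm ?tpot_le ?tpot_ge0.
Qed.

Lemma tpotE e mu x : 0 < e ->
  (\int[mu]_y (kap e (x - (y : 'rV[R]_d)))%:E)%E = (tpot e mu x)%:E.
Proof. by move=> e0; rewrite bintE//; exact: bmeas_kap. Qed.

Lemma tpot_potential e mu x : 0 < e ->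
  ((tpot e mu x)%:E <= potential alpha mu x)%E.
Proof.
move=> e0; rewrite -tpotE//; apply: ge0_le_integral => //.
- by move=> y _; rewrite lee_fin kap_ge0.
- by apply/measurable_EFinP; case: (bmeas_kap x e0).
- exact: measurable_rieszr.
- by move=> y _; exact: kap_riesz.
Qed.

Lemma cvg_kap x :
  (kap n.+1%:R^-1 x)%:E @[n --> \oo] --> riesz alpha x.
Proof.
have [->|x0] := eqVneq x 0; last first.
  rewrite -enorm_gt0 in x0.
  apply: cvg_near_cst; near=> n.
  rewrite (@riesz_kap n.+1%:R^-1)//.
  by near: n; apply: near_natSinv_le.
rewrite /riesz eqxx; apply/cvgeyPge => A.
have z0 : enorm (0 : 'rV[R]_d) = 0 by apply/eqP; rewrite enorm_eq0.
(* Solves B^-q = |A| + 1, so that truncation below B exceeds A at the origin. *)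
pose B := (`|A| + 1) `^ (- q^-1).
have B0 : 0 < B by rewrite powR_gt0// ltr_wpDl.
near=> n; rewrite lee_fin /kap z0 (max_idPr _) ?invr_ge0//.
apply: (@le_trans _ _ (B `^ (- q))).
  rewrite /B -powRrM mulrNN mulVf ?gt_eqF// powRr1 ?addr_ge0//.
  by rewrite (le_trans (ler_norm _))// lerDl.
apply: powRN_anti => //; first exact: ltW.
by near: n; apply: near_natSinv_le.
Unshelve. all: by end_near. Qed.

Lemma cvg_tpot mu x :
  (tpot n.+1%:R^-1 mu x)%:E @[n --> \oo] --> potential alpha mu x.
Proof.
rewrite /potential; under eq_fun do rewrite -tpotE//.
rewrite (_ : (fun y : T => riesz alpha (x - y)) =
  (fun y : T => limn (fun n => (kap n.+1%:R^-1 (x - y))%:E))); last first.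
  by apply/funext => y; apply/esym/cvg_lim => //; exact: cvg_kap.
apply: cvg_monotone_convergence => //.
- by move=> n; apply/measurable_EFinP; case: (@bmeas_kap n.+1%:R^-1 x _).
- by move=> n y _; rewrite lee_fin kap_ge0.
- move=> y _ m n mn; rewrite lee_fin kap_anti//.
  by rewrite lef_pV2 ?posrE// ler_nat.
Qed.

Lemma cvg_int_tpot mu (nu : {measure set T -> \bar R}) :
  (\int[nu]_x (tpot n.+1%:R^-1 mu x)%:E)%E @[n --> \oo] -->
  (\int[nu]_x potential alpha mu x)%E.
Proof.
rewrite (_ : (fun x : T => potential alpha mu x) =
  (fun x : T => limn (fun n => (tpot n.+1%:R^-1 mu x)%:E))); last first.
  by apply/funext => y; apply/esym/cvg_lim => //; exact: cvg_tpot.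
apply: cvg_monotone_convergence => //.
- by move=> n; apply/measurable_EFinP; case: (@bmeas_tpot n.+1%:R^-1 mu _).
- by move=> n y _; rewrite lee_fin tpot_ge0.
- move=> y _ m n mn; rewrite lee_fin tpot_anti//.
  by rewrite lef_pV2 ?posrE// ler_nat.
Qed.

Lemma potential_le mu x (A : R) : (forall e, 0 < e -> tpot e mu x <= A) ->
  (potential alpha mu x <= A%:E)%E.
Proof.
move=> H; rewrite -(cvg_lim _ (@cvg_tpot mu x))//; apply: lime_le.
  by apply/cvg_ex; eexists; exact: cvg_tpot.
by apply: nearW => n; rewrite lee_fin H.
Qed.

End truncated_potential.

(** * Maximum principle and Frostman's bound *)

Section second_difference.
Context {R : realType}.
Implicit Types (p s z h u w : R).

(** The cubic coefficient and the quartic remainder constant of (1 - z)^-p, each times a bound, in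
    units of u^2, for the sum of the corresponding powers of u + w and u - w. When w^2 <= 4 u and u
    <= 1, these bounds are 2 + 6 * 4 = 26 and 2 + 12 * 4 + 2 * 16 = 82. *)
Definition sdc p : R := 26 * (p * (p + 1) * (p + 2) / 6) + 82 * (16 * 2 `^ p).

Lemma sdc_ge0 p : 0 < p -> 0 <= sdc p.
Proof.
move=> p0; rewrite /sdc addr_ge0 ?mulr_ge0 ?powR_ge0 ?invr_ge0 ?addr_ge0//;
  exact: ltW.
Qed.

Lemma binpoly4E p z : (binpoly p 4).[z] =
  1 + p * z + p * (p + 1) / 2 * z ^+ 2 + p * (p + 1) * (p + 2) / 6 * z ^+ 3.
Proof.
rewrite horner_poly !big_ord_recl big_ord0 /binc /= !big_ord_recl !big_ord0 /=.
by rewrite /bump /=; field.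
Qed.

(** To be used with u = h^2 / |x|^2 and w = 2 h x_i / |x|^2, for which |x + h e_i|^2 = |x|^2 (1 + u
    + w). Odd powers of w cancel between the two terms; w^2 is of the same order as u. *)
Lemma powR_second_diff p u w : 0 < p -> 0 <= u -> 64 * u <= 1 ->
  w ^+ 2 <= 4 * u ->
  - (2 * p * u) + p * (p + 1) * w ^+ 2 - sdc p * u ^+ 2 <=
  (1 + (u + w)) `^ (- p) + (1 + (u - w)) `^ (- p) - 2.
Proof.
move=> p0 u0 u1 wu.
have w4 : `|w| <= 1 / 4.
  rewrite -(@ler_pXn2r _ 2)// ?nnegrE// ?divr_ge0// real_normK ?num_real//.
  rewrite (le_trans wu)//; lra.
have [w1 w2] : - (1 / 4) <= w /\ w <= 1 / 4.
  by move: w4; rewrite ler_norml => /andP.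
have t1 : `|- (u + w)| <= 1 / 2 by rewrite ler_norml; apply/andP; split; lra.
have t2 : `|- (u - w)| <= 1 / 2 by rewrite ler_norml; apply/andP; split; lra.
have := powR_taylor4 p0 t1; have := powR_taylor4 p0 t2.
rewrite !opprK !binpoly4E /sdc.
set c3 := p * (p + 1) * (p + 2) / 6; set c4 := 16 * 2 `^ p.
have c30 : 0 <= c3.
  by rewrite /c3 !mulr_ge0// ?invr_ge0 ?addr_ge0// ltW.
have c40 : 0 <= c4 by rewrite mulr_ge0 ?powR_ge0.
have pp0 : 0 <= p * (p + 1) by rewrite mulr_ge0 ?addr_ge0// ltW.
have u2 : 0 <= u ^+ 2 by rewrite sqr_ge0.
have wp : 0 <= w ^+ 2 by rewrite sqr_ge0.
have h3 : 2 * u ^+ 3 + 6 * u * w ^+ 2 <= 26 * u ^+ 2.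
  have : u * w ^+ 2 <= u * (4 * u) by rewrite ler_wpM2l.
  have : u ^+ 3 <= u ^+ 2 by rewrite exprS ler_piMl//; lra.
  nra.
have h4 : 2 * u ^+ 4 + 12 * u ^+ 2 * w ^+ 2 + 2 * w ^+ 4 <= 82 * u ^+ 2.
  have a1 : u ^+ 2 * w ^+ 2 <= u ^+ 2 by rewrite ler_piMr//; lra.
  have a2 : u ^+ 4 <= u ^+ 2 by rewrite (exprD u 2 2) ler_piMr//; nra.
  have a3 : w ^+ 4 <= (4 * u) ^+ 2.
    rewrite (exprM w 2 2); apply: lerXn2r; rewrite ?nnegrE //; exact: mulr_ge0.
  nra.
have := ler_wpM2l c30 h3; have := ler_wpM2l c40 h4.
set A := (1 + (u - w)) `^ (- p); set B := (1 + (u + w)) `^ (- p).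
have : 0 <= p * (p + 1) * u ^+ 2 by rewrite mulr_ge0.
clearbody c3 c4 A B; nra.
Qed.

End second_difference.

Section maximum_principle.
Context {R : realType} {d : nat} (alpha : R).
Notation T := (borel_rV R d).
Notation q := (d%:R - alpha).
Hypothesis ad : alpha < d%:R.
Hypothesis alpha2 : alpha <= 2.
Implicit Types (x y z : 'rV[R]_d) (e h : R) (i : 'I_d).

Let q0 : 0 < q. Proof. by rewrite subr_gt0. Qed.

Definition evec h i : 'rV[R]_d := h *: delta_mx ord0 i.

Lemma sqnorm_evec h i : sqnorm (evec h i) = h ^+ 2.
Proof.
rewrite /sqnorm (bigD1 i)//= big1 ?addr0 => [|j ji]; rewrite !mxE eqxx/=.
  by rewrite eqxx mulr1.
by rewrite (negbTE ji) mulr0 expr0n.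
Qed.

Lemma dotv_evec x h i : dotv x (evec h i) = h * x ord0 i.
Proof.
rewrite /dotv (bigD1 i)//= big1 ?addr0 => [|j ji]; rewrite !mxE eqxx/=.
  by rewrite eqxx mulr1 mulrC.
by rewrite (negbTE ji) mulr0 mulr0.
Qed.

Lemma enorm_evec h i : 0 <= h -> enorm (evec h i) = h.
Proof. by move=> h0; rewrite /enorm -/(sqnorm _) sqnorm_evec sqrtr_sqr ger0_norm. Qed.

Lemma evecN h i : evec (- h) i = - evec h i.
Proof. by rewrite /evec scaleNr. Qed.

Lemma enorm_powR x : enorm x `^ (- q) = sqnorm x `^ (- (q / 2)).
Proof.
rewrite -sqr_enorm -powR_mulrn ?enorm_ge0// -powRrM.
by congr (_ `^ _); field.
Qed.

Definition second_diff (f : 'rV[R]_d -> R) h x : R :=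
  \sum_(i < d) (f (x + evec h i) + f (x - evec h i) - 2 * f x).

(* The Laplacian of |x|^-q is q (2 - alpha) |x|^(-q-2) >= 0. *)
Lemma kap_second_diff e h x : 0 < e -> 0 < h -> 8 * h <= e -> 2 * e <= enorm x ->
  - (d%:R * sdc (q / 2) * e `^ (- q) / e ^+ 4 * h ^+ 4) <=
  second_diff (kap alpha e) h x.
Proof.
move=> e0 h0 he ex.
set p := q / 2; have p0 : 0 < p by rewrite divr_gt0.
set s := sqnorm x.
have s4 : 4 * e ^+ 2 <= s.
  rewrite /s -sqr_enorm (_ : 4 * e ^+ 2 = (2 * e) ^+ 2); last by ring.
  by rewrite lerXn2r ?nnegrE ?enorm_ge0// mulr_ge0// ltW.
have e2 : 0 < e ^+ 2 by rewrite exprn_gt0.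
have s0 : 0 < s by rewrite (lt_le_trans _ s4)// mulr_gt0.
pose u := h ^+ 2 / s.
have u0 : 0 <= u by rewrite /u divr_ge0 ?sqr_ge0// ltW.
have h2e : 64 * h ^+ 2 <= e ^+ 2.
  rewrite (_ : 64 * h ^+ 2 = (8 * h) ^+ 2); last by ring.
  by rewrite lerXn2r ?nnegrE ?(ltW e0)// mulr_ge0// ltW.
have u1 : 64 * u <= 1.
  rewrite /u mulrA ler_pdivrMr// mul1r (le_trans h2e)// (le_trans _ s4)//.
  by rewrite ler_peMl ?(ltW e2)//; lra.
pose w i := 2 * h * x ord0 i / s.
have wE i : w i ^+ 2 = 4 * u * (x ord0 i ^+ 2 / s).
  by rewrite /w /u; field; rewrite gt_eqF.
have xs i : x ord0 i ^+ 2 / s <= 1.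
  rewrite ler_pdivrMr// mul1r /s /sqnorm (bigD1 i)//= lerDl.
  by apply: sumr_ge0 => j _; rewrite sqr_ge0.
have wu i : w i ^+ 2 <= 4 * u.
  by rewrite wE; apply: ler_piMr => //; exact: mulr_ge0.
(* Both neighbours of x stay where the truncation is inactive. *)
have far hh i : `|hh| = h -> e <= enorm (x + evec hh i).
  move=> hhE.
  have h1 : enorm (evec hh i) = h.
    rewrite /enorm -/(sqnorm _) sqnorm_evec -[_ ^+ 2]real_normK ?num_real// hhE.
    by rewrite sqrtr_sqr gtr0_norm.
  have := ler_enormD (x + evec hh i) (- evec hh i).
  rewrite addrK enormN h1; nra.
have kE y : e <= enorm y -> kap alpha e y = sqnorm y `^ (- p).
  by move=> ey; rewrite /kap (max_idPl ey) enorm_powR.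
have sE hh i : `|hh| = h ->
    kap alpha e (x + evec hh i) = s `^ (- p) * (1 + (u + hh / h * w i)) `^ (- p).
  move=> hhE; rewrite kE ?far//.
  have hh2 : hh ^+ 2 = h ^+ 2 by rewrite -[LHS]real_normK ?num_real// hhE.
  have E : sqnorm (x + evec hh i) = s * (1 + (u + hh / h * w i)).
    rewrite sqnormD dotv_evec sqnorm_evec hh2 -/s /u /w; field.
    by rewrite !gt_eqF.
  rewrite E powRM ?(ltW s0)//.
  by rewrite -(pmulr_rge0 _ s0) -E sqnorm_ge0.
have sp0 : 0 <= s `^ (- p) by exact: powR_ge0.
have term i : s `^ (- p) * (- (2 * p * u) + p * (p + 1) * w i ^+ 2 - sdc p * u ^+ 2)
    <= kap alpha e (x + evec h i) + kap alpha e (x - evec h i) - 2 * kap alpha e x.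
  rewrite -evecN sE ?gtr0_norm// sE ?normrN ?gtr0_norm// kE; last first.
    by rewrite (le_trans _ ex)// ler_peMl ?(ltW e0)//; lra.
  rewrite mulNr divff ?gt_eqF// mulN1r mul1r -/s.
  have := ler_wpM2l sp0 (powR_second_diff p0 u0 u1 (wu i)).
  by rewrite mulrBr mulrDr; lra.
apply: (@le_trans _ _ (\sum_(i < d) s `^ (- p) *
    (- (2 * p * u) + p * (p + 1) * w i ^+ 2 - sdc p * u ^+ 2))); last first.
  by apply: ler_sum => i _; exact: term.
rewrite -mulr_sumr.
(* The w_i^2 sum to 4 u, and 2 (p + 1) - d = 2 - alpha since 2 p = d - alpha. *)
have -> : \sum_(i < d) (- (2 * p * u) + p * (p + 1) * w i ^+ 2 - sdc p * u ^+ 2)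
    = 2 * p * u * (2 - alpha) - d%:R * sdc p * u ^+ 2.
  rewrite sumrB big_split/= !sumr_const card_ord -mulr_sumr.
  under eq_bigr do rewrite wE.
  rewrite -mulr_sumr -mulr_suml -/(sqnorm x) -/s divff ?gt_eqF// mulr1.
  rewrite -(mulr_natl (- _) d) -(mulr_natl (sdc p * _) d).
  by move: (sdc p) => C; rewrite /p; field.
have dC0 : 0 <= d%:R * sdc p by rewrite mulr_ge0// sdc_ge0.
apply: (@le_trans _ _ (s `^ (- p) * (- (d%:R * sdc p * u ^+ 2)))); last first.
  apply: ler_wpM2l => //; rewrite -[leLHS]add0r lerD2r.
  by rewrite mulr_ge0 ?subr_ge0// mulr_ge0// mulr_ge0// ltW.
rewrite mulrN lerN2.
have ue : u ^+ 2 <= h ^+ 4 / e ^+ 4.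
  rewrite /u expr_div_n -exprM ler_pM2l ?exprn_gt0//.
  rewrite lef_pV2 ?posrE ?exprn_gt0// (exprM e 2 2).
  rewrite lerXn2r ?nnegrE ?(ltW e2) ?(ltW s0)// (le_trans _ s4)//.
  by rewrite ler_peMl ?(ltW e2)//; lra.
have se : s `^ (- p) <= e `^ (- q).
  rewrite -enorm_powR; apply: powRN_anti => //; first exact: ltW.
  by rewrite (le_trans _ ex)// ler_peMl ?(ltW e0)//; lra.
rewrite (_ : d%:R * sdc p * e `^ (- q) / e ^+ 4 * h ^+ 4 =
  e `^ (- q) * (d%:R * sdc p * (h ^+ 4 / e ^+ 4))); last by ring.
apply: ler_pM => //; first by rewrite mulr_ge0 ?sqr_ge0.
exact: ler_wpM2l.
Qed.

End maximum_principle.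

(** With D the dimension, the right-hand side is the second difference of c |x|^2, and the left-hand
    side the error of the potential in [tpot_second_diff]. *)
Lemma quartic_lt_quadratic {R : realFieldType} (C c D h : R) :
  0 <= C -> 0 < c -> 1 <= D -> 0 < h -> h <= 1 -> h * (C + 1) <= c ->
  C * h ^+ 4 < c * (2 * D * h ^+ 2).
Proof.
move=> C0 c0 D1 h0 h1 hc.
have a1 : C * h <= c by apply: le_trans hc; rewrite mulrDr mulrC mulr1 lerDl ltW.
have h20 : 0 < h ^+ 2 by rewrite exprn_gt0.
have a2 : h ^+ 4 <= h * h ^+ 2.
  rewrite (_ : h ^+ 4 = h * (h ^+ 2 * h)); last by ring.
  by rewrite ler_wpM2l ?(ltW h0)// ler_piMr// ltW.
have a3 : C * h ^+ 4 <= C * (h * h ^+ 2) by rewrite ler_wpM2l.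
have a4 : C * h * h ^+ 2 <= c * h ^+ 2 by rewrite ler_wpM2r// ltW.
have a5 : 0 < c * h ^+ 2 by rewrite mulr_gt0.
have a6 : c * h ^+ 2 * 1 <= c * h ^+ 2 * D by rewrite ler_wpM2l// ltW.
nra.
Qed.

Section maximum_principle_step.
Context {R : realType} {d : nat} (alpha : R).
Notation T := (borel_rV R d).
Notation q := (d%:R - alpha).
Hypothesis ad : alpha < d%:R.
Hypothesis alpha2 : alpha <= 2.
Hypothesis d0 : (0 < d)%N.
Implicit Types (x y z : 'rV[R]_d) (e h : R) (i : 'I_d).

Let q0 : 0 < q. Proof. by rewrite subr_gt0. Qed.

Lemma second_diffDZ (f g : 'rV[R]_d -> R) (c : R) h x :
  second_diff (fun y => f y + c * g y) h x =
  second_diff f h x + c * second_diff g h x.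
Proof.
rewrite /second_diff mulr_sumr -big_split/=; apply: eq_bigr => i _.
by move: (x + _) (x - _) => y z; ring.
Qed.

Lemma second_diff_sqnorm h x : second_diff (@sqnorm R d) h x = 2 * d%:R * h ^+ 2.
Proof.
rewrite /second_diff (eq_bigr (fun=> 2 * h ^+ 2)) => [|i _].
  by rewrite sumr_const card_ord -mulr_natl; ring.
by rewrite -evecN !sqnormD !dotv_evec !sqnorm_evec; ring.
Qed.

Lemma tpot_second_diff (rho : {finite_measure set T -> \bar R})
    (K : set 'rV[R]_d) e h x :
  measurable (K : set T) -> rho (~` K) = 0%E ->
  0 < e -> 0 < h -> 8 * h <= e -> (forall y, K y -> 2 * e <= enorm (x - y)) ->
  - (d%:R * sdc (q / 2) * e `^ (- q) / e ^+ 4 * fine (rho setT) * h ^+ 4) <=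
  second_diff (tpot alpha e rho) h x.
Proof.
move=> mK rK e0 h0 he xK.
pose F i (y : T) : R := kap alpha e (x + evec h i - (y : 'rV[R]_d))
  + kap alpha e (x - evec h i - (y : 'rV[R]_d)) - 2 * kap alpha e (x - (y : 'rV[R]_d)).
have bk z := bmeas_kap ad z e0.
have b2k : bmeas (fun y : T => 2 * kap alpha e (x - (y : 'rV[R]_d))).
  by apply: bmeasM => //; exact: bmeas_cst.
have bF i : bmeas (F i) := bmeasB (bmeasD (bk _) (bk _)) b2k.
have -> : second_diff (tpot alpha e rho) h x = \int[rho]_y \sum_(i < d) F i y.
  rewrite bint_sum//; apply: eq_bigr => i _.
  by rewrite (bintB _ (bmeasD (bk _) (bk _)) b2k) (bintD _ (bk _) (bk _)) (bintZl _ _ (bk _)).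
rewrite mulrAC -mulNr -bint_cst.
apply: (bint_le_null _ _ (measurableC mK) rK).
- exact: bmeas_cst.
- exact: bmeas_sum.
move=> y /contrapT yK.
have := kap_second_diff ad alpha2 e0 h0 he (xK _ yK).
move=> /le_trans; apply; rewrite le_eqVlt; apply/orP; left; apply/eqP.
apply: eq_bigr => i _; rewrite /F (addrAC x (- y)).
by rewrite (addrAC x (- y)).
Qed.

Lemma compact_eball (M : R) : compact [set x : 'rV[R]_d | enorm x <= M].
Proof.
apply: bounded_closed_compact.
  exists M; split; first exact: num_real.
  by move=> N MN x /= xM; rewrite (le_trans (norm_le_enorm x))// (le_trans xM)// ltW.
by apply: cts_closed_le; exact: continuous_enorm.
Qed.

(* At a maximum point, away from K, of tpot + c |x|^2 the second differences
   would be at least 2 d c h^2 - O(h^4) > 0. *)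
Lemma tpot_max (rho : {finite_measure set T -> \bar R}) (K : set 'rV[R]_d)
    (e r A : R) :
  measurable (K : set T) -> rho (~` K) = 0%E ->
  0 < e -> 0 <= A -> (forall y, K y -> enorm y <= r) ->
  (forall x y, K y -> enorm (x - y) <= 2 * e -> tpot alpha e rho x <= A) ->
  forall x, tpot alpha e rho x <= A.
Proof.
have ar (a b s t : R) : 0 < t -> s + 2 * t <= a + b -> b <= t / 2 -> s + t < a.
  by lra.
move=> mK rK e0 A0 Kr nearA x0; rewrite leNgt; apply/negP => Ax0.
pose u := tpot alpha e rho.
pose g := (u x0 - A) / 2.
have g0 : 0 < g by rewrite divr_gt0// subr_gt0.
have ux0 : u x0 = A + 2 * g by rewrite /g; field.
pose m := fine (rho setT); have m0 : 0 <= m by rewrite fine_ge0.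
(* At distance L the kernel is g / (m + 1), so the potential of mass m is at most g there. *)
pose L := ((m + 1) / g) `^ q^-1.
have L0 : 0 < L by rewrite powR_gt0// divr_gt0// ltr_wpDl.
have Lg : L `^ (- q) * m <= g.
  have mg0 : 0 <= (m + 1) / g by apply: divr_ge0; [exact: addr_ge0|exact: ltW].
  rewrite /L -powRrM mulrN mulVf ?gt_eqF// powR_inv1//.
  rewrite invf_div mulrAC ler_pdivrMr ?ltr_wpDl// mulrDr mulr1.
  by rewrite lerDl ltW.
pose M := `|r| + L + enorm x0 + 1.
have M0 : 0 < M by rewrite /M ltr_wpDl// !addr_ge0 ?enorm_ge0 ?(ltW L0).
have faru x : M <= enorm x -> u x <= A + g.
  move=> Mx; apply: (@le_trans _ _ g); last by rewrite lerDr.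
  apply: (le_trans _ Lg); rewrite -bint_cst.
  apply: (bint_le_null _ _ (measurableC mK) rK).
  - exact: bmeas_kap.
  - exact: bmeas_cst.
  move=> y /contrapT yK; apply: powRN_anti => //; first exact: ltW.
  rewrite le_max; apply/orP; left.
  have := ler_enormD (x - y) y; rewrite subrK => H.
  have := Kr _ yK; have := ler_norm r; have := enorm_ge0 x0.
  by move: Mx H; rewrite /M; lra.
(* c M^2 = g / 2: the perturbation is too small to move the maximum over the ball to its boundary or
   close to K, where the potential is at most A + g. *)
pose c := g / (2 * M ^+ 2).
have c0 : 0 < c by rewrite divr_gt0// mulr_gt0// exprn_gt0.
pose F x := u x + c * sqnorm x.
have cF : continuous F.
  apply: ctsD; first exact: tpot_continuous.
  apply: ctsM; first exact: cts_cst.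
  rewrite (_ : @sqnorm R d = fun x => enorm x ^+ 2); last first.
    by apply/funext => z; rewrite sqr_enorm.
  by apply: ctsX; exact: continuous_enorm.
have [|||x1] := @EVT_max_rV R d F [set x | enorm x <= M].
- by exists x0; rewrite /= /M; have := normr_ge0 r; lra.
- exact: compact_eball.
- by apply: continuous_subspaceT.
rewrite inE/= => x1M Fmax.
have Fx0 : u x0 <= F x1.
  apply: (@le_trans _ _ (F x0)); first by rewrite lerDl mulr_ge0 ?sqnorm_ge0 ?ltW.
  apply: Fmax; rewrite inE/= /M; have := enorm_ge0 x0; have := normr_ge0 r; lra.
have cM : c * sqnorm x1 <= g / 2.
  apply: (@le_trans _ _ (c * M ^+ 2)).
    by rewrite ler_wpM2l ?(ltW c0)// -sqr_enorm lerXn2r ?nnegrE ?enorm_ge0// ltW.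
  rewrite /c le_eqVlt; apply/orP; left; apply/eqP; field.
  by rewrite gt_eqF.
have ux1 : A + g < u x1.
  by apply: ar g0 _ cM; rewrite -ux0.
have x1lt : enorm x1 < M.
  by rewrite ltNge; apply/negP => /faru; rewrite leNgt ux1.
have x1K y : K y -> 2 * e <= enorm (x1 - y).
  move=> yK; rewrite leNgt; apply/negP => /ltW /(nearA _ _ yK).
  by rewrite leNgt => /negP; apply; rewrite (lt_trans _ ux1)// ltrDl.
pose C := d%:R * sdc (q / 2) * e `^ (- q) / e ^+ 4 * m.
have C0 : 0 <= C.
  rewrite /C !mulr_ge0 ?invr_ge0 ?exprn_ge0 ?powR_ge0 ?(ltW e0)//.
  by apply: sdc_ge0; rewrite divr_gt0.
have dR : 1 <= d%:R :> R by rewrite ler1n.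
pose h := Num.min (e / 8) (Num.min (M - enorm x1) (Num.min 1 (c / (C + 1)))).
have C1 : 0 < C + 1 by rewrite ltr_wpDl.
have h0 : 0 < h.
  rewrite !lt_min; apply/and4P; split; last exact: divr_gt0.
  - exact: divr_gt0.
  - by rewrite subr_gt0.
  - exact: ltr01.
have he : 8 * h <= e by rewrite mulrC -ler_pdivlMr// ge_min lexx.
have hM : h <= M - enorm x1 by rewrite !ge_min lexx !orbT.
have h1 : h <= 1 by rewrite !ge_min lexx !orbT.
have hc : h * (C + 1) <= c.
  by rewrite -ler_pdivlMr// !ge_min lexx !orbT.
have := tpot_second_diff mK rK e0 h0 he x1K; rewrite -/u -/m -/C.
apply/negP; rewrite -ltNge.
have : second_diff F h x1 <= 0.
  apply: sumr_le0 => i _; rewrite subr_le0 [_ * _]mulr_natl mulr2n lerD//.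
    apply: Fmax; rewrite inE/=.
    by rewrite (le_trans (ler_enormD _ _))// enorm_evec ?(ltW h0)// -lerBrDl.
  apply: Fmax; rewrite inE/=.
  by rewrite (le_trans (ler_enormD _ _))// enormN enorm_evec ?(ltW h0)// -lerBrDl.
rewrite second_diffDZ second_diff_sqnorm.
have /(_ d%:R dR) := quartic_lt_quadratic C0 c0 _ h0 h1 hc.
set a := C * _; set b := c * _; set u2 := second_diff _ _ _.
by move=> ab ub; rewrite -(ltrD2r b) (le_lt_trans ub)// addrC subr_gt0.
Qed.

End maximum_principle_step.

Lemma bint_mrestr {d0} {T : measurableType d0} {R : realType}
    (mu : {finite_measure set T -> \bar R}) (D : set T) (mD : measurable D)
    (f : T -> R) : bmeas f -> (forall x, 0 <= f x) ->
  \int[mrestr mu mD]_x f x = \int[mu]_x (f x * \1_D x).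
Proof.
move=> [mf _] f0.
have mf' : measurable_fun setT (EFin \o f) by exact/measurable_EFinP.
rewrite /Rintegral (ge0_integral_mrestr _ mD mf'); last first.
  by move=> x; rewrite lee_fin.
rewrite integral_mkcond; congr fine; apply: eq_integral => x _.
by rewrite patchE indicE; case: ifP => _; rewrite ?mulr1 ?mulr0.
Qed.

Lemma energy_mrestr_le {R : realType} {d : nat} (alpha : R)
    (mu : {finite_measure set (borel_rV R d) -> \bar R}) (D : set (borel_rV R d))
    (mD : measurable D) : (energy alpha (mrestr mu mD) <= energy alpha mu)%E.
Proof.
rewrite /energy (ge0_integral_mrestr _ mD)//; last 2 first.
- exact: (measurable_potential alpha (mrestr mu mD)).
- by move=> x; exact: (potential_ge0 alpha (mrestr mu mD)).
apply: (@le_trans _ _ (\int[mu]_(x in D) potential alpha mu x)%E).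
  apply: ge0_le_integral => //.
  - by move=> x _; exact: (potential_ge0 alpha (mrestr mu mD)).
  - by apply: measurable_funTS; exact: (measurable_potential alpha (mrestr mu mD)).
  - by apply: measurable_funTS; exact: measurable_potential.
  - move=> x _; rewrite /potential ge0_integral_mrestr//.
    + apply: ge0_subset_integral => //.
      * exact: measurable_rieszr.
      * by move=> y _; exact: riesz_ge0.
    + exact: measurable_rieszr.
    + by move=> y; exact: riesz_ge0.
apply: ge0_subset_integral => //; first exact: measurable_potential.
by move=> x _; exact: potential_ge0.
Qed.

Section frostman.
Context {R : realType} {d : nat} (alpha : R).
Notation T := (borel_rV R d).
Notation q := (d%:R - alpha).
Hypothesis ad : alpha < d%:R.
Hypothesis alpha2 : alpha <= 2.
Hypothesis d0 : (0 < d)%N.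
Context (E : set 'rV[R]_d) (muE : probability T R).
Hypothesis cE : compact E.
Hypothesis finW : (robin alpha E < +oo)%E.
Hypothesis eqE : is_equilibrium alpha E muE.
Implicit Types (x y z : 'rV[R]_d) (e : R).

Let q0 : 0 < q. Proof. by rewrite subr_gt0. Qed.

Notation W := (fine (robin alpha E)).

Lemma robinE : robin alpha E = W%:E.
Proof. by rewrite fineK// (robin_fin_num finW eqE). Qed.

Lemma robin_ge0 : 0 <= W.
Proof. by rewrite fine_ge0//; have [_ <-] := eqE; exact: mutual_ge0. Qed.

Lemma compact_measurable_rV (K : set 'rV[R]_d) : compact K -> measurable (K : set T).
Proof.
by move=> cK; apply: closed_measurable_rV; apply: compact_closed.
Qed.

Lemma closed_tpot_le (f : 'rV[R]_d -> R) : continuous f ->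
  closed [set x | forall e, 0 < e -> tpot alpha e muE x <= f x].
Proof.
move=> cf; rewrite (_ : mkset _ =
  \bigcap_(e in [set e | 0 < e]) [set x | tpot alpha e muE x - f x <= 0]).
  apply: closed_bigI => e e0; apply: cts_closed_le.
  by apply: ctsB => //; exact: tpot_continuous.
by apply/seteqP; split => x H e e0; have := H e e0; rewrite /= subr_le0.
Qed.

Lemma mE : measurable (E : set T).
Proof. exact: compact_measurable_rV. Qed.

Lemma energy_finE : energy alpha muE = W%:E.
Proof. by have [_ ->] := eqE; exact: robinE. Qed.

(** Split the energy W of muE over C and its complement. On C [variation] gives at least W times the
    mass, off C the potential is at least W + eta, so eta times the mass off C is at most 0.
    Quantifying over all truncations makes C closed. *)
Lemma frostman_ae (eta : R) : 0 < eta ->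
  muE (~` [set x | forall e, 0 < e -> tpot alpha e muE x <= W + eta]) = 0%E.
Proof.
move=> eta0; set C := mkset _.
have mC : measurable (C : set T).
  by apply: closed_measurable_rV; apply: closed_tpot_le; exact: cts_cst.
have mCc := measurableC mC.
pose u := (potential alpha muE : T -> \bar R).
have mu : measurable_fun setT u by exact: measurable_potential.
have u0 x : (0 <= u x)%E by exact: potential_ge0.
have uC : (\int[muE]_(x in C) u x + \int[muE]_(x in ~` C) u x = W%:E)%E.
  rewrite -ge0_integral_setU// ?setUv//; first by rewrite -energy_finE.
  by rewrite disj_set2E setICr.
have lowC : (W%:E * muE C <= \int[muE]_(x in C) u x)%E.
  rewrite -(ge0_integral_mrestr _ mC mu u0).
  have := variation finW eqE mE (nu := mrestr muE mC).
  rewrite robinE /= /mrestr setTI; apply.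
    have mEc : measurable (~` E : set T) by apply: measurableC; exact: mE.
    have [muE0 _] := eqE; apply: (subset_measure0 _ _ _ muE0) => //.
    exact: measurableI.
  apply: le_lt_trans (energy_mrestr_le alpha muE mC) _.
  by rewrite energy_finE ltry.
have upC : ((W + eta)%:E * muE (~` C) <= \int[muE]_(x in ~` C) u x)%E.
  rewrite -integral_cst//; apply: ge0_le_integral => //.
  - by move=> x _; rewrite lee_fin addr_ge0 ?robin_ge0// ltW.
  - exact: measurable_funTS.
  move=> x /existsNP[e /not_implyP[e0 /negP]]; rewrite -ltNge => /ltW H.
  by apply: (le_trans _ (tpot_potential ad muE x e0)); rewrite lee_fin.
have fC : muE C \is a fin_num by rewrite fin_num_measure.
have fCc : muE (~` C) \is a fin_num by rewrite fin_num_measure.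
have total : (muE C + muE (~` C) = 1)%E.
  by rewrite -measureU//; [rewrite setUv; exact: probability_setT|rewrite setICr].
have := leeD lowC upC; rewrite uC.
rewrite -(fineK fC) -(fineK fCc) in total *.
move: total; set a := fine _; set b := fine _.
rewrite -EFinD => -[ab1].
rewrite -!EFinM -EFinD lee_fin => H.
have b0 : 0 <= b by rewrite fine_ge0.
congr EFin; apply/eqP; rewrite eq_le b0 andbT.
have : eta * b <= 0.
  have -> : eta * b = W * a + (W + eta) * b - W * (a + b) by ring.
  by rewrite ab1 mulr1 subr_le0.
by rewrite pmulr_rle0.
Qed.

End frostman.

Lemma near_arith {R : realFieldType} (a b c t w g l : R) :
  a - b <= g / 4 -> b - c <= l -> c <= t -> t <= w + g / 4 -> l <= g / 4 ->
  a <= w + g * 3 / 4.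
Proof. lra. Qed.

Section frostman_everywhere.
Context {R : realType} {d : nat} (alpha : R).
Notation T := (borel_rV R d).
Notation q := (d%:R - alpha).
Hypothesis ad : alpha < d%:R.
Hypothesis alpha2 : alpha <= 2.
Hypothesis d0 : (0 < d)%N.
Context (E : set 'rV[R]_d) (muE : probability T R).
Hypothesis cE : compact E.
Hypothesis finW : (robin alpha E < +oo)%E.
Hypothesis eqE : is_equilibrium alpha E muE.
Implicit Types (x y z : 'rV[R]_d) (e : R).

Let q0 : 0 < q. Proof. by rewrite subr_gt0. Qed.

Notation W := (fine (robin alpha E)).

(** Chebyshev's inequality for u - tpot_delta, whose integral is at most zeta * eps for some delta
    because the truncated energies increase to W. *)
Lemma tail_small (zeta eps : R) : 0 < zeta -> 0 < eps -> exists2 delta, 0 < delta &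
  (muE (~` [set x | forall e, (0 < e)%R -> (tpot alpha e muE x <=
     tpot alpha delta muE x + zeta)%R]) <= eps%:E)%E.
Proof.
move=> z0 e0.
have := @cvg_int_tpot _ _ _ ad muE muE.
rewrite -/(energy alpha muE) (energy_finE finW eqE).
move=> /fine_cvgP[_] /cvgrPdist_le /(_ _ (mulr_gt0 z0 e0)) [N _ /(_ N (leqnn N))].
pose de : R := N.+1%:R^-1; have de0 : 0 < de by rewrite /de invr_gt0.
rewrite /= => HN0.
have HN : `|W - \int[muE]_x tpot alpha de muE x| <= zeta * eps := HN0.
exists de => //; set C := mkset _.
have mC : measurable (C : set T).
  apply: closed_measurable_rV; apply: (closed_tpot_le ad).
  by apply: ctsD; [exact: tpot_continuous|exact: cts_cst].
have mCc := measurableC mC.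
have bt := bmeas_tpot ad muE de0.
have bi : bmeas (fun x : T => zeta * \1_(~` C) x).
  by apply: bmeasM; [exact: bmeas_cst|exact: bmeas_indic].
have : \int[muE]_x (tpot alpha de muE x + zeta * \1_(~` C) x) <= W.
  rewrite -lee_fin -bintE; last exact: bmeasD.
  rewrite -(energy_finE finW eqE); apply: ge0_le_integral => //.
  - move=> x _; rewrite lee_fin addr_ge0 ?tpot_ge0// mulr_ge0 ?(ltW z0)//.
  - by apply/measurable_EFinP; case: (bmeasD bt bi).
  - exact: measurable_potential.
  move=> x _; rewrite indicE; have [xC|xC] := boolP (x \in ~` C); last first.
    by rewrite mulr0 addr0; exact: tpot_potential.
  move: xC; rewrite in_setE mulr1 => /existsNP[e /not_implyP[ep /negP]].
  rewrite -ltNge => /ltW H.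
  by apply: (le_trans _ (tpot_potential ad muE x ep)); rewrite lee_fin.
rewrite bintD// bintZl; last exact: bmeas_indic.
rewrite bint_indic// => H.
rewrite -[leLHS]fineK ?fin_num_measure// lee_fin -(ler_pM2l z0).
rewrite -(lerD2l (\int[muE]_x tpot alpha de muE x)) (le_trans H)//.
by rewrite addrC -lerBlDr (le_trans (ler_norm _)).
Qed.

(** An Egorov-type selection inside E. K is compact because each of the two bounds is an
    intersection of closed conditions between continuous functions. *)
Lemma good_compact (eps eta zeta : R) : 0 < eps -> 0 < eta -> 0 < zeta ->
  exists (K : set 'rV[R]_d) (delta : R),
  [/\ compact K, 0 < delta, (muE (~` K) <= eps%:E)%E,
    forall x e, K x -> 0 < e -> tpot alpha e muE x <= W + eta &
    forall x e, K x -> 0 < e -> tpot alpha e muE x <= tpot alpha delta muE x + zeta].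
Proof.
move=> e0 h0 z0; have [de de0 Hde] := tail_small z0 e0.
pose C1 := [set x | forall e, 0 < e -> tpot alpha e muE x <= W + eta].
pose C2 := [set x | forall e, 0 < e ->
  tpot alpha e muE x <= tpot alpha de muE x + zeta].
have c1 : closed C1 by apply: (closed_tpot_le ad); exact: cts_cst.
have c2 : closed C2.
  apply: (closed_tpot_le ad).
  by apply: ctsD; [exact: tpot_continuous|exact: cts_cst].
exists (E `&` (C1 `&` C2)), de; split => //.
- apply: (subclosed_compact _ cE); last by move=> x [].
  by apply: closedI; [exact: compact_closed|exact: closedI].
- have mE' := mE cE.
  have m1 : measurable (C1 : set T) := closed_measurable_rV c1.
  have m2 : measurable (C2 : set T) := closed_measurable_rV c2.
  have n1 := frostman_ae ad cE finW eqE h0.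
  have [nE _] := eqE.
  rewrite !setCI.
  have mEc := measurableC mE'; have m1c := measurableC m1.
  have m2c := measurableC m2.
  have h1 : (muE (~` E `|` (~` C1 `|` ~` C2)) <=
      muE (~` E) + muE (~` C1 `|` ~` C2))%E.
    by apply: measureU2 => //; exact: measurableU.
  have h2 : (muE (~` C1 `|` ~` C2) <= muE (~` C1) + muE (~` C2))%E.
    exact: measureU2.
  apply: (le_trans h1); rewrite nE add0e; apply: (le_trans h2).
  by rewrite n1 add0e.
- by move=> x e [_ [H _]]; exact: H.
- by move=> x e [_ [_ H]]; exact: H.
Qed.

Lemma tpot_mrestr_le (K : set T) (mK : measurable K) e x : 0 < e ->
  tpot alpha e (mrestr muE mK) x <= tpot alpha e muE x.
Proof.
move=> e0; have bk := bmeas_kap ad x e0.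
rewrite /tpot bint_mrestr//; last by move=> y; exact: kap_ge0.
apply: bint_le => //; first by apply: bmeasM => //; exact: bmeas_indic.
move=> y; apply: ler_piMr; first exact: kap_ge0.
by rewrite indicE; case: (_ \in _).
Qed.

Lemma tpot_mrestr_ge (K : set T) (mK : measurable K) e x : 0 < e ->
  tpot alpha e muE x <=
  tpot alpha e (mrestr muE mK) x + e `^ (- q) * fine (muE (~` K)).
Proof.
move=> e0; have bk := bmeas_kap ad x e0; have mKc := measurableC mK.
rewrite /tpot bint_mrestr//; last by move=> y; exact: kap_ge0.
rewrite -bint_indic// -bintZl; last exact: bmeas_indic.
have b1 : bmeas (fun y : T => kap alpha e (x - (y : 'rV[R]_d)) * \1_K y).
  by apply: bmeasM => //; exact: bmeas_indic.
have b2 : bmeas (fun y : T => e `^ (- q) * (\1_(~` K) y : R)).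
  by apply: bmeasM; [exact: bmeas_cst|exact: bmeas_indic].
rewrite -bintD//; apply: bint_le => //; first exact: bmeasD.
move=> y; rewrite !indicE in_setC; case: (y \in K) => /=.
  by rewrite mulr1 mulr0 addr0.
by rewrite mulr1 mulr0 add0r kap_le.
Qed.

Lemma tpot_mrestr_diff (K : set T) (mK : measurable K) e e' x :
  0 < e -> e <= e' ->
  tpot alpha e (mrestr muE mK) x - tpot alpha e' (mrestr muE mK) x <=
  tpot alpha e muE x - tpot alpha e' muE x.
Proof.
move=> e0 ee; have e'0 : 0 < e' by exact: lt_le_trans ee.
have bk := bmeas_kap ad x e0; have bk' := bmeas_kap ad x e'0.
rewrite /tpot !bint_mrestr//; try by move=> y; exact: kap_ge0.
have b1 : bmeas (fun y : T => kap alpha e (x - (y : 'rV[R]_d)) * \1_K y).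
  by apply: bmeasM => //; exact: bmeas_indic.
have b2 : bmeas (fun y : T => kap alpha e' (x - (y : 'rV[R]_d)) * \1_K y).
  by apply: bmeasM => //; exact: bmeas_indic.
rewrite -bintB// -bintB//; apply: bint_le; [exact: bmeasB|exact: bmeasB|].
move=> y; rewrite -mulrBl; apply: ler_piMr; first by rewrite subr_ge0 kap_anti.
by rewrite indicE; case: (_ \in _).
Qed.

(* xb is a point of K closest to x, so that |xb - y| <= 2 |x - y| on K. *)
Lemma tpot_near (rho : {finite_measure set T -> \bar R}) (K : set 'rV[R]_d)
    (mK : measurable (K : set T)) e e' x xb : rho (~` K) = 0%E ->
  0 < e -> e <= e' -> (forall y, K y -> enorm (xb - y) <= 2 * enorm (x - y)) ->
  tpot alpha e rho x - tpot alpha e' rho x <=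
  2 `^ q * (tpot alpha (2 * e) rho xb - tpot alpha (2 * e') rho xb).
Proof.
move=> rK e0 ee xK; have e'0 : 0 < e' by exact: lt_le_trans ee.
have e20 : 0 < 2 * e by rewrite mulr_gt0.
have e'20 : 0 < 2 * e' by rewrite mulr_gt0.
have bk z r : 0 < r -> bmeas (fun y : T => kap alpha r (z - (y : 'rV[R]_d))).
  by move=> r0; exact: bmeas_kap.
have b1 := bk x _ e0; have b2 := bk x _ e'0.
have b3 := bk xb _ e20; have b4 := bk xb _ e'20.
have b34 := bmeasB b3 b4.
have E1 := bintB rho b1 b2.
have E2 : _ = 2 `^ q * (tpot alpha (2 * e) rho xb - tpot alpha (2 * e') rho xb) :=
  etrans (bintZl rho (2 `^ q) b34) (congr1 (fun r => 2 `^ q * r) (bintB rho b3 b4)).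
rewrite -[leLHS]E1 -[leRHS]E2.
apply: (bint_le_null (bmeasB b1 b2) (bmeasM (bmeas_cst _) b34) (measurableC mK)) => //.
by move=> y /contrapT yK; apply: kap_ratio => //; exact: xK.
Qed.

Lemma nearest_point (K : set 'rV[R]_d) x : compact K -> K !=set0 ->
  exists2 xb, K xb & forall y, K y -> enorm (x - xb) <= enorm (x - y).
Proof.
move=> cK K0.
have [|c cK' H] := @EVT_min_rV R d (fun y => enorm (x - y)) K K0 cK.
  apply: continuous_subspaceT; apply: (@lipschitz_enorm_continuous _ _ _ 1) => //.
  move=> y z; rewrite mul1r (le_trans (ler_dist_enorm _ _))//.
  by rewrite (_ : x - y - (x - z) = z - y) 1?enormB// opprB addrC addrA subrK.
exists c; first by rewrite in_setE in cK'.
by move=> y Ky; apply: H; rewrite in_setE.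
Qed.

Lemma tpot_le_robin e x : 0 < e -> tpot alpha e muE x <= W.
Proof.
move=> e0; apply/ler_addgt0Pr => g g0.
(* Four errors of g / 4 each: eta for the bound on K, 2^q zeta for the truncation error near K, the
   Lipschitz error controlled by r below, and e^-q eps for the mass left outside K. *)
pose eta := g / 4; pose zeta := g / (4 * 2 `^ q).
pose eps := g / (4 * e `^ (- q)).
have P2 : 0 < 2 `^ q by exact: powR_gt0.
have Pe : 0 < e `^ (- q) by exact: powR_gt0.
have eta0 : 0 < eta by rewrite divr_gt0.
have zeta0 : 0 < zeta by rewrite divr_gt0// mulr_gt0.
have eps0 : 0 < eps by rewrite divr_gt0// mulr_gt0.
have [K [de [cK de0 Keps Keta Kzeta]]] := good_compact eps0 eta0 zeta0.
have mK : measurable (K : set T) by exact: compact_measurable_rV.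
pose rho : {finite_measure set T -> \bar R} := mrestr muE mK.
have rhoK : rho (~` K) = 0%E by rewrite /rho/= /mrestr setICl measure0.
pose L := q * (de / 2) `^ (- q - 1).
have L0 : 0 <= L by rewrite mulr_ge0 ?powR_ge0// ltW.
(* r <= e lets the final bound pass from scale r to scale e; r <= de / 2 leaves room for the doubled
   scales of [tpot_near]; the last entry gives 2 L r <= g / 4. *)
pose r := Num.min e (Num.min (de / 2) (g / (8 * (L + 1)))).
have L1 : 0 < L + 1 by rewrite ltr_wpDl.
have r0 : 0 < r.
  rewrite /r !lt_min e0 divr_gt0//= divr_gt0// mulr_gt0//.
have re : r <= e by rewrite ge_min lexx.
have rde : r <= de / 2 by rewrite !ge_min lexx !orbT.
have rL : 2 * L * r <= g / 4.
  have : r <= g / (8 * (L + 1)) by rewrite !ge_min lexx !orbT.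
  rewrite ler_pdivlMr ?mulr_gt0//; move: (r) (L) (g) r0 => a b c a0; lra.
have [nB [Kn HnB]] : exists B, 0 <= B /\ forall y, K y -> enorm y <= B.
  have [M [_ HM]] := compact_bounded cK.
  exists (d%:R * (`|M| + 1)); split; first by rewrite mulr_ge0// addr_ge0.
  move=> y Ky; rewrite (le_trans (enorm_le_norm y))// ler_wpM2l//.
  by apply: HM => //; rewrite (le_lt_trans (ler_norm M))// ltrDl.
pose A := W + g * 3 / 4.
have A0 : 0 <= A.
  by rewrite addr_ge0 ?divr_ge0 ?mulr_ge0 ?(ltW g0) ?(robin_ge0 eqE).
have rhoT : fine (rho setT) <= 1.
  rewrite -[leRHS]/(fine 1%:E) fine_le ?fin_num_measure//.
  by rewrite /rho/= /mrestr setTI probability_le1.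
have near : forall z y, K y -> enorm (z - y) <= 2 * r -> tpot alpha r rho z <= A.
  move=> z y Ky zy.
  have [zb Kzb Hzb] := nearest_point z cK (ex_intro _ y Ky).
  have zb2 w : K w -> enorm (zb - w) <= 2 * enorm (z - w).
    move=> Kw; have := ler_enormD (zb - z) (z - w).
    rewrite addrA subrK (enormB zb) => /le_trans; apply.
    by rewrite mulr_natl mulr2n lerD2r Hzb.
  have h1 := tpot_near mK rhoK r0 rde zb2.
  have ded : 2 * (de / 2) = de by field.
  have r2de : 2 * r <= de by rewrite mulrC -ler_pdivlMr.
  have r20 : 0 < 2 * r by rewrite mulr_gt0.
  have h2 := tpot_mrestr_diff mK zb r20 r2de; rewrite -/rho in h2.
  have h3 := Kzeta _ _ Kzb r20.
  have d20 : 0 < de / 2 by rewrite divr_gt0.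
  have h4 := tpot_lip ad rho z zb d20; rewrite -/L in h4.
  have h5 := tpot_mrestr_le mK zb d20; rewrite -/rho in h5.
  have h6 := Keta _ _ Kzb d20.
  have h7 : enorm (z - zb) <= 2 * r := le_trans (Hzb _ Ky) zy.
  have h8 : L * fine (rho setT) * enorm (z - zb) <= L * (2 * r).
    rewrite -mulrA ler_wpM2l// (le_trans _ h7)// ler_piMl ?enorm_ge0//.
  have h9 : tpot alpha r rho z - tpot alpha (de / 2) rho z <= g / 4.
    apply: (le_trans h1); rewrite ded.
    apply: (@le_trans _ _ (2 `^ q * zeta)); last first.
      by rewrite /zeta le_eqVlt; apply/orP; left; apply/eqP; field; rewrite gt_eqF.
    by rewrite ler_wpM2l ?(ltW P2)// (le_trans h2)// lerBlDl.
  have h10 := le_trans (le_trans (ler_norm _) h4) h8.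
  apply: (near_arith h9 h10 h5 h6).
  by rewrite mulrA (mulrC L).
have final := tpot_max ad alpha2 d0 mK rhoK r0 A0 HnB near x.
apply: (le_trans (tpot_mrestr_ge mK x e0)); rewrite -/rho.
have h1 : tpot alpha e rho x <= A by apply: (le_trans _ final); exact: tpot_anti.
have h2 : e `^ (- q) * fine (muE (~` K)) <= g / 4.
  apply: (@le_trans _ _ (e `^ (- q) * eps)); last first.
    by rewrite /eps le_eqVlt; apply/orP; left; apply/eqP; field; rewrite gt_eqF.
  rewrite ler_wpM2l ?(ltW Pe)// -lee_fin fineK// fin_num_measure//.
  exact: measurableC.
rewrite (le_trans (lerD h1 h2))// /A -addrA lerD2l -mulrDl.
by rewrite -{2}[g]mulr1 -mulrDr -mulrA ler_piMr ?(ltW g0)//; lra.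
Qed.

Theorem frostman x : (potential alpha muE x <= robin alpha E)%E.
Proof.
rewrite (robinE finW eqE); apply: (potential_le ad) => e e0.
exact: tpot_le_robin.
Qed.

End frostman_everywhere.

(** * Averages over point sets and the converse *)

Section point_averages.
Context {R : realType} {d : nat}.
Notation T := (borel_rV R d).
Implicit Types (x y : 'rV[R]_d).

Definition avg n (X : 'I_n -> 'rV[R]_d) (f : 'rV[R]_d -> R) : R :=
  n%:R^-1 * \sum_(k < n) f (X k).

Lemma avgD n (X : 'I_n -> 'rV[R]_d) f g :
  avg X (fun x => f x + g x) = avg X f + avg X g.
Proof. by rewrite /avg big_split mulrDr. Qed.

Lemma avgN n (X : 'I_n -> 'rV[R]_d) f : avg X (fun x => - f x) = - avg X f.
Proof. by rewrite /avg sumrN mulrN. Qed.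

Lemma avgB n (X : 'I_n -> 'rV[R]_d) f g :
  avg X (fun x => f x - g x) = avg X f - avg X g.
Proof. by rewrite avgD avgN. Qed.

Lemma avgZl n (X : 'I_n -> 'rV[R]_d) c f :
  avg X (fun x => c * f x) = c * avg X f.
Proof. by rewrite /avg -mulr_sumr mulrCA. Qed.

Lemma avg_cst n (X : 'I_n -> 'rV[R]_d) c : (0 < n)%N -> avg X (fun=> c) = c.
Proof.
move=> n0; rewrite /avg sumr_const card_ord -[c *+ n]mulr_natl mulrA mulVf ?mul1r//.
by rewrite pnatr_eq0 -lt0n.
Qed.

Lemma avg_le n (X : 'I_n -> 'rV[R]_d) f g :
  (forall x, f x <= g x) -> avg X f <= avg X g.
Proof.
by move=> fg; rewrite ler_wpM2l ?invr_ge0//; apply: ler_sum => k _.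
Qed.

Lemma avg_ge0 n (X : 'I_n -> 'rV[R]_d) f : (forall x, 0 <= f x) -> 0 <= avg X f.
Proof.
by move=> f0; rewrite mulr_ge0 ?invr_ge0//; apply: sumr_ge0.
Qed.

Lemma ge0_integral_counting n (X : 'I_n -> 'rV[R]_d) (f : T -> \bar R) :
  measurable_fun setT f -> (forall x, 0 <= f x)%E ->
  (\int[counting_measure X]_x f x = n%:R^-1%:E * \sum_(k < n) f (X k))%E.
Proof.
move=> mf f0.
have n0 : 0 <= n%:R^-1 :> R by rewrite invr_ge0.
pose m (k : nat) : {measure set T -> \bar R} :=
  dirac (oapp X point (insub k) : T).
transitivity (\int[mscale (NngNum n0) (msum m n)]_x f x)%E.
  apply: eq_measure_integral => A mA _.
  rewrite /= /counting_measure /mscale /msum/=; congr (_ * _)%E.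
  by apply: eq_bigr => k _; rewrite /m/= valK.
rewrite ge0_integral_mscale// ge0_integral_measure_sum//=.
congr (_ * _)%E; apply: eq_bigr => k _.
by rewrite /m integral_dirac//= diracT mul1e valK.
Qed.

Lemma integral_counting n (X : 'I_n -> 'rV[R]_d) (f : T -> R) :
  measurable_fun setT f ->
  (\int[counting_measure X]_x (f x)%:E = (avg X f)%:E)%E.
Proof.
move=> mf; have mEf : measurable_fun setT (EFin \o f) by exact/measurable_EFinP.
rewrite integralE (@ge0_integral_counting _ _ ((EFin \o f)^\+)%E); last 2 first.
- exact: measurable_funepos.
- by move=> x; exact: funepos_ge0.
rewrite (@ge0_integral_counting _ _ ((EFin \o f)^\-)%E); last 2 first.
- exact: measurable_funeneg.
- by move=> x; exact: funeneg_ge0.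
have E1 x : ((EFin \o f)^\+ x = (Num.max (f x) 0)%:E)%E.
  by rewrite funeposE /= -EFin_max.
have E2 x : ((EFin \o f)^\- x = (Num.max (- f x) 0)%:E)%E.
  by rewrite funenegE /= -EFin_max.
under eq_bigr do rewrite E1; under [X in (_ - _ * X)%E]eq_bigr do rewrite E2.
rewrite !sumEFin -!EFinM -EFinB -mulrBr -sumrB; congr EFin.
rewrite /avg; congr (_ * _); apply: eq_bigr => k _.
by case: (leP (f (X k)) 0) => h; case: (leP (- f (X k)) 0) => h'; lra.
Qed.

Lemma compactly_supported_eball (f : 'rV[R]_d -> R) (B : R) :
  (forall x, B < enorm x -> f x = 0) -> compactly_supported f.
Proof.
move=> fB; apply: (subclosed_compact _ (@compact_eball R d B)).
  exact: closed_closure.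
have cB : closed [set x : 'rV[R]_d | enorm x <= B].
  by apply: cts_closed_le; exact: continuous_enorm.
rewrite [X in _ `<=` X]((closure_id _).1 cB).
apply: closure_subset => x /= fx0; rewrite leNgt; apply/negP => /fB fx.
by rewrite fx eqxx in fx0.
Qed.

Definition cutoff (B : R) x : R := Num.max 0 (Num.min 1 (B + 1 - enorm x)).

Lemma cutoff_continuous B : continuous (cutoff B).
Proof.
apply: cts_max; first exact: cts_cst.
apply: cts_min; first exact: cts_cst.
by apply: ctsB; [exact: cts_cst|exact: continuous_enorm].
Qed.

Lemma cutoff_eq1 B x : enorm x <= B -> cutoff B x = 1.
Proof.
move=> xB; rewrite /cutoff (min_idPl _); last by lra.
exact/max_idPr.
Qed.

Lemma cutoff_eq0 B x : B + 1 < enorm x -> cutoff B x = 0.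
Proof.
move=> xB; apply/max_idPl; rewrite ge_min; apply/orP; right; lra.
Qed.

Lemma cutoff_ge0 B x : 0 <= cutoff B x.
Proof. by rewrite le_max lexx. Qed.

Lemma cutoff_le1 B x : cutoff B x <= 1.
Proof. by rewrite ge_max ler01 ge_min lexx. Qed.

Lemma compact_enorm_bounded (K : set 'rV[R]_d) : compact K ->
  exists B : R, 0 <= B /\ forall y, K y -> enorm y <= B.
Proof.
move=> cK; have [M [_ HM]] := compact_bounded cK.
exists (d%:R * (`|M| + 1)); split; first by rewrite mulr_ge0// addr_ge0.
move=> y Ky; rewrite (le_trans (enorm_le_norm y))// ler_wpM2l//.
by apply: HM => //; rewrite (le_lt_trans (ler_norm M))// ltrDl.
Qed.

End point_averages.

Section converse.
Context {R : realType} {d : nat} (alpha : R).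
Notation T := (borel_rV R d).
Notation q := (d%:R - alpha).
Hypothesis ad : alpha < d%:R.
Hypothesis alpha2 : alpha <= 2.
Hypothesis d0 : (0 < d)%N.
Context (E : set 'rV[R]_d) (muE : probability T R).
Hypothesis cE : compact E.
Hypothesis finW : (robin alpha E < +oo)%E.
Hypothesis eqE : is_equilibrium alpha E muE.
Implicit Types (x y z : 'rV[R]_d) (e : R).

Notation W := (fine (robin alpha E)).

Definition upot x : R := fine (potential alpha muE x).

Lemma upotE x : potential alpha muE x = (upot x)%:E.
Proof.
rewrite fineK// ge0_fin_numE ?potential_ge0//.
rewrite (le_lt_trans (frostman ad alpha2 d0 cE finW eqE x))//.
Qed.

Lemma upot_ge0 x : 0 <= upot x.
Proof. by rewrite fine_ge0// potential_ge0. Qed.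

Lemma upot_le x : upot x <= W.
Proof.
by rewrite -lee_fin -upotE -(robinE finW eqE); exact: (frostman ad alpha2 d0 cE finW eqE).
Qed.

Lemma tpot_upot e x : 0 < e -> tpot alpha e muE x <= upot x.
Proof. by move=> e0; rewrite -lee_fin -upotE; exact: tpot_potential. Qed.

Definition mext n (X : 'I_n -> 'rV[R]_d) : R :=
  n%:R^-1 * \sum_(k < n | X k \notin E) (W - upot (X k)).

Lemma mextE n (X : 'I_n -> 'rV[R]_d) : m_ext alpha E muE X = (mext X)%:E.
Proof.
rewrite /m_ext /mext EFinM -sumEFin; congr (_ * _)%E.
by apply: eq_bigr => k _; rewrite /green upotE (robinE finW eqE).
Qed.

Lemma mext_ge0 n (X : 'I_n -> 'rV[R]_d) : 0 <= mext X.
Proof.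
rewrite mulr_ge0 ?invr_ge0//; apply: sumr_ge0 => k _.
by rewrite subr_ge0 upot_le.
Qed.

Lemma int_tpot_cvg : \int[muE]_x tpot alpha n.+1%:R^-1 muE x @[n --> \oo] --> W.
Proof.
have := @cvg_int_tpot _ _ _ ad muE muE.
by rewrite -/(energy alpha muE) (energy_finE finW eqE) => /fine_cvgP[_].
Qed.

Lemma mext_cvg0 (X : forall n : nat, 'I_n -> 'rV[R]_d) :
  weak_cvg (fun n => counting_measure (X n)) muE ->
  m_ext alpha E muE (X n) @[n --> \oo] --> 0%E.
Proof.
move=> wX; under eq_fun do rewrite mextE; apply: cvg_EFin.
  exact: nearW.
under eq_fun do rewrite /=.
apply/cvgrPdist_le => eps eps0.
have e20 : 0 < eps / 2 by rewrite divr_gt0.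
have /cvgrPdist_le /(_ _ e20) [N _ /(_ N (leqnn N))] := int_tpot_cvg.
pose e : R := N.+1%:R^-1; have e0 : 0 < e by rewrite invr_gt0.
rewrite /= -/e => HN.
have [B [B0 EB]] := compact_enorm_bounded cE.
pose f x := cutoff B x * tpot alpha e muE x.
have cf : continuous f.
  by apply: ctsM; [exact: cutoff_continuous|exact: tpot_continuous].
have csf : compactly_supported f.
  apply: (@compactly_supported_eball _ _ _ (B + 1)) => x xB.
  by rewrite /f cutoff_eq0// mul0r.
have bt := bmeas_tpot ad muE e0.
have bc : bmeas (cutoff B : T -> R).
  split; first by apply: continuous_measurable_rV; exact: cutoff_continuous.
  by exists 1 => x; rewrite ger0_norm ?cutoff_le1 ?cutoff_ge0.
have bf : bmeas (f : T -> R) by exact: bmeasM.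
have fE : \int[muE]_x f x = \int[muE]_x tpot alpha e muE x.
  have [muE0 _] := eqE; have mE' := mE cE.
  apply: (bint_eq_null bf bt (measurableC mE') muE0) => x /contrapT Ex.
  by rewrite /f cutoff_eq1 ?mul1r//; exact: EB.
have f_le x : f x <= upot x.
  rewrite (le_trans _ (tpot_upot x e0))// ler_piMl ?tpot_ge0//.
  exact: cutoff_le1.
have := wX f cf csf; rewrite bintE//.
under eq_fun do rewrite (integral_counting _ bf.1).
move=> /fine_cvgP[_] /cvgrPdist_le /(_ _ e20) Hf.
near=> n.
have n0 : (0 < n)%N by near: n; exists 1%N.
rewrite /= sub0r normrN ger0_norm ?mext_ge0//.
have : mext (X n) <= avg (X n) (fun x => W - f x).
  rewrite /mext /avg ler_wpM2l ?invr_ge0//.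
  (* The points in E are put back into the sum: their terms W - f are nonnegative, and the sum
     becomes an average of a continuous function. *)
  rewrite [leRHS](bigID (fun k => X n k \notin E))/=.
  apply: ler_wpDr; last by apply: ler_sum => k _; rewrite lerD2l lerN2 f_le.
  apply: sumr_ge0 => k _.
  by rewrite subr_ge0 (le_trans (f_le _))// upot_le.
move=> /le_trans; apply; rewrite avgB (avg_cst _ _ n0).
have : `|\int[muE]_x f x - avg (X n) f| <= eps / 2 by near: n; exact: Hf.
rewrite fE => H.
have a1 := le_trans (ler_norm _) H; have a2 := le_trans (ler_norm _) HN.
rewrite -(subrK (\int[muE]_x tpot alpha e muE x) W) -addrA.
by rewrite (le_trans (lerD a2 a1))// -splitr.
Unshelve. all: by end_near. Qed.

End converse.

(** * Limit measures along ultrafilters *)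

Section binary_tree_measure.
Context {R : realType} (w : seq bool -> R).
Hypothesis w1 : w [::] = 1.
Hypothesis w_ge0 : forall s, 0 <= w s.
Hypothesis wS : forall s, w s = w (rcons s false) + w (rcons s true).
Implicit Types (s : seq bool) (t : R) (l : nat).

(* The strings of length l label consecutive intervals of [0, 1[, in
   lexicographic order, the one labelled by s being [left s, left s + w s[. *)
Let left s : R := \sum_(i < size s | nth false s i) w (rcons (take i s) false).

Let left_rcons s b :
  left (rcons s b) = left s + (if b then w (rcons s false) else 0).
Proof.
rewrite /left size_rcons.
rewrite (eq_bigl (fun i : 'I_(size s).+1 => nth false (rcons s b) i))//.
rewrite big_mkcond big_ord_recr/= nth_rcons ltnn eqxx -cats1 take_size_cat//.
congr (_ + _).
rewrite [RHS]big_mkcond; apply: eq_bigr => i _ /=.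
by rewrite nth_cat ltn_ord takel_cat// ltnW.
Qed.

Let left_ge0 s : 0 <= left s.
Proof. by apply: sumr_ge0 => i _; exact: w_ge0. Qed.

Let right_le1 s : left s + w s <= 1.
Proof.
elim/last_ind: s => [|s b IH]; first by rewrite /left big_ord0 add0r w1.
rewrite left_rcons (le_trans _ IH)// (wS s) -addrA lerD2l; case: b => //.
by rewrite add0r lerDl.
Qed.

(** Makes the coding total; the points moved to 0 are null for Lebesgue measure restricted to [0,
    1[. *)
Let clip t : R := if (0 <= t) && (t < 1) then t else 0.

Let clip01 t : 0 <= clip t < 1.
Proof. by rewrite /clip; case: ifP => // _; rewrite lexx ltr01. Qed.

(** Binary search for the string of length l whose interval contains [clip t]: the next bit tells
    whether this point lies beyond the left child. *)
Let Fixpoint S l t : seq bool := if l is k.+1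
  then rcons (S k t) (left (S k t) + w (rcons (S k t) false) <= clip t)
  else [::].

Let size_S l t : size (S l t) = l.
Proof. by elim: l => //= l IH; rewrite size_rcons IH. Qed.

Let SP l t s : size s = l ->
  (S l t == s) = (left s <= clip t < left s + w s).
Proof.
elim/last_ind: s l => [|s b IH] l.
  by move=> <- /=; rewrite eqxx /left big_ord0 add0r w1; case/andP: (clip01 t) => -> ->.
rewrite size_rcons => <- /=; rewrite eqseq_rcons.
have sub : left (rcons s b) <= clip t < left (rcons s b) + w (rcons s b) ->
    left s <= clip t < left s + w s.
  rewrite left_rcons (wS s); have := w_ge0 (rcons s false); have := w_ge0 (rcons s true).
  by case: b => h1 h2 /andP[h3 h4]; apply/andP; split; lra.
have [Ss|Ss] := eqVneq (S (size s) t) s; last first.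
  by apply/esym/negbTE/negP => /sub; rewrite -(IH (size s))// (negbTE Ss).
have := IH _ erefl; rewrite Ss eqxx => /esym/andP[h1 h2]; rewrite /= left_rcons.
case: b {sub} => /=; first by rewrite eqb_id -addrA -wS h2 andbT.
by rewrite eqbF_neg addr0 h1 /= ltNge.
Qed.

Let measurable_clip : measurable_fun setT (clip : measurableTypeR R -> R).
Proof.
apply: measurable_fun_ifT => //.
by apply: measurable_and; [exact: measurable_fun_ler|exact: measurable_fun_ltr].
Qed.

(** P is Lebesgue measure on [0, 1[, under which the interval of s has measure w s. The clause
    [0 < w (S l t)] holds for every t, since a half-open interval containing a point has positive
    length; later it shows that all coded cells are inhabited. *)
Lemma binary_tree_measure :
  exists (P : probability (measurableTypeR R) R) (S : nat -> R -> seq bool),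
  forall l, [/\ forall t, size (S l t) = l,
    forall t, exists b, S l.+1 t = rcons (S l t) b,
    forall t, 0 < w (S l t),
    forall s, measurable ([set t | S l t = s] : set (measurableTypeR R)) &
    forall s, size s = l -> P [set t | S l t = s] = (w s)%:E].
Proof.
have mI : measurable (`[0 : R, 1[%classic : set (measurableTypeR R)).
  exact: measurable_itv.
pose lam : {measure set (measurableTypeR R) -> \bar R} :=
  mrestr (@lebesgue_measure R) mI.
have lam1 : lam setT = 1%:E.
  rewrite /lam/= /mrestr setTI lebesgue_measure_itv/= lte_fin ltr01.
  by rewrite -EFinB subr0.
pose P : probability (measurableTypeR R) R :=
  mnormalize lam (dirac (0 : measurableTypeR R)).
exists P, S => l.
have mS s : measurable ([set t | S l t = s] : set (measurableTypeR R)).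
  have [ls|ls] := eqVneq (size s) l; last first.
    rewrite (_ : mkset _ = set0)//; apply/seteqP; split => // t /= St.
    by move: ls; rewrite -St size_S eqxx.
  rewrite (_ : mkset _ = clip @^-1` `[left s, left s + w s[%classic).
    by rewrite -[X in measurable X]setTI; apply: measurable_clip => //; exact: measurable_itv.
  apply/seteqP; split => t /=; rewrite in_itv/= -(SP t ls).
    by move=> ->; rewrite eqxx.
  by move/eqP.
split => //.
- by move=> t; eexists.
- move=> t; have := SP t (size_S l t); rewrite eqxx => /esym/andP[h1 h2].
  by have := le_lt_trans h1 h2; rewrite ltrDl.
- move=> s ls.
  transitivity (lam [set t | S l t = s] * 1^-1%:E)%E; first exact: mnormalizeE.
  rewrite invr1 mule1.
  rewrite /lam/= /mrestr.
  rewrite (_ : _ `&` _ = `[left s, left s + w s[%classic).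
    rewrite lebesgue_measure_itv/= lte_fin ltrDl.
    case: ltP => [_|w0]; first by rewrite -EFinB addrAC subrr add0r.
    by congr EFin; apply/eqP; rewrite eq_le w0 w_ge0.
  apply/seteqP; split => t /=; rewrite !in_itv/=.
    move=> [/eqP + t01]; rewrite (SP t ls) /clip t01.
    exact.
  move=> /andP[h1 h2].
  have t01 : (0 <= t) && (t < 1).
    by rewrite (le_trans (left_ge0 s) h1) (lt_le_trans h2 (right_le1 s)).
  by split => //; apply/eqP; rewrite (SP t ls) /clip t01 h1 h2.
Qed.

End binary_tree_measure.

Lemma three_quarters_le {R : realFieldType} (x : R) : 0 < x ->
  x / 4 + x / 4 + x / 4 <= x.
Proof. by move=> ?; lra. Qed.

Lemma cvgr_sumr {R : realType} (J I : Type) (F : set_system J) (r : seq I)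
    (v : I -> J -> R) (a : I -> R) : Filter F ->
  (forall i, v i n @[n --> F] --> a i) ->
  \sum_(i <- r) v i n @[n --> F] --> \sum_(i <- r) a i.
Proof.
move=> FF va; elim: r => [|i r IH].
  by under eq_fun do rewrite big_nil; rewrite big_nil; exact: cvg_cst.
by under eq_fun do rewrite big_cons; rewrite big_cons; exact: cvgD.
Qed.

(** A cluster point in the compact segment is a limit, because U contains each preimage or its
    complement. *)
Lemma ultra_cvg_bounded {R : realType} (I : Type) (U : set_system I)
    (v : I -> R) (C : R) : UltraFilter U -> (forall n, `|v n| <= C) ->
  cvg (v n @[n --> U]).
Proof.
move=> UU vC.
have vU : (v @ U) `[- C, C]%classic.
  change (U (v @^-1` `[- C, C]%classic)); apply: filterE => n /=.
  by rewrite in_itv/= -ler_norml.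
have [p [_ clp]] := @segment_compact R (- C) C _ (fmap_proper_filter v _) vU.
apply/cvg_ex; exists p => B Bp.
have [//|UB] := in_ultra_setVsetC (v @^-1` B) UU.
have [x [] //] : ~` B `&` B !=set0 by apply: clp.
Qed.

(** If the preimage of a neighbourhood of c is not in F, its complement is compatible with F and
    belongs to a finer ultrafilter, along which v cannot tend to c. *)
Lemma cvg_ultra {R : realType} (I : Type) (F : set_system I) (v : I -> R) (c : R) :
  ProperFilter F ->
  (forall U : set_system I, UltraFilter U -> F `<=` U -> v n @[n --> U] --> c) ->
  v n @[n --> F] --> c.
Proof.
move=> FF H B Bc; apply: contrapT => nFB.
have nF : ~ F (v @^-1` B) by [].
have FD : ProperFilter (within (~` (v @^-1` B)) F).
  apply: Build_ProperFilter_ex => D DF.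
  apply: contrapT => D0; apply: nF.
  move: DF; rewrite /within/= => DF; apply: filterS DF => n nD.
  by apply: contrapT => /nD Dn; apply: D0; exists n.
have [U [UU sU]] := ultraFilterLemma FD.
have FU : F `<=` U.
  by move=> D FDD; apply: sU; apply: filterS FDD => n Dn _.
have UB : U (v @^-1` B) by exact: (H U UU FU).
have UnB : U (~` (v @^-1` B)) by apply: sU; rewrite /within/=; apply: filterE => n; exact.
have : U set0 by rewrite -(setICr (v @^-1` B)); exact: filterI.
exact: filter_not_empty.
Qed.

Lemma compact_unif_continuous {R : realType} {V : normedModType R} (K : set V)
    (f : V -> R) (e : R) : compact K -> continuous f -> 0 < e ->
  exists2 r, 0 < r & forall x y, K x -> `|x - y| <= r -> `|f x - f y| <= e.
Proof.
move=> /compact_near_coveringP cK cf e0.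
have e20 : 0 < e / 2 by rewrite divr_gt0.
have [|r /= r0 Hr] := cK _ 0^'+ (fun r x => forall y, `|x - y| <= r -> `|f x - f y| <= e) _.
  move=> x Kx.
  have /cvgrPdist_lt /(_ _ e20) := cf x.
  move=> /nbhs_ballP[r /= r0 Hr].
  have r20 : 0 < r / 2 by rewrite divr_gt0.
  exists (ball x (r / 2), [set s | s < r / 2]).
    split; first exact: nbhsx_ballx.
    by apply: nbhs_right_lt.
  move=> [y s] /= [xy sr] z yz.
  rewrite -(subrKA (f x)) (le_trans (ler_normD _ _))// (splitr e) lerD//.
    rewrite distrC ltW//; apply: Hr; apply: le_ball xy.
    by rewrite ler_pdivrMr// ler_peMr ?(ltW r0)//; lra.
  rewrite ltW//; apply: Hr; rewrite -ball_normE/= -(subrKA y).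
  rewrite (le_lt_trans (ler_normD _ _))// (splitr r) ltr_leD//.
    by move: xy; rewrite -ball_normE.
  by rewrite (le_trans yz)// ltW.
exists (r / 2); first by rewrite divr_gt0.
move=> x y Kx xy; apply: (Hr (r / 2)) => //=; rewrite ?divr_gt0//.
by rewrite sub0r normrN gtr0_norm ?divr_gt0// ltr_pdivrMr// ltr_pMr//; lra.
Qed.

Section limit_measure.
Context {R : realType} {d : nat}.
Notation T := (borel_rV R d).
Context (M : R).
Implicit Types (x y : 'rV[R]_d).

Let Q : set 'rV[R]_d := [set x | `|x| <= M].

Let closedQ : closed Q.
Proof. by apply: cts_closed_le => x; exact: norm_continuous. Qed.

Let compactQ : compact Q.
Proof.
apply: bounded_closed_compact => //.
exists M; split; first exact: num_real.
by move=> N MN x /= xM; rewrite (le_trans xM)// ltW.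
Qed.

(** The answers to all tests x_j < a / (N + 1) - M, enumerated by [pickle]. On Q, those with a fixed
    N and finitely many a locate x to within 1 / (N + 1). *)
Let bit (i : nat) x : bool :=
  if (unpickle i : option ('I_d * nat * nat)) is Some (j, a, N)
  then x ord0 j < a%:R / N.+1%:R - M else false.

Let code l x : seq bool := [seq bit i x | i <- iota 0 l].

Let size_code l x : size (code l x) = l.
Proof. by rewrite size_map size_iota. Qed.

Let codeS l x : code l.+1 x = rcons (code l x) (bit l x).
Proof. by rewrite /code -addn1 iotaD map_cat cats1. Qed.

Let code_bit l x y i : (i < l)%N -> code l x = code l y -> bit i x = bit i y.
Proof.
move=> il /(congr1 (nth false ^~ i)).
by rewrite !(nth_map 0) ?size_iota// nth_iota.
Qed.

Lemma norm_le_coord x (e : R) : 0 <= e ->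
  (forall i, `|x ord0 i| <= e) -> `|x| <= e.
Proof.
move=> e0 H; rewrite [leLHS]/Num.norm/= mx_normrE; apply/bigmax_leP; split => //.
by move=> [j i] _ /=; rewrite ord1.
Qed.

Let code_close k : exists l, forall x y, Q x -> Q y ->
  code l x = code l y -> `|x - y| <= k.+1%:R^-1.
Proof.
(* On Q the number (x_j + M) (k + 1) lies in [0, 2 M (k + 1)], so the tests with a < A suffice; l
   exceeds the index of each of them. *)
pose A := (Num.truncn (2 * M * k.+1%:R)).+2.
pose l := (\max_(p : 'I_d * 'I_A) pickle (p.1, nat_of_ord p.2, k)).+1.
exists l.
have k0 : 0 < k.+1%:R :> R by [].
suff H x y j : Q x -> Q y -> code l x = code l y ->
    y ord0 j - x ord0 j <= k.+1%:R^-1.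
  move=> x y Qx Qy xy; apply: norm_le_coord => // j.
  rewrite !mxE ler_norml; apply/andP; split; last exact: H.
  by rewrite lerNl opprB; exact: H.
move=> Qx Qy xy.
pose s := (x ord0 j + M) * k.+1%:R.
have xM : `|x ord0 j| <= M := le_trans (coord_le_norm x j) Qx.
have s0 : 0 <= s.
  rewrite mulr_ge0//; move: xM; rewrite ler_norml; lra.
(* The least a whose test x passes. As y passes it too, (y_j + M) (k + 1) < a <= s + 1. *)
pose a := (Num.truncn s).+1.
have /andP[s1 s2] := truncn_itv s0.
have aA : (a < A)%N.
  rewrite /a /A !ltnS; apply: le_truncn; apply: ler_wpM2r => //.
  by rewrite mulr_natl mulr2n lerD2r (le_trans (ler_norm _)).
have ib : (pickle (j, a, k) < l)%N.
  rewrite /l ltnS; pose p : 'I_d * 'I_A := (j, Ordinal aA).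
  exact: (leq_bigmax_cond p).
have := code_bit ib xy; rewrite /bit pickleK.
have -> : x ord0 j < a%:R / k.+1%:R - M by rewrite ltrBrDr ltr_pdivlMr.
move=> /esym; rewrite ltrBrDr ltr_pdivlMr// => yl.
rewrite -(ler_pM2r k0) mulVf ?gt_eqF//.
have tE : a%:R = (Num.truncn s)%:R + 1 :> R by rewrite /a natr1.
rewrite -(lerD2l s) /s -mulrDl addrC addrA subrK (le_trans (ltW yl))// tE.
by rewrite lerD2r.
Qed.

Let cellb s x : bool := (`|x| <= M) && (code (size s) x == s).

Let cellb_rcons s b x : cellb (rcons s b) x = cellb s x && (bit (size s) x == b).
Proof. by rewrite /cellb size_rcons codeS eqseq_rcons andbA. Qed.

(** A point of the cell if there is one. The default 0 never matters for coded strings, since an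
    empty cell has weight 0. *)
Let rep s : 'rV[R]_d := xget 0 [set x | cellb s x].

Let repP s x : cellb s x -> cellb s (rep s).
Proof. by move=> sx; rewrite /rep; case: xgetP => [y _ //|/(_ x)]. Qed.

Lemma avg_norm_le n (X : 'I_n -> 'rV[R]_d) f (C : R) : 0 <= C ->
  (forall x, `|f x| <= C) -> `|avg X f| <= C.
Proof.
move=> C0 fC; case: n X => [|n] X.
  by rewrite /avg big_ord0 mulr0 normr0.
rewrite -(avg_cst X C (ltn0Sn n)) ler_norml -avgN; apply/andP.
split; apply: avg_le => x; have := fC x; rewrite ler_norml; by case/andP.
Qed.

Lemma limit_measure (U : set_system nat) (X : forall n, 'I_n -> 'rV[R]_d) :
  UltraFilter U ->
  avg (X n) (fun x => (`|x| <= M)%R%:R : R) @[n --> U] --> (1 : R) ->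
  exists sigma : probability T R, sigma (~` Q) = 0%E /\
  forall f : 'rV[R]_d -> R, continuous f -> bmeas (f : T -> R) ->
    avg (X n) (fun x => (`|x| <= M)%R%:R * f x) @[n --> U] --> \int[sigma]_x f x.
Proof.
move=> UU XQ.
pose v s n := avg (X n) (fun x => (cellb s x)%:R : R).
(* The ultrafilter makes the limits of all proportions exist at once, and they inherit additivity
   over subcells. *)
pose w s : R := lim (v s n @[n --> U]).
have vb s n : `|v s n| <= 1.
  by apply: avg_norm_le => // x; case: (cellb s x); rewrite ?normr1 ?normr0.
have vw s : v s n @[n --> U] --> w s.
  exact: (ultra_cvg_bounded _ (vb s)).
have w1 : w [::] = 1.
  apply: cvg_lim => //; apply: cvg_trans XQ; apply: near_eq_cvg.
  apply: filterE => n; rewrite /v; congr avg; apply/funext => x.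
  by rewrite /cellb /= eqxx andbT.
have w0 s : 0 <= w s.
  by apply: limr_ge; [exact: vw|apply: filterE => n; apply: avg_ge0].
have wS s : w s = w (rcons s false) + w (rcons s true).
  apply: cvg_lim => //.
  rewrite (_ : v s = fun n => v (rcons s false) n + v (rcons s true) n).
    exact: (cvgD (vw (rcons s false)) (vw (rcons s true))).
  apply/funext => n; rewrite /v -[RHS]avgD; congr avg; apply/funext => x.
  rewrite !cellb_rcons; case: (cellb s x) => /=; last by rewrite addr0.
  by case: (bit _ _); rewrite /= ?addr0 ?add0r.
have [P [S PS]] := binary_tree_measure w1 w0 wS.
(* An empty cell would contain no point of any X_n and have weight 0, contrary to
   [0 < w (S l t)]. *)
have cellS l t : cellb (S l t) (rep (S l t)).
  have [_ _ /(_ t) wp _ _] := PS l; apply: contraT => nc.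
  have nx x : cellb (S l t) x = false.
    by apply/negbTE; apply: contraNN nc => /repP.
  move: wp; rewrite (_ : w (S l t) = 0) ?ltxx//.
  apply: cvg_lim => //; apply: cvg_near_cst; apply: filterE => n.
  rewrite /v (_ : (fun x => _) = fun=> 0); last by apply/funext => x; rewrite nx.
  by rewrite /avg big1 ?mulr0.
have prefix l m t x : cellb (S (m + l)%N t) x -> cellb (S l t) x.
  elim: m => // m IH; rewrite addSn.
  have [_ /(_ t)[b ->] _ _ _] := PS (m + l)%N.
  by rewrite cellb_rcons => /andP[/IH].
have sS l t : size (S l t) = l by have [+ _ _ _ _] := PS l; exact.
have [L HL] := choice code_close.
have close k t m : `|rep (S (m + L k)%N t) - rep (S (L k) t)| <= k.+1%:R^-1.
  have /prefix/andP[h1 /eqP h2] := cellS (m + L k)%N t.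
  have /andP[h3 /eqP h4] := cellS (L k) t.
  by apply: HL => //; rewrite !sS in h2 h4; rewrite h2 h4.
(* The representatives of the nested cells satisfy [close], a closed condition that passes to any of
   their cluster points. *)
have lim_ex t : exists p, `|p| <= M /\
    forall k, `|p - rep (S (L k) t)| <= k.+1%:R^-1.
  have FQ : (rep (S l t) @[l --> \oo]) Q.
    by exists 0%N => // l _; have /andP[] := cellS l t.
  have [p [Qp]] := compactQ (fmap_proper_filter _ _) FQ.
  rewrite clusterE => clp; exists p; split => // k.
  pose Bk := [set y : 'rV[R]_d | `|y - rep (S (L k) t)| <= k.+1%:R^-1].
  have cB : closed Bk.
    apply: cts_closed_le; apply: (@lipschitz_continuous_norm _ _ _ 1) => y z.
    by rewrite mul1r (le_trans (ler_dist_dist _ _))// opprB addrA subrK.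
  have : closure Bk p.
    apply: clp; exists (L k) => // l /= /subnK <-; exact: close.
  by rewrite -((closure_id _).1 cB).
have [Phi HPhi] := choice lim_ex.
have mS l (D : set (seq bool)) :
    measurable ([set t | D (S l t)] : set (measurableTypeR R)).
  pose F (s : seq bool) : set (measurableTypeR R) :=
    if `[< D s >] then [set t | S l t = s] else set0.
  rewrite (_ : mkset _ = \bigcup_s F s).
    apply: countable_bigcupT_measurable => [|s]; first exact: countableP.
    rewrite /F; case: ifP => _; last exact: measurable0.
    by have [_ _ _ + _] := PS l; exact.
  apply/seteqP; split => t /=.
    by move=> Dt; exists (S l t) => //; rewrite /F asboolT.
  by move=> [s _]; rewrite /F; case: ifPn => [/asboolP Ds /= ->|].
have mPhi : measurable_fun setT (Phi : measurableTypeR R -> T).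
  apply: (@measurability _ _ _ T setT Phi (@open 'rV[R]_d : set (set T)) erefl).
  move=> _ [G oG <-]; rewrite setTI.
  (* Phi t lies in G exactly when, at some level, the ball around the representative that must
     contain Phi t is inside G: a condition on a finite string only. *)
  rewrite (_ : _ @^-1` _ = \bigcup_k [set t | [set s | forall y : 'rV[R]_d,
      `|y - rep s| <= k.+1%:R^-1 -> G y] (S (L k) t)]).
    by apply: bigcupT_measurable => k; exact: mS.
  apply/seteqP; split => t /=; last by move=> [k _]; apply; exact: (HPhi t).2.
  move=> Gt; have /nbhs_ballP[r /= r0 Hr] := open_nbhs_nbhs (conj oG Gt).
  have r20 : 0 < r / 2 by rewrite divr_gt0.
  have [k _ /(_ k (leqnn k)) kr] := near_infty_natSinv_lt (PosNum r20).
  exists k => // y yk; apply: Hr; rewrite -ball_normE/= -(subrKA (rep (S (L k) t))).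
  rewrite (le_lt_trans (ler_normD _ _))// (splitr r) ler_ltD//.
    by rewrite (le_trans ((HPhi t).2 k))// ltW.
  by rewrite distrC (le_lt_trans yk).
pose mfP := isMeasurableFun.Build _ _ _ _ _ mPhi.
pose PhiV : {mfun measurableTypeR R >-> T} := HB.pack (Phi : measurableTypeR R -> T) mfP.
pose sigma := distribution P PhiV.
exists sigma; split.
  transitivity (P (Phi @^-1` (~` Q))) => //.
  rewrite (_ : _ @^-1` _ = set0) ?measure0//.
  by apply/seteqP; split => // t /=; case; exact: (HPhi t).1.
move=> f cf bf.
have bfP : bmeas (f \o Phi : measurableTypeR R -> R).
  split; first exact: (measurableT_comp bf.1 mPhi).
  by have [_ [C fC]] := bf; exists C => t /=; exact: fC.
have -> : \int[sigma]_x f x = \int[P]_t f (Phi t).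
  rewrite /Rintegral integral_distribution//.
    by apply/measurable_EFinP; exact: bf.1.
  exact: (bmeas_integrable P bfP).
apply/cvgrPdist_le => eps eps0.
have e20 : 0 < eps / 4 by rewrite divr_gt0.
have [r r0 Hr] := compact_unif_continuous compactQ cf e20.
have [k _ /(_ k (leqnn k)) kr] := near_infty_natSinv_lt (PosNum r0).
pose l := L k.
have b1 (s : seq bool) : bmeas (\1_[set t | S l t = s] : measurableTypeR R -> R).
  by apply: bmeas_indic; have [_ _ _ + _] := PS l; exact.
(* The integral and the averages are each compared with a finite sum over the cells of level l; the
   two sums differ only by w s against v s n. *)
have I1 : `|\int[P]_t f (Phi t) - \sum_(s : l.-tuple bool) f (rep s) * w s| <= eps / 4.
  have E : \sum_(s : l.-tuple bool) f (rep s) * w s =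
      \int[P]_t (\sum_(s : l.-tuple bool) f (rep s) * \1_[set t | S l t = s] t).
    rewrite bint_sum; last by move=> s; apply: bmeasM => //; exact: bmeas_cst.
    apply: eq_bigr => s _; rewrite bintZl// bint_indic; last first.
      by have [_ _ _ + _] := PS l; exact.
    have [_ _ _ _ HP] := PS l; congr (_ * _).
    by rewrite -[LHS]/(fine (w s)%:E) -(HP s (size_tuple s)).
  rewrite E -bintB//; last first.
    by apply: bmeas_sum => s; apply: bmeasM => //; exact: bmeas_cst.
  rewrite -[leRHS]mulr1 -[X in _ * X]/(fine 1%E) -(probability_setT P).
  apply: bint_norm_le.
    apply: bmeasB => //.
    by apply: bmeas_sum => s; apply: bmeasM => //; exact: bmeas_cst.
  move=> t; have st : size (S l t) == l by rewrite sS.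
  rewrite (bigD1 (Tuple st))//= big1 ?addr0; last first.
    move=> s /eqP sne; rewrite indicE memNset ?mulr0//= => Ss.
    by apply: sne; apply/val_inj.
  rewrite indicE mem_set//= mulr1; apply: Hr; first exact: (HPhi t).1.
  by rewrite (le_trans ((HPhi t).2 k))// ltW.
have I2 n : `|avg (X n) (fun x => (`|x| <= M)%R%:R * f x) -
    \sum_(s : l.-tuple bool) f (rep s) * v s n| <= eps / 4.
  have -> : \sum_(s : l.-tuple bool) f (rep s) * v s n =
      avg (X n) (fun x => \sum_(s : l.-tuple bool) f (rep s) * (cellb s x)%:R : R).
    rewrite [RHS]/avg exchange_big/= mulr_sumr; apply: eq_bigr => s _.
    by rewrite -mulr_sumr mulrCA.
  rewrite -avgB; apply: avg_norm_le => [|x]; first exact: ltW.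
  have [xM|xM] := boolP (`|x| <= M); last first.
    rewrite mul0r big1 ?subrr ?normr0 ?ltW// => s _.
    by rewrite /cellb (negbTE xM) mulr0.
  have sx : size (code l x) == l by rewrite size_code.
  rewrite mul1r (bigD1 (Tuple sx))//= big1 ?addr0; last first.
    move=> s /eqP sne; rewrite /cellb size_tuple xM/=.
    case: eqP => [cs|]; last by rewrite mulr0.
    by exfalso; apply: sne; apply/val_inj.
  have cx : cellb (code l x) x by rewrite /cellb xM size_code eqxx.
  rewrite cx mulr1; apply: Hr => //.
  have /andP[h1 /eqP h2] := repP cx; rewrite size_code in h2.
  by rewrite (le_trans _ (ltW kr))//; apply: HL.
have : \sum_(s : l.-tuple bool) f (rep s) * v s n @[n --> U] -->
    \sum_(s : l.-tuple bool) f (rep s) * w s.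
  apply: cvgr_sumr => s; apply: cvgM; [exact: cvg_cst|exact: vw].
move=> /cvgrPdist_le /(_ _ e20); apply: filterS => n Hn.
set a := \int[P]_t _ in I1 *; set b := \sum_s _ * w _ in I1 Hn *.
set c := \sum_s _ * v _ _ in I2 Hn *.
have I2n := I2 n; set e := avg _ _ in I2n *.
have -> : a - e = (a - b) + (b - c) - (e - c) by ring.
rewrite (le_trans (ler_normB _ _))//.
rewrite (le_trans (lerD (le_trans (ler_normD _ _) (lerD I1 Hn)) I2n))//.
exact: three_quarters_le.
Qed.

End limit_measure.

(** * Positive definiteness on the sphere *)

(* Stereographic projection to the unit sphere of R^(d+1) turns |x - y|^2 into
   (1 + |x|^2) (1 + |y|^2) (1 - z) / 2, where z is the inner product of the
   images of x and y. *)
Section stereographic.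
Context {R : realType} {d : nat}.
Implicit Types (x y : 'rV[R]_d) (i : 'I_d.+1).

Definition stereo i x : R :=
  if unlift ord0 i is Some j then 2 * x ord0 j / (1 + sqnorm x)
  else (1 - sqnorm x) / (1 + sqnorm x).

Definition sphdot x y : R := \sum_(i < d.+1) stereo i x * stereo i y.

Let den_gt0 x : 0 < 1 + sqnorm x.
Proof. by rewrite ltr_wpDr// sqnorm_ge0. Qed.

Lemma dotvN x y : dotv x (- y) = - dotv x y.
Proof. by rewrite /dotv -sumrN; apply: eq_bigr => i _; rewrite mxE mulrN. Qed.

Lemma sqnormN x : sqnorm (- x) = sqnorm x.
Proof. by rewrite /sqnorm; apply: eq_bigr => i _; rewrite mxE sqrrN. Qed.

Lemma sphdotE x y : sqnorm (x - y) =
  (1 + sqnorm x) * (1 + sqnorm y) * (1 - sphdot x y) / 2.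
Proof.
have -> : sphdot x y = ((1 - sqnorm x) * (1 - sqnorm y) + 4 * dotv x y) /
    ((1 + sqnorm x) * (1 + sqnorm y)).
  rewrite /sphdot big_ord_recl /stereo unlift_none [RHS]mulrDl; congr (_ + _).
    by rewrite invfM; ring.
  rewrite /dotv mulr_sumr mulr_suml; apply: eq_bigr => i _.
  by rewrite liftK invfM; ring.
rewrite sqnormD dotvN sqnormN; field.
by rewrite !gt_eqF.
Qed.

Lemma sphdotxx x : sphdot x x = 1.
Proof.
have := sphdotE x x; rewrite subrr (_ : sqnorm 0 = 0); last first.
  by rewrite /sqnorm big1// => i _; rewrite mxE expr0n.
move/esym/eqP; rewrite !mulf_eq0 invr_eq0 pnatr_eq0 orbF !(gt_eqF (den_gt0 x)).
by rewrite /= subr_eq0 => /eqP.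
Qed.

Lemma sphdot_le1 x y : `|sphdot x y| <= 1.
Proof.
rewrite ler_norml; apply/andP; split.
  have : 0 <= \sum_(i < d.+1) (stereo i x + stereo i y) ^+ 2.
    by apply: sumr_ge0 => i _; rewrite sqr_ge0.
  have -> : \sum_(i < d.+1) (stereo i x + stereo i y) ^+ 2 =
      sphdot x x + sphdot y y + 2 * sphdot x y.
    rewrite /sphdot mulr_sumr -!big_split/=; apply: eq_bigr => i _; ring.
  by rewrite !sphdotxx; lra.
have : 0 <= \sum_(i < d.+1) (stereo i x - stereo i y) ^+ 2.
  by apply: sumr_ge0 => i _; rewrite sqr_ge0.
have -> : \sum_(i < d.+1) (stereo i x - stereo i y) ^+ 2 =
    sphdot x x + sphdot y y - 2 * sphdot x y.
  rewrite /sphdot mulr_sumr -!big_split -sumrB/=; apply: eq_bigr => i _; ring.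
by rewrite !sphdotxx; lra.
Qed.

Lemma stereo_le1 i x : `|stereo i x| <= 1.
Proof.
rewrite -(@ler_pXn2r _ 2)// ?nnegrE// real_normK ?num_real// expr1n -(sphdotxx x).
rewrite /sphdot (bigD1 i)//= expr2 lerDl; apply: sumr_ge0 => j _.
by rewrite -expr2 sqr_ge0.
Qed.

Lemma sqnorm_continuous : continuous (@sqnorm R d).
Proof.
rewrite (_ : @sqnorm R d = fun x => enorm x ^+ 2); last first.
  by apply/funext => z; rewrite sqr_enorm.
by apply: ctsX; exact: continuous_enorm.
Qed.

Lemma stereo_continuous i : continuous (stereo i).
Proof.
have cD : continuous (fun x => (1 + sqnorm x)^-1).
  apply: ctsV; first by move=> x; rewrite gt_eqF.
  by apply: ctsD; [exact: cts_cst|exact: sqnorm_continuous].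
rewrite /stereo; case: (unlift ord0 i) => [j|]; apply: ctsM => //.
  by apply: ctsM; [exact: cts_cst|exact: coord_continuous].
by apply: ctsB; [exact: cts_cst|exact: sqnorm_continuous].
Qed.

Definition wgt (p : R) x : R := (1 + sqnorm x) `^ (- p).

Lemma wgt_ge0 p x : 0 <= wgt p x. Proof. exact: powR_ge0. Qed.

Lemma wgt_gt0 p x : 0 < wgt p x. Proof. exact: powR_gt0. Qed.

Lemma wgt_le1 p x : 0 <= p -> wgt p x <= 1.
Proof.
move=> p0; have -> : 1 = 1 `^ (- p) :> R by rewrite powR1.
by apply: powRN_anti => //; rewrite lerDl sqnorm_ge0.
Qed.

(** [Num.max 0] keeps the base positive on the whole line; it changes nothing when s is a squared
    norm. *)
Lemma powR_shift_continuous (p : R) :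
  continuous (fun s : R => (1 + Num.max 0 s) `^ (- p)).
Proof.
move=> s; apply: (@continuous_comp _ _ _ (fun s : R => 1 + Num.max 0 s)
  (fun u : R => u `^ (- p))).
  by apply: ctsD; [exact: cts_cst|apply: cts_max; [exact: cts_cst|move=> ?; exact: cvg_id]].
have s0 : 0 < 1 + Num.max 0 s by rewrite ltr_wpDr// le_max lexx.
apply: differentiable_continuous; apply/derivable1_diffP.
by have [] := is_derive1_powR (- p) s0.
Qed.

Lemma wgt_continuous p : continuous (wgt p).
Proof.
rewrite (_ : wgt p = (fun x => (1 + Num.max 0 (sqnorm x)) `^ (- p))).
  exact: (cts_comp (@powR_shift_continuous p) sqnorm_continuous).
by apply/funext => x; rewrite /wgt (max_idPr _)// sqnorm_ge0.
Qed.

Lemma sphdot_riesz_powR (p : R) x y : 0 < p -> x != y ->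
  sqnorm (x - y) `^ (- p) = 2 `^ p * (wgt p x * wgt p y * (1 - sphdot x y) `^ (- p)).
Proof.
move=> p0 xy.
have z0 : 0 <= 1 - sphdot x y.
  by rewrite subr_ge0 (le_trans (ler_norm _))// sphdot_le1.
rewrite sphdotE mulrC powRM ?invr_ge0//; last by rewrite !mulr_ge0// ltW.
rewrite powRM ?mulr_ge0 ?(ltW (den_gt0 _))// powRM ?(ltW (den_gt0 _))//.
by rewrite -[X in X `^ _]powR_inv1// -powRrM mulrN mulN1r opprK.
Qed.

End stereographic.

(** The difference of the two sides is (1 - r) (1 + z) / 2. It makes the dilated kernel at most ((1
    + r) / 2)^-p times the Riesz kernel. *)
Lemma dilation_le {R : realFieldType} (r z : R) : r < 1 -> -1 <= z ->
  (1 + r) / 2 * (1 - z) <= 1 - r * z.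
Proof.
move=> r1 z1; have : 0 <= (1 - r) * (1 + z) by rewrite mulr_ge0//; lra.
lra.
Qed.

Section sphere_forms.
Context {R : realType} {d : nat}.
Notation T := (borel_rV R d).
Implicit Types (x y : 'rV[R]_d) (f g : 'rV[R]_d -> R) (j m : nat).
Implicit Types (L : ('rV[R]_d -> R) -> R).

(* bq L L' j f g is L_x L'_y (f x * g y * sphdot x y ^+ j), unfolded so that
   only values of L and L' at products of coordinates occur. *)
Fixpoint bq L L' j f g : R := if j is k.+1
  then \sum_(i < d.+1) bq L L' k (fun x => f x * stereo i x) (fun x => g x * stereo i x)
  else L f * L' g.

(** Accumulates the coordinates in the order in which [bq] does, so that [bq_ge] follows by
    induction on s. *)
Definition stprod (s : seq 'I_d.+1) f : 'rV[R]_d -> R :=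
  foldl (fun h i x => h x * stereo i x) f s.

Lemma bqB L L' j f : bq (fun h => L h - L' h) (fun h => L h - L' h) j f f =
  bq L L j f f - 2 * bq L L' j f f + bq L' L' j f f.
Proof.
elim: j f => [|j IH] f /=; first by ring.
rewrite (eq_bigr _ (fun i _ => IH _)) big_split/= sumrB; congr (_ - _ + _).
by rewrite mulr_sumr.
Qed.

Lemma bq_ge0 L j f : 0 <= bq L L j f f.
Proof.
by elim: j f => [|j IH] f /=; [rewrite -expr2 sqr_ge0|apply: sumr_ge0 => i _].
Qed.

(** The form is the sum, over all words of this length in the coordinates, of the squares of the
    corresponding values of L; the word s is one of them. *)
Lemma bq_ge L (s : seq 'I_d.+1) f : L (stprod s f) ^+ 2 <= bq L L (size s) f f.
Proof.
elim: s f => [|i s IH] f /=; first by rewrite expr2.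
rewrite (bigD1 i)//= (le_trans (IH _))// lerDl; apply: sumr_ge0 => k _.
exact: bq_ge0.
Qed.

Lemma sphdot_exprS f g x y j : f x * g y * sphdot x y ^+ j.+1 =
  \sum_(i < d.+1) (f x * stereo i x) * (g y * stereo i y) * sphdot x y ^+ j.
Proof.
rewrite exprS {1}/sphdot mulr_suml mulr_sumr; apply: eq_bigr => i _; ring.
Qed.

Lemma bmeas_stereo i : bmeas (stereo i : T -> R).
Proof.
split; first by apply: continuous_measurable_rV; exact: stereo_continuous.
by exists 1 => x; exact: stereo_le1.
Qed.

Lemma bmeas_wgt p : 0 <= p -> bmeas (wgt p : T -> R).
Proof.
move=> p0; split; first by apply: continuous_measurable_rV; exact: wgt_continuous.
by exists 1 => x; rewrite ger0_norm ?wgt_ge0// wgt_le1.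
Qed.

Lemma bmeas_sphdotX j x : bmeas (fun y : T => sphdot x y ^+ j).
Proof.
elim: j => [|j IH]; first exact: bmeas_cst.
under eq_fun do rewrite exprS.
apply: bmeasM => //; apply: bmeas_sum => i; apply: bmeasM; first exact: bmeas_cst.
exact: bmeas_stereo.
Qed.

(** Once the power of [sphdot] is expanded, the integrand is a finite sum of products of a function
    of x and one of y, and the double integral factorizes by linearity. *)
Lemma bq_int (rho rho' : {finite_measure set T -> \bar R}) j f g :
  bmeas (f : T -> R) -> bmeas (g : T -> R) ->
  bmeas (fun x : T => \int[rho']_y (f x * g y * sphdot x y ^+ j)) /\
  \int[rho]_x \int[rho']_y (f x * g y * sphdot x y ^+ j) =
  bq (fun h => \int[rho]_x h x) (fun h => \int[rho']_x h x) j f g.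
Proof.
elim: j f g => [|j IH] f g bf bg.
  have E x : \int[rho']_y (f x * g y * sphdot x y ^+ 0) = f x * \int[rho']_y g y.
    by under eq_Rintegral do rewrite expr0 mulr1; rewrite bintZl.
  rewrite (funext E : (fun x : T => _) = _).
  by split; [apply: bmeasM => //; exact: bmeas_cst|rewrite bintZr].
have bfs i := bmeasM bf (bmeas_stereo i); have bgs i := bmeasM bg (bmeas_stereo i).
have E x : \int[rho']_y (f x * g y * sphdot x y ^+ j.+1) =
   \sum_(i < d.+1) \int[rho']_y ((f x * stereo i x) * (g y * stereo i y) * sphdot x y ^+ j).
  under eq_Rintegral do rewrite sphdot_exprS.
  rewrite bint_sum// => i; apply: bmeasM; last exact: bmeas_sphdotX.
  by apply: bmeasM; [exact: bmeas_cst|exact: bgs].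
rewrite (funext E : (fun x : T => _) = _); split.
  by apply: bmeas_sum => i; have [+ _] := IH _ _ (bfs i) (bgs i).
rewrite bint_sum; last first.
  by move=> i; have [+ _] := IH _ _ (bfs i) (bgs i).
by apply: eq_bigr => i _; have [_ ->] := IH _ _ (bfs i) (bgs i).
Qed.

Lemma bq_avg n (X : 'I_n -> 'rV[R]_d) (b : 'rV[R]_d -> R) j f g :
  bq (fun h => avg X (fun x => b x * h x)) (fun h => avg X (fun x => b x * h x)) j f g =
  n%:R^-1 ^+ 2 * \sum_(k < n) \sum_(l < n)
    b (X k) * b (X l) * (f (X k) * g (X l) * sphdot (X k) (X l) ^+ j).
Proof.
elim: j f g => [|j IH] f g /=.
  rewrite /avg mulrACA expr2; congr (_ * _); rewrite mulr_suml; apply: eq_bigr => k _.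
  by rewrite mulr_sumr; apply: eq_bigr => l _; rewrite expr0; ring.
rewrite (eq_bigr _ (fun i _ => IH _ _)) -mulr_sumr exchange_big; congr (_ * _).
apply: eq_bigr => k _; rewrite exchange_big; apply: eq_bigr => l _ /=.
by rewrite sphdot_exprS mulr_sumr.
Qed.

Section dilated_kernel.
Context (p r : R) (m : nat).
Hypothesis p0 : 0 < p.
Hypothesis r01 : 0 <= r < 1.

Definition kpol x y : R := 2 `^ p * (wgt p x * wgt p y *
  \sum_(j < m) binc p j * r ^+ j * sphdot x y ^+ j).

(** The form of [kpol] on functionals rather than measures, so that integrals, averages and their
    differences are handled alike. *)
Definition dq L L' : R :=
  2 `^ p * \sum_(j < m) binc p j * r ^+ j * bq L L' j (wgt p) (wgt p).

Let kpolE x y : kpol x y = \sum_(j < m) 2 `^ p * (binc p j * r ^+ j) *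
  (wgt p x * wgt p y * sphdot x y ^+ j).
Proof.
rewrite /kpol !mulr_sumr; apply: eq_bigr => j _; ring.
Qed.

Let dqE L L' : dq L L' = \sum_(j < m) 2 `^ p * (binc p j * r ^+ j) *
  bq L L' j (wgt p) (wgt p).
Proof. by rewrite /dq !mulr_sumr; apply: eq_bigr => j _; rewrite mulrA. Qed.

Lemma bmeas_kpol x : bmeas (fun y : T => kpol x y).
Proof.
under eq_fun do rewrite kpolE.
apply: bmeas_sum => j; apply: bmeasM; first exact: bmeas_cst.
apply: bmeasM; last exact: bmeas_sphdotX.
by apply: bmeasM; [exact: bmeas_cst|apply: bmeas_wgt; exact: ltW].
Qed.

Lemma dq_int (rho rho' : {finite_measure set T -> \bar R}) :
  bmeas (fun x : T => \int[rho']_y kpol x y) /\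
  \int[rho]_x \int[rho']_y kpol x y =
  dq (fun h => \int[rho]_x h x) (fun h => \int[rho']_x h x).
Proof.
have bw := bmeas_wgt (ltW p0).
have E x : \int[rho']_y kpol x y = \sum_(j < m) 2 `^ p * (binc p j * r ^+ j) *
    \int[rho']_y (wgt p x * wgt p y * sphdot x y ^+ j).
  under eq_Rintegral do rewrite kpolE.
  have bb j : bmeas (fun y : T => wgt p x * wgt p y * sphdot x y ^+ j).
    apply: bmeasM; last exact: bmeas_sphdotX.
    by apply: bmeasM => //; exact: bmeas_cst.
  rewrite bint_sum => [|j]; last by apply: bmeasM => //; exact: bmeas_cst.
  by apply: eq_bigr => j _; rewrite bintZl.
have bb j := (@bq_int rho rho' j _ _ bw bw).1.
have bc (j : 'I_m) : bmeas (fun x : T => 2 `^ p * (binc p j * r ^+ j) *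
    \int[rho']_y (wgt p x * wgt p y * sphdot x y ^+ j)).
  by apply: bmeasM => //; exact: bmeas_cst.
rewrite (funext E : (fun x : T => _) = _); split; first exact: bmeas_sum.
rewrite bint_sum// dqE; apply: eq_bigr => j _.
by rewrite bintZl// (@bq_int rho rho' j _ _ bw bw).2.
Qed.

Lemma dq_avg n (X : 'I_n -> 'rV[R]_d) (b : 'rV[R]_d -> R) :
  dq (fun h => avg X (fun x => b x * h x)) (fun h => avg X (fun x => b x * h x)) =
  n%:R^-1 ^+ 2 * \sum_(k < n) \sum_(l < n) b (X k) * b (X l) * kpol (X k) (X l).
Proof.
rewrite dqE; under eq_bigr do rewrite bq_avg mulrCA.
rewrite -mulr_sumr; congr (_ * _).
under eq_bigr do rewrite mulr_sumr.
rewrite exchange_big; apply: eq_bigr => k _ /=.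
under eq_bigr do rewrite mulr_sumr.
rewrite exchange_big; apply: eq_bigr => l _ /=.
by rewrite kpolE mulr_sumr; apply: eq_bigr => j _; rewrite mulrCA.
Qed.

Lemma dq_ge L L' (s : seq 'I_d.+1) : (size s < m)%N ->
  2 `^ p * (binc p (size s) * r ^+ size s) *
    (L (stprod s (wgt p)) - L' (stprod s (wgt p))) ^+ 2 <=
  dq L L - 2 * dq L L' + dq L' L'.
Proof.
move=> sm.
have -> : dq L L - 2 * dq L L' + dq L' L' =
    dq (fun h => L h - L' h) (fun h => L h - L' h).
  rewrite !dqE mulr_sumr -sumrB -big_split/=; apply: eq_bigr => j _.
  by rewrite bqB; ring.
have c0 j : 0 <= 2 `^ p * (binc p j * r ^+ j).
  rewrite !mulr_ge0 ?powR_ge0 ?exprn_ge0//; last by case/andP: r01.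
  by rewrite ltW// binc_gt0.
rewrite dqE (bigD1 (Ordinal sm))//= ler_wpDr//.
  by apply: sumr_ge0 => j _; rewrite mulr_ge0 ?bq_ge0.
rewrite ler_wpM2l//.
exact: (bq_ge (fun h => L h - L' h)).
Qed.

Context (eps : R).
Hypothesis series_eps : forall z, `|z| <= 1 ->
  `|(1 - r * z) `^ (- p) - \sum_(j < m) binc p j * r ^+ j * z ^+ j| <= eps.

Let eps0 : 0 <= eps.
Proof. by have := @series_eps 0; rewrite normr0 => /(_ ler01); exact: le_trans. Qed.

Let kpol_near x y : `|2 `^ p * (wgt p x * wgt p y * (1 - r * sphdot x y) `^ (- p))
   - kpol x y| <= 2 `^ p * eps.
Proof.
rewrite /kpol -mulrBr -mulrBr normrM ger0_norm ?powR_ge0// ler_wpM2l ?powR_ge0//.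
rewrite normrM ger0_norm ?mulr_ge0 ?wgt_ge0//.
apply: (@le_trans _ _ (1 * eps)); last by rewrite mul1r.
apply: ler_pM => //; first by rewrite mulr_ge0 ?wgt_ge0.
  by rewrite mulr_ile1 ?wgt_ge0 ?wgt_le1 ?(ltW p0).
exact/series_eps/sphdot_le1.
Qed.

Let den_ge x y : 1 - r <= 1 - r * sphdot x y.
Proof.
rewrite lerD2l lerN2 ler_piMr//; first by case/andP: r01.
by rewrite (le_trans (ler_norm _))// sphdot_le1.
Qed.

Let den_gt0 x y : 0 < 1 - r * sphdot x y.
Proof. by rewrite (lt_le_trans _ (den_ge x y))// subr_gt0; case/andP: r01. Qed.

(** Controls [kpol] on and near the diagonal, where comparison with the singular kernel is of no
    help. *)
Lemma kpol_le_cst x y : kpol x y <= 2 `^ p * ((1 - r) `^ (- p) + eps).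
Proof.
have := kpol_near x y; rewrite ler_norml lerNl opprB => /andP[+ _].
rewrite lerBlDr => /le_trans; apply.
rewrite mulrDr addrC lerD2r ler_wpM2l ?powR_ge0//.
apply: (@le_trans _ _ (1 * (1 - r) `^ (- p))); last by rewrite mul1r.
apply: ler_pM; rewrite ?powR_ge0 ?mulr_ge0 ?wgt_ge0//.
  by rewrite mulr_ile1 ?wgt_ge0 ?wgt_le1 ?(ltW p0).
apply: powRN_anti; rewrite ?(ltW p0) ?den_ge// subr_gt0; by case/andP: r01.
Qed.

Lemma kpol_le x y : x != y -> kpol x y <=
  ((1 + r) / 2) `^ (- p) * sqnorm (x - y) `^ (- p) + 2 `^ p * eps.
Proof.
move=> xy.
have := kpol_near x y; rewrite ler_norml lerNl opprB => /andP[+ _].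
rewrite lerBlDr => /le_trans; apply.
rewrite addrC lerD2r sphdot_riesz_powR// [leRHS]mulrCA.
apply: ler_wpM2l; first exact: powR_ge0.
rewrite [leRHS]mulrCA; apply: ler_wpM2l; first by rewrite mulr_ge0 ?wgt_ge0.
have z0 : 0 < 1 - sphdot x y.
  rewrite lt_def subr_ge0 (le_trans (ler_norm _)) ?sphdot_le1// andbT.
  apply: contra xy => /eqP z; have := sphdotE x y; rewrite z mulr0 mul0r.
  by move=> /eqP; rewrite -sqr_enorm sqrf_eq0 enorm_eq0 subr_eq0.
have /andP[r0 r1] := r01.
have h0 : 0 <= (1 + r) / 2 by rewrite divr_ge0// addr_ge0.
rewrite -powRM ?(ltW z0)//.
apply: powRN_anti; first exact: ltW.
  by rewrite mulr_gt0// divr_gt0// ltr_wpDr.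
have := sphdot_le1 x y; rewrite ler_norml => /andP[z1 _].
exact: dilation_le.
Qed.

(** With a = 1 + |x|^2 and b = 1 + |y|^2, a b (1 - r z) / 2 = |x - y|^2 + a b (1 - r) z / 2. The
    added term is at most A^2 (1 - r) / 2, a small multiple of max(|x - y|, e)^2 when r is close to
    1. *)
Lemma kpol_ge (alpha e A : R) x y : p = (d%:R - alpha) / 2 -> 0 < e ->
  1 + sqnorm x <= A -> 1 + sqnorm y <= A ->
  (1 + A ^+ 2 * (1 - r) / (2 * e ^+ 2)) `^ (- p) * kap alpha e (x - y) -
    2 `^ p * eps <= kpol x y.
Proof.
move=> pE e0 xA yA; have /andP[r0 r1] := r01.
have := kpol_near x y; rewrite ler_norml => /andP[_].
rewrite lerBlDr => H; rewrite lerBlDr [leRHS]addrC; apply: le_trans H.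
set a := 1 + sqnorm x; set b := 1 + sqnorm y.
have a0 : 0 < a by rewrite ltr_wpDr// sqnorm_ge0.
have b0 : 0 < b by rewrite ltr_wpDr// sqnorm_ge0.
set z := sphdot x y; set et := A ^+ 2 * (1 - r) / (2 * e ^+ 2).
set mx := Num.max (enorm (x - y)) e.
have mx0 : 0 < mx by rewrite lt_max e0 orbT.
have e2 : 0 < e ^+ 2 by rewrite exprn_gt0.
have et0 : 0 <= et.
  rewrite /et; apply: divr_ge0; apply: mulr_ge0 => //; rewrite ?sqr_ge0//.
  by rewrite subr_ge0 ltW.
have -> : 2 `^ p * (wgt p x * wgt p y * (1 - r * z) `^ (- p)) =
    (a * b * (1 - r * z) / 2) `^ (- p).
  have ab0 : 0 <= a * b by rewrite mulr_ge0 ?ltW.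
  have abz0 : 0 <= a * b * (1 - r * z) by rewrite mulr_ge0// ltW// den_gt0.
  rewrite [in RHS]mulrC powRM ?invr_ge0// powRM ?(ltW (den_gt0 _ _))//.
  rewrite powRM ?(ltW a0) ?(ltW b0)//.
  by rewrite -[2^-1]powR_inv1// -powRrM mulrN mulN1r opprK.
have -> : kap alpha e (x - y) = (mx ^+ 2) `^ (- p).
  rewrite /kap -/mx -powR_mulrn ?(ltW mx0)// -powRrM pE.
  by congr (_ `^ _); field.
rewrite -powRM ?sqr_ge0//; last by rewrite addr_ge0.
apply: powRN_anti; first exact: ltW.
  by rewrite divr_gt0// mulr_gt0 ?den_gt0// mulr_gt0.
have sE : sqnorm (x - y) = a * b * (1 - z) / 2 by exact: sphdotE.
have smx : sqnorm (x - y) <= mx ^+ 2.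
  by rewrite -sqr_enorm lerXn2r ?nnegrE ?enorm_ge0 ?(ltW mx0)// le_max lexx.
have emx : e ^+ 2 <= mx ^+ 2.
  by rewrite lerXn2r ?nnegrE ?(ltW e0) ?(ltW mx0)// le_max lexx orbT.
have abA : a * b <= A ^+ 2 by rewrite expr2; apply: ler_pM => //; exact: ltW.
have h1 : a * b * (1 - r * z) / 2 <= sqnorm (x - y) + A ^+ 2 * (1 - r) / 2.
  have z1 : z <= 1 by rewrite (le_trans (ler_norm _))// sphdot_le1.
  have -> : a * b * (1 - r * z) / 2 = sqnorm (x - y) + (a * b) * ((1 - r) * z) / 2.
    by rewrite sE; ring.
  rewrite lerD2l ler_pM2r ?invr_gt0//.
  apply: (@le_trans _ _ (a * b * (1 - r))).
    by rewrite ler_wpM2l ?mulr_ge0 ?(ltW a0) ?(ltW b0)// ler_piMr// subr_ge0 ltW.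
  by rewrite ler_wpM2r// subr_ge0 ltW.
apply: (le_trans h1); rewrite mulrDl mul1r lerD//.
have -> : A ^+ 2 * (1 - r) / 2 = et * e ^+ 2 by rewrite /et; field; rewrite gt_eqF.
exact: ler_wpM2l.
Qed.

End dilated_kernel.

End sphere_forms.

(** * Density of spherical polynomials *)

(* [smp y l G c] is the expectation of [G] at the end of the random walk on
   counts started at [c], whose successive steps increment the coordinates [i]
   listed in [l] with probability [y i]: Bernstein's proof of the Weierstrass
   theorem without binomial coefficients. *)
Section bernstein.
Context {R : realType} {D : nat} (y : 'I_D -> R).
Implicit Types (l : seq 'I_D) (G : ('I_D -> nat) -> R) (c : 'I_D -> nat).

Definition incr (i : 'I_D) c : 'I_D -> nat := fun k => (c k + (k == i))%N.

Fixpoint smp l G c : R := if l is i :: l'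
  then y i * smp l' G (incr i c) + (1 - y i) * smp l' G c else G c.

Lemma smpD l G G' c : smp l (fun c => G c + G' c) c = smp l G c + smp l G' c.
Proof. by elim: l c => //= i l IH c; rewrite !IH; ring. Qed.

Lemma smpZ l a G c : smp l (fun c => a * G c) c = a * smp l G c.
Proof. by elim: l c => //= i l IH c; rewrite !IH; ring. Qed.

Lemma smp_cst l a c : smp l (fun=> a) c = a.
Proof. by elim: l c => //= i l IH c; rewrite !IH; ring. Qed.

Lemma smp_sum l (I : Type) (r : seq I) (G : I -> ('I_D -> nat) -> R) c :
  smp l (fun c => \sum_(k <- r) G k c) c = \sum_(k <- r) smp l (G k) c.
Proof.
elim: l c => //= i l IH c; rewrite !IH !mulr_sumr -big_split; exact: eq_bigr.
Qed.

(** Squared bias plus variance: the j-th count is a sum of [count_mem j l] independent steps of mean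
    y_j and variance y_j (1 - y_j). *)
Lemma smp_sqr l j (a b : R) c :
  smp l (fun c => (a * (c j)%:R - b) ^+ 2) c =
  (a * ((c j)%:R + (count_mem j l)%:R * y j) - b) ^+ 2
    + a ^+ 2 * (count_mem j l)%:R * (y j * (1 - y j)).
Proof.
elim: l c => [|i l IH] c /=; first by rewrite mul0r !addr0 mulr0 mul0r addr0.
rewrite !IH /incr (eq_sym j) !natrD; case: eqP => [->|_] /=; ring.
Qed.

Hypothesis y01 : forall i, 0 <= y i <= 1.

Lemma smp_le l G G' c : (forall c, G c <= G' c) -> smp l G c <= smp l G' c.
Proof.
move=> GG; elim: l c => //= i l IH c; have /andP[y0 y1] := y01 i.
by rewrite lerD// ler_wpM2l// subr_ge0.
Qed.

(** The expected quadratic error is B times a sum of D variances, each at most 1 / N. [Num.min 1]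
    keeps the sampled point in the cube for all counts, as [smp_le] compares at every count. *)
Lemma bernstein_bound (N : nat) (F : 'rV[R]_D -> R) (e B : R) :
  (0 < N)%N -> 0 <= B ->
  (forall v : 'rV[R]_D, (forall i, 0 <= v ord0 i <= 1) ->
     `|F v - F (\row_i y i)| <= e + B * \sum_(i < D) (v ord0 i - y i) ^+ 2) ->
  `|smp (flatten (nseq N (enum 'I_D)))
     (fun c => F (\row_i Num.min 1 (N%:R^-1 * (c i)%:R))) (fun=> 0%N)
   - F (\row_i y i)| <= e + B * D%:R / N%:R.
Proof.
move=> N0 B0 HF; set l := flatten _; set G := (fun c => F _).
have N0' : 0 < N%:R^-1 :> R by rewrite invr_gt0 ltr0n.
have cl j : count_mem j l = N.
  rewrite /l count_flatten map_nseq sumn_nseq -[RHS]mul1n; congr (_ * _)%N.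
  by rewrite count_uniq_mem ?enum_uniq// mem_enum.
pose H (c : 'I_D -> nat) : R := e + B * \sum_(i < D) (N%:R^-1 * (c i)%:R - y i) ^+ 2.
have GH c : `|G c - F (\row_i y i)| <= H c.
  apply: le_trans (HF _ _) _ => [i|].
    by rewrite mxE le_min ler01 ge_min lexx mulr_ge0// ltW.
  rewrite lerD2l ler_wpM2l//; apply: ler_sum => i _; rewrite mxE.
  have /andP[y0 y1] := y01 i; set u := _ * _.
  rewrite -[leLHS]real_normK ?num_real// -[leRHS]real_normK ?num_real//.
  rewrite lerXn2r ?nnegrE//; case: (leP 1 u) => // u1.
  by rewrite !ger0_norm ?subr_ge0 ?(le_trans y1)// lerD2r.
have E1 : smp l H (fun=> 0%N) <= e + B * D%:R / N%:R.
  rewrite smpD smp_cst smpZ smp_sum lerD2l -mulrA ler_wpM2l//.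
  rewrite (eq_bigr (fun j => N%:R^-1 * (y j * (1 - y j)))) => [|j _]; last first.
    rewrite smp_sqr cl; set n := N%:R; have n0 : n != 0 :> R by rewrite pnatr_eq0 -lt0n.
    by field.
  apply: (@le_trans _ _ (\sum_(j < D) N%:R^-1)); last first.
    by rewrite sumr_const card_ord -[leLHS]mulr_natl.
  apply: ler_sum => j _; rewrite ler_piMr ?(ltW N0')//.
  have /andP[y0 y1] := y01 j; rewrite mulr_ile1 ?subr_ge0//.
  by rewrite gerBl.
have Gm : smp l G (fun=> 0%N) - F (\row_i y i) =
    smp l (fun c => G c + - F (\row_i y i)) (fun=> 0%N) by rewrite smpD smp_cst.
rewrite Gm ler_norml; apply/andP; split.
  rewrite lerNl -mulN1r -smpZ (le_trans _ E1)//; apply: smp_le => c.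
  by rewrite mulN1r (le_trans _ (GH c))// -normrN ler_norm.
by rewrite (le_trans _ E1)//; apply: smp_le => c; rewrite (le_trans _ (GH c))// ler_norm.
Qed.

End bernstein.

Lemma row_continuous {R : realType} {X : topologicalType} (D : nat)
    (g : 'I_D -> X -> R) : (forall i, continuous (g i)) ->
  continuous (fun x => \row_i g i x : 'rV[R]_D).
Proof.
move=> cg x; apply/cvgrPdist_le => e e0.
have : \forall t \near x, forall i, `|g i x - g i t| <= e.
  apply: filter_forall => i.
  by have /cvgrPdist_le/(_ _ e0) := cg i x.
apply: filterS => t H; apply: norm_le_coord; first exact: ltW.
by move=> i; rewrite !mxE.
Qed.

Lemma bint_norm_le_null {d0} {T : measurableType d0} {R : realType}
    (nu : {finite_measure set T -> \bar R}) (N : set T) (f : T -> R) (C : R) :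
  bmeas f -> measurable N -> nu N = 0%E -> (forall x, ~ N x -> `|f x| <= C) ->
  `|\int[nu]_x f x| <= C * fine (nu setT).
Proof.
move=> bf mN N0 fC; have bc c : bmeas (fun _ : T => c : R) := bmeas_cst c.
rewrite ler_norml -bint_cst -mulrN1 -bintZr//; apply/andP.
split.
  apply: (bint_le_null (bc _) bf mN N0) => x /fC.
  by rewrite ler_norml mulrN1 => /andP[].
by apply: (bint_le_null bf (bc _) mN N0) => x /fC; rewrite ler_norml => /andP[].
Qed.

(** Within the radius r of uniform continuity e suffices; beyond it the sum of squares is at least
    r^2, and the quadratic term exceeds twice a bound of |F|. *)
Lemma quadratic_modulus {R : realType} (D : nat) (F : 'rV[R]_D -> R) (e : R) :
  continuous F -> 0 < e -> exists2 B, 0 <= B &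
    forall v y : 'rV[R]_D, (forall i, 0 <= v ord0 i <= 1) ->
      (forall i, 0 <= y ord0 i <= 1) ->
      `|F v - F y| <= e + B * \sum_(i < D) (v ord0 i - y ord0 i) ^+ 2.
Proof.
move=> cF e0.
pose K := [set v : 'rV[R]_D | `|v| <= 1].
have cK : compact K.
  apply: bounded_closed_compact.
    exists 1; split; first exact: num_real.
    by move=> N MN x /= xM; rewrite (le_trans xM)// ltW.
  by apply: cts_closed_le => x; exact: norm_continuous.
have inK (v : 'rV[R]_D) : (forall i, 0 <= v ord0 i <= 1) -> K v.
  move=> v01; apply: norm_le_coord => // i; have /andP[v0 v1] := v01 i.
  by rewrite ger0_norm.
have [r r0 Hr] := compact_unif_continuous cK cF e0.
have [C [C0 FC]] : exists C, 0 <= C /\ forall v, K v -> `|F v| <= C.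
  have cFK : compact [set F x | x in K].
    by apply: continuous_compact => //; exact: continuous_subspaceT.
  have [C [_ HC]] := compact_bounded cFK.
  exists (`|C| + 1); split; first by rewrite addr_ge0.
  move=> v Kv; apply: HC; first by rewrite (le_lt_trans (ler_norm C))// ltrDl.
  by exists v.
exists (2 * C / r ^+ 2); first by apply: divr_ge0; [exact: mulr_ge0|exact: sqr_ge0].
move=> v y /inK Kv /inK Ky; set S := \sum_(i < D) _.
have S0 : 0 <= S by apply: sumr_ge0 => i _; exact: sqr_ge0.
case: (leP `|v - y| r) => vy.
  rewrite (le_trans (Hr _ _ Kv vy))// lerDl; apply: mulr_ge0 => //.
  by apply: divr_ge0; [exact: mulr_ge0|exact: sqr_ge0].
rewrite (le_trans (ler_normB _ _))// (le_trans (lerD (FC _ Kv) (FC _ Ky)))//.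
rewrite (_ : C + C = 2 * C); last by rewrite mulr_natl.
apply: ler_wpDl; first exact: ltW.
rewrite -[leRHS]mulrA; apply: ler_peMr; first by rewrite mulr_ge0.
rewrite mulrC ler_pdivlMr ?exprn_gt0// mul1r leNgt; apply/negP => Sr.
move: vy; rewrite ltNge => /negP; apply; apply: norm_le_coord => [|i]; first exact: ltW.
rewrite !mxE -(@ler_pXn2r _ 2)// ?nnegrE ?(ltW r0)// real_normK ?num_real//.
rewrite (le_trans _ (ltW Sr))// /S (bigD1 i)//= lerDl.
by apply: sumr_ge0 => j _; exact: sqr_ge0.
Qed.

Section stereo_density.
Context {R : realType} {d : nat}.
Notation T := (borel_rV R d).
Context (p M : R) (sigma mu : probability T R).
Hypothesis p0 : 0 < p.
Let Q : set 'rV[R]_d := [set x | `|x| <= M].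
Hypothesis sigmaQ : sigma (~` Q) = 0%E.
Hypothesis muQ : mu (~` Q) = 0%E.
Hypothesis moments : forall s,
  \int[sigma]_x stprod s (wgt p) x = \int[mu]_x stprod s (wgt p) x.
Implicit Types (x : 'rV[R]_d) (f g : 'rV[R]_d -> R).

Lemma stprodE s f x : stprod s f x = f x * \prod_(i <- s) stereo i x.
Proof.
elim: s f => [|i s IH] f /=; first by rewrite big_nil mulr1.
by rewrite big_cons IH mulrA.
Qed.

Lemma bmeas_stprod s f : bmeas (f : T -> R) -> bmeas (stprod s f : T -> R).
Proof.
elim: s f => //= i s IH f bf; apply: IH; apply: bmeasM => //; exact: bmeas_stereo.
Qed.

(** Requiring equality for all products with monomials, and not for f alone, makes the class stable
    under multiplication by the sphere coordinates. *)
Let ann f := bmeas (f : T -> R) /\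
  forall s, \int[sigma]_x stprod s f x = \int[mu]_x stprod s f x.

Let annD f g : ann f -> ann g -> ann (fun x => f x + g x).
Proof.
move=> [bf Hf] [bg Hg]; split; first exact: bmeasD.
move=> s; have -> : stprod s (fun x => f x + g x) =
    fun x => stprod s f x + stprod s g x.
  by apply/funext => x; rewrite !stprodE mulrDl.
by rewrite !bintD ?Hf ?Hg//; exact: bmeas_stprod.
Qed.

Let annZ c f : ann f -> ann (fun x => c * f x).
Proof.
move=> [bf Hf]; split; first by apply: bmeasM => //; exact: bmeas_cst.
move=> s; have -> : stprod s (fun x => c * f x) = fun x => c * stprod s f x.
  by apply/funext => x; rewrite !stprodE mulrA.
by rewrite !bintZl ?Hf//; exact: bmeas_stprod.
Qed.

Let annS i f : ann f -> ann (fun x => f x * stereo i x).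
Proof.
move=> [bf Hf]; split; first by apply: bmeasM => //; exact: bmeas_stereo.
by move=> s; exact: (Hf (i :: s)).
Qed.

(** Sphere coordinates rescaled to [0, 1], to serve as step probabilities of the walk. *)
Let y x (i : 'I_d.+1) : R := (1 + stereo i x) / 2.

Let y01 x i : 0 <= y x i <= 1.
Proof. have := stereo_le1 i x; rewrite ler_norml /y; lra. Qed.

Let ann_smp l (G : ('I_d.+1 -> nat) -> R) c f : ann f ->
  ann (fun x => f x * smp (y x) l G c).
Proof.
elim: l c f => [|i l IH] c f af /=.
  by under eq_fun do rewrite mulrC; exact: annZ.
have ay : ann (fun x => f x * y x i).
  rewrite (_ : (fun x => _) = fun x => 2^-1 * f x + 2^-1 * (f x * stereo i x)).
    by apply: annD; apply: annZ => //; exact: annS.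
  by apply/funext => x; rewrite /y; field.
have ay' : ann (fun x => f x * (1 - y x i)).
  rewrite (_ : (fun x => _) = fun x => 1 * f x + (-1) * (f x * y x i)).
    by apply: annD; apply: annZ.
  by apply/funext => x; ring.
have := annD (IH (incr i c) _ ay) (IH c _ ay'); congr ann.
by apply/funext => x /=; set s1 := smp _ _ _ (incr _ _); set s2 := smp _ _ _ _; ring.
Qed.

Let mQ : measurable (~` Q : set T).
Proof.
apply: measurableC; apply: closed_measurable_rV.
by apply: cts_closed_le => x; exact: norm_continuous.
Qed.

Lemma stereo_dense (phi : 'rV[R]_d -> R) : continuous phi -> bmeas (phi : T -> R) ->
  \int[sigma]_x phi x = \int[mu]_x phi x.
Proof.
move=> cphi bphi.
pose A := 1 + (d%:R * M) ^+ 2; have A0 : 0 < A by rewrite ltr_wpDr// sqr_ge0.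
(* [xi] inverts the projection in the rescaled coordinates, where 2 y_0 = 2 / (1 + |x|^2). On Q this
   is at least 2 / A, and the maximum keeps [xi] continuous everywhere else. *)
pose den (v : 'rV[R]_d.+1) := Num.max (2 * v ord0 ord0) (2 / A).
have den0 v : 0 < den v by rewrite lt_max divr_gt0 ?orbT.
pose xi (v : 'rV[R]_d.+1) : 'rV[R]_d :=
  \row_j ((2 * v ord0 (lift ord0 j) - 1) / den v).
have cxi : continuous xi.
  apply: row_continuous => j.
  have c2 k : continuous (fun v : 'rV[R]_d.+1 => 2 * v ord0 k).
    by apply: ctsM; [exact: cts_cst|exact: coord_continuous].
  apply: ctsM; first by apply: ctsB => //; exact: cts_cst.
  apply: ctsV; first by move=> v; rewrite gt_eqF.
  by apply: cts_max => //; exact: cts_cst.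
(* The known moments carry the weight, so phi / w is what gets approximated by polynomials;
   multiplying back by w <= 1 does not increase the error. *)
pose psi x := phi x / wgt p x.
have cpsi : continuous psi.
  apply: ctsM => //; apply: ctsV; first by move=> x; rewrite gt_eqF ?wgt_gt0.
  exact: wgt_continuous.
pose F v := psi (xi v).
have cF : continuous F by move=> v; exact: (continuous_comp (cxi v) (cpsi _)).
have xiy x : Q x -> xi (\row_i y x i) = x.
  move=> Qx; have sA : 1 + sqnorm x <= A.
    rewrite lerD2l -sqr_enorm lerXn2r ?nnegrE ?enorm_ge0//.
      by rewrite mulr_ge0//; exact: le_trans Qx.
    by rewrite (le_trans (enorm_le_norm x))// ler_wpM2l.
  have a0 : 0 < 1 + sqnorm x by rewrite ltr_wpDr// sqnorm_ge0.
  have y0 : 2 * y x ord0 = 2 / (1 + sqnorm x).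
    by rewrite /y /stereo unlift_none; field; rewrite gt_eqF.
  apply/rowP => j; rewrite mxE /den !mxE y0 (max_idPl _); last first.
    by rewrite ler_pM2l// lef_pV2 ?posrE.
  by rewrite /y /stereo liftK; field; rewrite gt_eqF.
apply/eqP; rewrite -subr_eq0 -normr_le0; apply/ler_addgt0Pr => e e0; rewrite add0r.
have e4 : 0 < e / 4 by rewrite divr_gt0.
have [B B0 HB] := quadratic_modulus cF e4.
pose C := B * d.+1%:R; have C0 : 0 <= C by rewrite mulr_ge0.
pose N := (Num.truncn (C / (e / 4))).+1.
have CN : C / N%:R <= e / 4.
  rewrite ler_pdivrMr// mulrC -ler_pdivrMr//.
  by rewrite ltW// /N; have /andP[_ +] := truncn_itv (divr_ge0 C0 (ltW e4)).
pose G c := F (\row_i Num.min 1 (N%:R^-1 * (c i)%:R)).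
pose P x := wgt p x * smp (y x) (flatten (nseq N (enum 'I_d.+1))) G (fun=> 0%N).
have aw : ann (wgt p) by split => //; apply: bmeas_wgt; exact: ltW.
have [bP HP] := ann_smp (flatten (nseq N (enum 'I_d.+1))) G (fun=> 0%N) aw.
have near x : Q x -> `|phi x - P x| <= e / 2.
  move=> Qx.
  have phiE : phi x = wgt p x * F (\row_i y x i).
    by rewrite /F xiy// /psi mulrC divfK// gt_eqF ?wgt_gt0.
  rewrite phiE /P -mulrBr normrM ger0_norm ?wgt_ge0// distrC.
  apply: (@le_trans _ _ (1 * (e / 4 + C / N%:R))); last first.
    by rewrite mul1r (_ : e / 2 = e / 4 + e / 4) ?lerD2l//; field.
  apply: ler_pM => //; [exact: wgt_ge0|by apply: wgt_le1; exact: ltW|].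
  apply: bernstein_bound => // v v01.
  have -> : \sum_(i < d.+1) (v ord0 i - y x i) ^+ 2 =
      \sum_(i < d.+1) (v ord0 i - (\row_i y x i) ord0 i) ^+ 2.
    by apply: eq_bigr => i _; rewrite mxE.
  by apply: HB => // i; rewrite mxE.
have close (nu : probability T R) : nu (~` Q) = 0%E ->
    `|\int[nu]_x phi x - \int[nu]_x P x| <= e / 2.
  move=> nuQ; rewrite -bintB//.
  rewrite -[e / 2]mulr1 -[X in _ * X]/(fine 1%E) -(probability_setT nu).
  apply: (bint_norm_le_null _ mQ nuQ); first exact: bmeasB.
  by move=> x /contrapT/near.
have H1 := close _ sigmaQ; have H2 := close _ muQ.
have H3 := HP [::]; rewrite /= in H3; rewrite H3 in H1.
rewrite -(subrKA (\int[mu]_x P x)) (le_trans (ler_normD _ _))//.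
by rewrite (splitr e) lerD// distrC.
Qed.

End stereo_density.

(** * Identification of the limit measure *)

Lemma powRN_near1 {R : realType} (p x : R) : 0 <= p -> 2^-1 <= x ->
  `|x `^ (- p) - 1| <= p * 2^-1 `^ (- p - 1) * `|x - 1|.
Proof.
move=> p0 x2; have := @powRN_lip R p 2^-1 x 1 p0.
by rewrite powR1; apply => //; rewrite ?invr_gt0// invf_le1// ler1n.
Qed.

(** Both bases tend to 1 as r -> 1, and x^-p is Lipschitz on [1/2, +oo[. The bound r >= 1/2 also
    serves to keep the coefficient of a given squared moment away from 0 independently of delta. *)
Lemma dilation_factors_near1 {R : realType} (p a delta : R) :
  0 <= p -> 0 <= a -> 0 < delta -> exists r, [/\ 2^-1 <= r < 1,
    `|((1 + r) / 2) `^ (- p) - 1| <= delta &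
    `|(1 + a * (1 - r)) `^ (- p) - 1| <= delta].
Proof.
move=> p0 a0 del0; pose c := p * 2^-1 `^ (- p - 1).
have c0 : 0 <= c by rewrite mulr_ge0// powR_ge0.
have den0 : 0 < (c + 1) * (a + 1) by rewrite mulr_gt0// ltr_wpDl.
pose t := Num.min 2^-1 (delta / ((c + 1) * (a + 1))).
have t0 : 0 < t by rewrite lt_min divr_gt0// invr_gt0 ltr0n.
have t2 : t <= 2^-1 by rewrite ge_min lexx.
have ct : (c + 1) * (a + 1) * t <= delta.
  by rewrite mulrC -ler_pdivlMr// ge_min lexx orbT.
have cat : c * (a * t) <= delta.
  apply: le_trans ct; rewrite mulrA; apply: ler_wpM2r; first exact: ltW.
  by apply: ler_pM => //; rewrite lerDl.
have c1t : c * t <= delta.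
  apply: le_trans ct; apply: ler_wpM2r; first exact: ltW.
  by rewrite -[leLHS]mulr1; apply: ler_pM => //; rewrite ?lerDl ?lerDr.
have h2 : 2^-1 <= 1 :> R by rewrite invf_le1// ler1n.
exists (1 - t); split.
- by apply/andP; split; lra.
- have -> : (1 + (1 - t)) / 2 = 1 - t / 2 by field.
  have ht : t / 2 <= t by rewrite ler_pdivrMr// ler_peMr ?(ltW t0)// ler1n.
  have t20 : 0 <= t / 2 by rewrite divr_ge0// ltW.
  apply: le_trans (powRN_near1 p0 _) _; first by lra.
  rewrite -/c addrAC subrr add0r normrN ger0_norm//.
  by apply: le_trans c1t; apply: ler_wpM2l.
- have at0 : 0 <= a * t by rewrite mulr_ge0// ltW.
  have -> : 1 - (1 - t) = t by ring.
  apply: le_trans (powRN_near1 p0 _) _; first by lra.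
  by rewrite -/c addrAC subrr add0r ger0_norm.
Qed.

Section distance.
Context {R : realType} {d : nat} (E : set 'rV[R]_d).
Implicit Types (x y : 'rV[R]_d).

Definition edist x : R := inf [set enorm (x - y) | y in E].

Let edist_lb x : has_lbound [set enorm (x - y) | y in E].
Proof. by exists 0 => _ [y _ <-]; exact: enorm_ge0. Qed.

Lemma edist_le x y : E y -> edist x <= enorm (x - y).
Proof. by move=> Ey; apply: (ge_inf (edist_lb x)); exists y. Qed.

Hypothesis E0 : E !=set0.

Lemma edist_ge x (r : R) : (forall y, E y -> r <= enorm (x - y)) -> r <= edist x.
Proof.
move=> H; apply: lb_le_inf; first by have [y Ey] := E0; exists (enorm (x - y)), y.
by move=> _ [y Ey <-]; exact: H.
Qed.

Let edistB x y : edist x - edist y <= enorm (x - y).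
Proof.
rewrite lerBlDr addrC -lerBlDr; apply: edist_ge => z Ez.
rewrite lerBlDr (le_trans (edist_le x Ez))//.
have := ler_enormD (y - z) (x - y); congr (_ <= _); congr enorm.
by rewrite addrC subrKA.
Qed.

Lemma edist_continuous : continuous edist.
Proof.
apply: (@lipschitz_enorm_continuous _ _ _ 1) => // x y; rewrite mul1r.
rewrite ler_norml edistB andbT lerNl opprB enormB; exact: edistB.
Qed.

Lemma edist_gt0 x : closed E -> ~ E x -> 0 < edist x.
Proof.
move=> cE nEx; have : nbhs x (~` E) by apply: open_nbhs_nbhs; split => //; exact: closed_openC.
move=> /nbhs_ballP[r /= r0 Hr]; apply: (lt_le_trans r0); apply: edist_ge => y Ey.
rewrite leNgt; apply/negP => xy; apply: (Hr y) => //.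
by rewrite -ball_normE/=; exact: le_lt_trans (norm_le_enorm _) xy.
Qed.

End distance.

Section equilibrium_potential.
Context {R : realType} {d : nat} (alpha : R).
Notation T := (borel_rV R d).
Notation q := (d%:R - alpha).
Hypothesis ad : alpha < d%:R.
Hypothesis alpha2 : alpha <= 2.
Hypothesis d0 : (0 < d)%N.
Context (E : set 'rV[R]_d) (muE : probability T R).
Hypothesis cE : compact E.
Hypothesis finW : (robin alpha E < +oo)%E.
Hypothesis eqE : is_equilibrium alpha E muE.
Implicit Types (x y z : 'rV[R]_d) (e : R).

Let q0 : 0 < q. Proof. by rewrite subr_gt0. Qed.

Notation W := (fine (robin alpha E)).
Notation u := (upot alpha muE).

Lemma support_neq0 : E !=set0.
Proof.
apply: contrapT => nE; have [muE0 _] := eqE.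
have : muE setT = 0%E :> \bar R.
  rewrite -[RHS]muE0; congr (muE _); apply/seteqP; split => // x _ Ex.
  by apply: nE; exists x.
by rewrite probability_setT => /eqP; rewrite eqe oner_eq0.
Qed.

Let mEc : measurable (~` E : set T).
Proof. by apply: measurableC; exact: mE. Qed.

Let tpot_ge_cst e x (c : R) : 0 < e -> (forall y, E y -> c <= kap alpha e (x - y)) ->
  c <= tpot alpha e muE x.
Proof.
move=> e0 H; have [muE0 _] := eqE.
rewrite -[c]mulr1 -[X in _ * X]/(fine 1%E) -(probability_setT muE) -bint_cst.
apply: (bint_le_null _ (bmeas_kap ad x e0) mEc muE0); first exact: bmeas_cst.
by move=> y /contrapT; exact: H.
Qed.

Let tpot_le_cst e x (c : R) : 0 < e -> (forall y, E y -> kap alpha e (x - y) <= c) ->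
  tpot alpha e muE x <= c.
Proof.
move=> e0 H; have [muE0 _] := eqE.
rewrite -[c]mulr1 -[X in _ * X]/(fine 1%E) -(probability_setT muE) -bint_cst.
apply: (bint_le_null (bmeas_kap ad x e0) _ mEc muE0); first exact: bmeas_cst.
by move=> y /contrapT; exact: H.
Qed.

(** On the bounded set E the kernel is bounded below, hence so is u at a point of E. With W > 0, the
    threshold W / 2 separates infinity from E. *)
Lemma robin_gt0 : 0 < W.
Proof.
have [B [B0 EB]] := compact_enorm_bounded cE.
have [x Ex] := support_neq0.
have c0 : 0 < (2 * B + 1) `^ (- q) by rewrite powR_gt0// ltr_wpDl// mulr_ge0.
apply: (lt_le_trans c0); apply: le_trans (upot_le ad alpha2 d0 cE finW eqE x).
apply: le_trans (tpot_upot ad alpha2 d0 cE finW eqE x ltr01).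
apply: tpot_ge_cst => // y Ey; apply: powRN_anti; first exact: ltW.
  by rewrite lt_max ltr01 orbT.
rewrite ge_max lerDr mulr_ge0// andbT (le_trans (ler_enormD _ _))// enormN.
by have := EB _ Ex; have := EB _ Ey; lra.
Qed.

Lemma upot_far : exists M, [/\ 0 <= M, forall x, E x -> `|x| <= M &
  forall x, M < `|x| -> u x <= W / 2].
Proof.
have [B [B0 EB]] := compact_enorm_bounded cE.
have W2 : 0 < W / 2 by rewrite divr_gt0// robin_gt0.
pose r := (W / 2) `^ (- q^-1).
have r0 : 0 < r by rewrite powR_gt0.
have rq : r `^ (- q) = W / 2.
  rewrite -powRrM mulrNN mulVf ?powRr1 ?ltW//.
  by rewrite gt_eqF.
exists (B + r); split.
- by rewrite addr_ge0// ltW.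
- move=> x Ex; rewrite (le_trans (norm_le_enorm x))// (le_trans (EB _ Ex))//.
  by rewrite lerDl ltW.
- move=> x xB; rewrite -lee_fin -(upotE ad alpha2 d0 cE finW eqE).
  apply: (potential_le ad) => e e0; apply: tpot_le_cst => // y Ey.
  rewrite -rq; apply: powRN_anti => //; first exact: ltW.
  rewrite le_max; apply/orP; left.
  have := EB _ Ey; have := ler_enormD (x - y) y; rewrite subrK.
  by have := norm_le_enorm x; lra.
Qed.

(** Off E the truncation is inactive, which makes u accessible to weak convergence there. *)
Lemma upot_tpot e x : 0 < e -> e <= edist E x -> u x = tpot alpha e muE x.
Proof.
move=> e0 ex; apply/eqP; rewrite eq_le (tpot_upot ad alpha2 d0 cE finW eqE)// andbT.
rewrite -lee_fin -(upotE ad alpha2 d0 cE finW eqE); apply: (potential_le ad) => e' e'0.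
have [muE0 _] := eqE.
apply: (bint_le_null (bmeas_kap ad x e'0) (bmeas_kap ad x e0) mEc muE0).
move=> y /contrapT Ey; have exy := le_trans ex (edist_le x Ey).
rewrite [leRHS]/kap (max_idPl exy); apply: powRN_anti; first exact: ltW.
  exact: lt_le_trans exy.
by rewrite le_max lexx.
Qed.

Lemma bmeas_upot : bmeas (u : T -> R).
Proof.
split; last first.
  exists W => x; rewrite ger0_norm; first exact: (upot_le ad alpha2 d0 cE finW eqE).
  exact: (upot_ge0 alpha muE).
apply/measurable_EFinP; apply: (eq_measurable_fun (potential alpha muE : T -> \bar R)).
  by move=> x _; rewrite /= (upotE ad alpha2 d0 cE finW eqE).
exact: measurable_potential.
Qed.

End equilibrium_potential.

Lemma sum_symmetric {V : zmodType} n (f : 'I_n -> 'I_n -> V) :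
  (forall k l, f k l = f l k) ->
  \sum_(k < n) \sum_(l < n) f k l =
  \sum_(k < n) f k k + (\sum_(k < n) \sum_(l < n | (k < l)%N) f k l) *+ 2.
Proof.
move=> fC.
have E k : \sum_(l < n) f k l =
    f k k + (\sum_(l < n | (k < l)%N) f k l + \sum_(l < n | (l < k)%N) f k l).
  rewrite (bigD1 k)//=; congr (_ + _); rewrite (bigID (fun l : 'I_n => (k < l)%N))/=.
  congr (_ + _); apply: eq_bigl => l; rewrite -val_eqE/=; by case: ltngtP.
rewrite (eq_bigr _ (fun k _ => E k)) !big_split/= mulr2n; congr (_ + (_ + _)).
rewrite (exchange_big_dep predT)//=; apply: eq_bigr => k _.
by apply: eq_bigr => l _.
Qed.

(** S stands for the sum over pairs j < k. Dividing 2 S by n^2 instead of n (n - 1) only decreases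
    it, and the n diagonal terms K e contribute K e / n. *)
Lemma discrete_sum_bound {R : realType} (n : R) (S D K c e : R) : 2 <= n ->
  0 <= K -> 2 / (n * (n - 1)) * S <= D -> 0 <= S ->
  n^-1 ^+ 2 * (n * (K * e) + K * (S * 2) + n * (n * c)) <= K * e / n + K * D + c.
Proof.
move=> n2 K0 SD S0.
have n0 : 0 < n by rewrite (lt_le_trans _ n2).
have n1 : 0 < n - 1 by lra.
have -> : n^-1 ^+ 2 * (n * (K * e) + K * (S * 2) + n * (n * c)) =
    K * e / n + K * (n^-1 ^+ 2 * (S * 2)) + c by field; rewrite gt_eqF.
rewrite lerD2r lerD2l; apply: ler_wpM2l => //; apply: le_trans SD.
rewrite (_ : 2 / (n * (n - 1)) * S = (n * (n - 1))^-1 * (S * 2)); last by ring.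
apply: ler_wpM2r; first exact: mulr_ge0.
rewrite exprVn expr2 lef_pV2 ?posrE ?mulr_gt0//.
by rewrite ler_pM2l// gerBl.
Qed.

Section kernel_estimates.
Context {R : realType} {d : nat} (alpha : R).
Notation T := (borel_rV R d).
Notation q := (d%:R - alpha).
Notation p := (q / 2).
Hypothesis ad : alpha < d%:R.
Implicit Types (x y : 'rV[R]_d) (e : R).

Let q0 : 0 < q. Proof. by rewrite subr_gt0. Qed.
Let p0 : 0 < p. Proof. by rewrite divr_gt0. Qed.

Context (r : R) (m : nat) (eps : R).
Hypothesis r01 : 0 <= r < 1.
Hypothesis series_eps : forall z, `|z| <= 1 ->
  `|(1 - r * z) `^ (- p) - \sum_(j < m) binc p j * r ^+ j * z ^+ j| <= eps.

Let eps0 : 0 <= eps.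
Proof. by have := @series_eps 0; rewrite normr0 => /(_ ler01); exact: le_trans. Qed.

Let K := ((1 + r) / 2) `^ (- p).
Let c := 2 `^ p * eps.

Let K0 : 0 < K.
Proof. by rewrite powR_gt0// divr_gt0// ltr_wpDr//; case/andP: r01. Qed.

Let c0 : 0 <= c. Proof. by rewrite mulr_ge0// powR_ge0. Qed.

(** Outside radius e this is [kpol_le]; e is chosen so small that K e^-q exceeds the constant bound
    C of [kpol_le_cst] inside. *)
Lemma kpol_le_kap : exists2 e, 0 < e &
  forall x y, kpol p r m x y <= K * kap alpha e (x - y) + c.
Proof.
pose C := 2 `^ p * ((1 - r) `^ (- p) + eps).
have C0 : 0 <= C by rewrite mulr_ge0 ?powR_ge0// addr_ge0// powR_ge0.
have CK0 : 0 < C / K + 1 by rewrite ltr_wpDl// divr_ge0// ltW.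
pose e := (C / K + 1) `^ (- q^-1).
have e0 : 0 < e by rewrite powR_gt0.
have eE : e `^ (- q) = C / K + 1.
  rewrite -powRrM mulrNN mulVf ?powRr1 ?ltW//.
  by rewrite gt_eqF.
exists e => // x y; case: (leP e (enorm (x - y))) => exy.
  have xy : x != y by rewrite -subr_eq0 -enorm_gt0 (lt_le_trans e0).
  apply: le_trans (kpol_le p0 r01 series_eps xy) _.
  rewrite lerD2r /kap (max_idPl exy) -sqr_enorm -powR_mulrn ?enorm_ge0//.
  rewrite -powRrM; have -> : 2%:R * - p = - q by field.
  exact: lexx.
apply: le_trans (kpol_le_cst p0 r01 series_eps x y) _.
rewrite /kap (max_idPr (ltW exy)) eE -/C.
have -> : K * (C / K + 1) = C + K by field; rewrite gt_eqF.
by rewrite -addrA lerDl addr_ge0// ltW.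
Qed.

Lemma dq_avg_le e n (X : 'I_n -> 'rV[R]_d) (b : 'rV[R]_d -> bool) (D : R) :
  0 < e -> (forall x y, kpol p r m x y <= K * kap alpha e (x - y) + c) ->
  (2 <= n)%N -> discrete_energy alpha X = D%:E ->
  dq p r m (fun h => avg X (fun x => (b x)%:R * h x))
    (fun h => avg X (fun x => (b x)%:R * h x)) <=
  K * e `^ (- q) / n%:R + K * D + c.
Proof.
move=> e0 He n2 XD; rewrite dq_avg.
pose f (k l : 'I_n) := kap alpha e (X k - X l).
pose S := \sum_(k < n) \sum_(l < n | (k < l)%N) f k l.
have S0 : 0 <= S by apply: sumr_ge0 => k _; apply: sumr_ge0 => l _; exact: kap_ge0.
have csum (a : R) : n%:R * a = \sum_(k < n) a by rewrite sumr_const card_ord mulr_natl.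
have n2' : 2 <= n%:R :> R by rewrite ler_nat.
have SD : 2 / (n%:R * (n%:R - 1)) * S <= D.
  rewrite -lee_fin -XD /discrete_energy EFinM; apply: lee_wpmul2l.
    rewrite lee_fin divr_ge0// mulr_ge0// subr_ge0 (le_trans _ n2')//.
    by rewrite ler1n.
  rewrite /S -sumEFin; apply: lee_sum => k _; rewrite -sumEFin.
  by apply: lee_sum => l _; exact: kap_riesz.
apply: le_trans (discrete_sum_bound c (e `^ (- q)) n2' (ltW K0) SD S0).
apply: ler_wpM2l; first exact: sqr_ge0.
have -> : n%:R * (K * e `^ (- q)) + K * (S * 2) + n%:R * (n%:R * c) =
    \sum_(k < n) \sum_(l < n) (K * f k l + c).
  have -> : \sum_(k < n) \sum_(l < n) (K * f k l + c) =
      K * (\sum_(k < n) \sum_(l < n) f k l) + n%:R * (n%:R * c).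
    rewrite mulr_sumr [n%:R * (n%:R * c)]csum -big_split/=; apply: eq_bigr => k _.
    by rewrite big_split/= -csum -mulr_sumr.
  rewrite sum_symmetric; last by move=> k l; rewrite /f /kap enormB.
  have -> : \sum_(k < n) f k k = n%:R * e `^ (- q).
    rewrite csum; apply: eq_bigr => k _.
    rewrite /f subrr /kap (max_idPr _)// (_ : enorm 0 = 0) ?ltW//.
    by apply/eqP; rewrite enorm_eq0.
  by rewrite -/S; ring.
apply: ler_sum => k _; apply: ler_sum => l _.
(* A pair with a discarded point contributes 0, which stays below the nonnegative bound. *)
case: (b (X k)); case: (b (X l)); rewrite ?mul1r ?mul0r ?mulr0 ?He//;
  by rewrite ?mul0r addr_ge0// mulr_ge0 ?kap_ge0// ltW.
Qed.

Lemma bq_cvg (F : set_system nat) (Ln : nat -> ('rV[R]_d -> R) -> R) L j f :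
  ProperFilter F ->
  (forall f, continuous f -> bmeas (f : T -> R) -> Ln n f @[n --> F] --> L f) ->
  continuous f -> bmeas (f : T -> R) ->
  bq (Ln n) (Ln n) j f f @[n --> F] --> bq L L j f f.
Proof.
move=> FF HL; elim: j f => [|j IH] f cf bf /=.
  by apply: cvgM; exact: HL.
apply: cvgr_sumr => i; apply: IH.
  by apply: ctsM => //; exact: stereo_continuous.
by apply: bmeasM => //; exact: bmeas_stereo.
Qed.

Lemma dq_cvg (F : set_system nat) (Ln : nat -> ('rV[R]_d -> R) -> R) L :
  ProperFilter F ->
  (forall f, continuous f -> bmeas (f : T -> R) -> Ln n f @[n --> F] --> L f) ->
  dq p r m (Ln n) (Ln n) @[n --> F] --> dq p r m L L.
Proof.
move=> FF HL; apply: cvgM; first exact: cvg_cst.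
apply: cvgr_sumr => j; apply: cvgM; first exact: cvg_cst.
apply: bq_cvg => //; first exact: wgt_continuous.
by apply: bmeas_wgt; exact: ltW.
Qed.

Lemma dq_ge_tpot (rho rho' : probability T R) (Q : set 'rV[R]_d) (A e : R) :
  measurable (~` Q : set T) -> rho (~` Q) = 0%E -> rho' (~` Q) = 0%E ->
  (forall x, Q x -> 1 + sqnorm x <= A) -> 0 < e ->
  (1 + A ^+ 2 / (2 * e ^+ 2) * (1 - r)) `^ (- p) * \int[rho]_x tpot alpha e rho' x - c
    <= dq p r m (fun h => \int[rho]_x h x) (fun h => \int[rho']_x h x).
Proof.
move=> mQ rQ rQ' QA e0; set G := _ `^ _.
have [bk <-] := @dq_int R d p r m p0 rho rho'.
have bt := bmeas_tpot ad rho' e0.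
have bc a : bmeas (fun _ : T => a : R) := bmeas_cst a.
have bGt := bmeasB (bmeasM (bc G) bt) (bc c).
have one (nu : probability T R) : fine (nu setT) = 1 by rewrite probability_setT.
have -> : G * \int[rho]_x tpot alpha e rho' x - c =
    \int[rho]_x (G * tpot alpha e rho' x - c).
  rewrite bintB//; last exact: (bmeasM (bc G) bt).
  by rewrite bintZl// bint_cst one mulr1.
apply: (bint_le_null bGt bk mQ rQ) => x /contrapT Qx.
have bx := bmeas_kap ad x e0.
have -> : G * tpot alpha e rho' x - c =
    \int[rho']_y (G * kap alpha e (x - (y : 'rV[R]_d)) - c).
  rewrite bintB//; last exact: (bmeasM (bc G) bx).
  by rewrite bintZl// bint_cst one mulr1.
apply: (bint_le_null _ (@bmeas_kpol R d p r m p0 x) mQ rQ').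
  exact: (bmeasB (bmeasM (bc G) bx) (bc c)).
move=> y /contrapT Qy.
have := kpol_ge p0 r01 series_eps erefl e0 (QA _ Qx) (QA _ Qy).
by rewrite [A ^+ 2 * (1 - r) / _]mulrAC.
Qed.

End kernel_estimates.

Lemma dilation_params {R : realType} (p a delta : R) (j : nat) :
  0 < p -> 0 <= a -> 0 < delta -> exists r m eps,
  [/\ 2^-1 <= r < 1, (j < m)%N,
    forall z, `|z| <= 1 ->
      `|(1 - r * z) `^ (- p) - \sum_(k < m) binc p k * r ^+ k * z ^+ k| <= eps,
    2 `^ p * eps = delta &
    ((1 + r) / 2) `^ (- p) <= 1 + delta /\
    1 - delta <= (1 + a * (1 - r)) `^ (- p)].
Proof.
move=> p0 a0 del0.
have [r [/andP[r2 r1] rK rG]] := dilation_factors_near1 (ltW p0) a0 del0.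
have r0 : 0 <= r by apply: le_trans r2; rewrite invr_ge0.
have r01 : 0 <= r < 1 by rewrite r0.
have tp : 0 < 2 `^ p :> R by rewrite powR_gt0.
have [N HN] := binomial_series_unif p0 r01 (divr_gt0 del0 tp).
exists r, (maxn N j.+1), (delta / 2 `^ p); split.
- by rewrite r2.
- by rewrite leq_max leqnn orbT.
- by apply: HN; rewrite leq_max leqnn.
- by rewrite mulrC divfK// gt_eqF.
- split; first by rewrite -lerBlDl (le_trans (ler_norm _)).
  by rewrite lerBlDr -lerBlDl (le_trans (ler_norm _))// distrC.
Qed.

Lemma le_of_dilations {R : realType} (T W : R) : 0 <= T -> 0 <= W ->
  (forall delta, 0 < delta <= 1 -> (1 - delta) * T - delta <= (1 + delta) * W + delta) ->
  T <= W.
Proof.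
move=> T0 W0 H; apply/ler_addgt0Pr => e e0.
have C0 : 0 < T + W + 2 by lra.
pose del := Num.min 1 (e / (T + W + 2)).
have del0 : 0 < del by rewrite lt_min ltr01 divr_gt0.
have dC : del * (T + W + 2) <= e by rewrite -ler_pdivlMr// ge_min lexx orbT.
have := H del; rewrite del0 ge_min lexx => /(_ isT); lra.
Qed.

(** The right-hand side equals delta (4 W + 6) - 2 delta^2, hence the choice of [del]. *)
Lemma eq0_of_dilations {R : realType} (W k x : R) : 0 <= W -> 0 < k ->
  (forall delta, 0 < delta <= 1 -> k * x ^+ 2 <=
    ((1 + delta) * W + delta) - 2 * ((1 - delta) * (W - delta) - delta) +
    ((1 + delta) * W + delta)) -> x = 0.
Proof.
move=> W0 k0 H; suff /eqP : k * x ^+ 2 = 0.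
  by rewrite mulf_eq0 gt_eqF//= sqrf_eq0 => /eqP.
apply/le_anti; rewrite mulr_ge0 ?sqr_ge0 ?(ltW k0)// andbT.
apply/ler_addgt0Pr => e e0; rewrite add0r.
have C0 : 0 < 4 * W + 6 by lra.
pose del := Num.min 1 (e / (4 * W + 6)).
have del0 : 0 < del by rewrite lt_min ltr01 divr_gt0.
have dC : del * (4 * W + 6) <= e by rewrite -ler_pdivlMr// ge_min lexx orbT.
have d2 : 0 <= del ^+ 2 by exact: sqr_ge0.
have := H del; rewrite del0 ge_min lexx => /(_ isT); lra.
Qed.

Lemma bint_restrict {d0} {T : measurableType d0} {R : realType}
    (mu : {finite_measure set T -> \bar R}) (D : set T) (f : T -> R) :
  measurable D -> bmeas f -> (forall x, 0 <= f x) ->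
  (\int[mu]_(x in D) (f x)%:E)%E = (\int[mu]_x (f x * \1_D x))%:E.
Proof.
move=> mD bf f0; rewrite -(bint_mrestr mu mD bf f0) -bintE// ge0_integral_mrestr//.
by apply/measurable_EFinP; exact: bf.1.
Qed.

Lemma bint_setC {d0} {T : measurableType d0} {R : realType}
    (mu : {finite_measure set T -> \bar R}) (D : set T) (f : T -> R) :
  measurable D -> bmeas f -> \int[mu]_x f x =
  \int[mu]_x (f x * \1_D x) + \int[mu]_x (f x * \1_(~` D) x).
Proof.
move=> mD bf; have b1 := bmeasM bf (bmeas_indic (R := R) mD).
have b2 := bmeasM bf (bmeas_indic (R := R) (measurableC mD)).
rewrite -bintD//; apply: eq_Rintegral => x _.
by rewrite -mulrDr !indicE in_setC; case: (x \in D); rewrite ?addr0 ?add0r mulr1.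
Qed.

Section limit_identification.
Context {R : realType} {d : nat} (alpha : R).
Notation T := (borel_rV R d).
Notation q := (d%:R - alpha).
Notation p := (q / 2).
Hypothesis ad : alpha < d%:R.
Hypothesis alpha2 : alpha <= 2.
Hypothesis d0 : (0 < d)%N.
Context (E : set 'rV[R]_d) (muE : probability T R).
Hypothesis cE : compact E.
Hypothesis finW : (robin alpha E < +oo)%E.
Hypothesis eqE : is_equilibrium alpha E muE.
Context (M : R) (X : forall n, 'I_n -> 'rV[R]_d) (sigma : probability T R).
Context (U : set_system nat) (PU : ProperFilter U).
Notation Q := [set x : 'rV[R]_d | `|x| <= M].
Hypothesis oU : \oo `<=` U.
Hypothesis EQ : forall x, E x -> `|x| <= M.
Hypothesis XI : discrete_energy alpha (@X n) @[n --> \oo] --> robin alpha E.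
Hypothesis Xm : mext alpha E muE (@X n) @[n --> \oo] --> 0.
Hypothesis sigmaQ : sigma (~` Q) = 0%E.
Hypothesis Xsigma : forall f : 'rV[R]_d -> R, continuous f -> bmeas (f : T -> R) ->
  avg (@X n) (fun x => (`|x| <= M)%R%:R * f x) @[n --> U] --> \int[sigma]_x f x.
Implicit Types (x y : 'rV[R]_d) (e : R).

Let q0 : 0 < q. Proof. by rewrite subr_gt0. Qed.
Let p0 : 0 < p. Proof. by rewrite divr_gt0. Qed.

Notation W := (fine (robin alpha E)).
Notation u := (upot alpha muE).
Notation Ls := (fun h => \int[sigma]_x h x).
Notation Lm := (fun h => \int[muE]_x h x).

Let W0 : 0 <= W. Proof. exact: robin_ge0 eqE. Qed.

Let muQ : muE (~` Q) = 0%E.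
Proof.
have [muE0 _] := eqE; apply: (subset_measure0 _ _ _ muE0).
- apply: measurableC; apply: closed_measurable_rV.
  by apply: cts_closed_le => x; exact: norm_continuous.
- by apply: measurableC; exact: mE.
- by move=> x /= xQ Ex; apply: xQ; exact: EQ.
Qed.

Let mQ : measurable (~` Q : set T).
Proof.
apply: measurableC; apply: closed_measurable_rV.
by apply: cts_closed_le => x; exact: norm_continuous.
Qed.

Let A := 1 + (d%:R * M) ^+ 2.

Let QA x : Q x -> 1 + sqnorm x <= A.
Proof.
move=> Qx; rewrite lerD2l -sqr_enorm lerXn2r ?nnegrE ?enorm_ge0//.
  by rewrite mulr_ge0//; exact: le_trans Qx.
by rewrite (le_trans (enorm_le_norm x))// ler_wpM2l.
Qed.

Section kernel_bounds.
Context (r : R) (m : nat) (eps : R).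
Hypothesis r01 : 0 <= r < 1.
Hypothesis series_eps : forall z, `|z| <= 1 ->
  `|(1 - r * z) `^ (- p) - \sum_(j < m) binc p j * r ^+ j * z ^+ j| <= eps.
Let K := ((1 + r) / 2) `^ (- p).
Let c := 2 `^ p * eps.

Lemma dq_equilibrium_le : dq p r m Lm Lm <= K * W + c.
Proof.
have [e e0 He] := kpol_le_kap ad r01 series_eps.
have [bk <-] := @dq_int R d p r m p0 muE muE.
have bc a : bmeas (fun _ : T => a : R) := bmeas_cst a.
have one : fine (muE setT) = 1 by rewrite probability_setT.
have -> : K * W + c = \int[muE]_x (K * W + c) by rewrite bint_cst one mulr1.
apply: (@bint_le _ T R muE _ _ bk (bc (K * W + c))) => x.
have bx := bmeas_kap ad x e0.
apply: (@le_trans _ _ (\int[muE]_y (K * kap alpha e (x - (y : 'rV[R]_d)) + c))).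
  apply: (@bint_le _ T R muE _ _ (@bmeas_kpol R d p r m p0 x)
    (bmeasD (bmeasM (bc K) bx) (bc c))) => y.
  exact: He.
rewrite (bintD _ (bmeasM (bc K) bx) (bc c)) bintZl// bint_cst one mulr1 lerD2r.
apply: ler_wpM2l; first exact: powR_ge0.
apply: le_trans (tpot_upot ad alpha2 d0 cE finW eqE x e0) _.
exact: (upot_le ad alpha2 d0 cE finW eqE).
Qed.

Lemma dq_limit_le : dq p r m Ls Ls <= K * W + c.
Proof.
have [e e0 He] := kpol_le_kap ad r01 series_eps.
pose b x := (`|x| <= M)%R.
pose Ln n (h : 'rV[R]_d -> R) := avg (@X n) (fun x => (b x)%:R * h x).
have H1 : dq p r m (Ln n) (Ln n) @[n --> U] --> dq p r m Ls Ls.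
  exact: (@dq_cvg R d alpha ad r m U Ln Ls PU Xsigma).
move: XI; rewrite (robinE finW eqE) => /fine_cvgP[Xfin XD].
have XDU : fine (discrete_energy alpha (@X n)) @[n --> U] --> W.
  by move=> B /XD; exact: oU.
apply/ler_addgt0Pr => t t0.
have XDt : K * fine (discrete_energy alpha (@X n)) + (c + t) @[n --> U] -->
    K * W + (c + t).
  by apply: cvgD; [apply: cvgM => //|]; exact: cvg_cst.
rewrite -addrA; apply: (ler_cvg_to H1 XDt); apply: oU.
(* From N on, the diagonal contribution K e^-q / n is at most t. *)
pose N := (Num.truncn (K * e `^ (- q) / t)).+1.
near=> n.
have n2 : (2 <= n)%N by near: n; exists 2%N.
have nN : (N <= n)%N by near: n; exists N.
have nfin : discrete_energy alpha (@X n) \is a fin_num by near: n.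
have n0 : 0 < n%:R :> R by rewrite ltr0n (leq_trans _ n2).
apply: le_trans (@dq_avg_le _ _ _ ad _ _ _ r01 series_eps e n (@X n) b _ e0 He n2
  (esym (fineK nfin))) _.
rewrite -/K -/c -addrA [leLHS]addrC addrA lerD2l.
rewrite ler_pdivrMr// [t * _]mulrC -ler_pdivrMr//.
have h0 : 0 <= K * e `^ (- q) / t.
  by apply: divr_ge0; [apply: mulr_ge0; exact: powR_ge0|exact: ltW].
have /andP[_ NK] := truncn_itv h0; apply: le_trans (ltW NK) _.
by rewrite ler_nat.
Unshelve. all: by end_near. Qed.
End kernel_bounds.

(** The regularized energy of sigma is at least its truncated energy by [dq_ge_tpot] and at most
    about W by the discrete energies; e stays fixed while r -> 1. *)
Lemma int_tpot_limit_le e : 0 < e -> \int[sigma]_x tpot alpha e sigma x <= W.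
Proof.
move=> e0; set t := Rintegral _ _ _.
have t0 : 0 <= t by apply: Rintegral_ge0 => x _; exact: tpot_ge0.
have a0 : 0 <= A ^+ 2 / (2 * e ^+ 2).
  by apply: divr_ge0; [exact: sqr_ge0|apply: mulr_ge0 => //; exact: sqr_ge0].
apply: (le_of_dilations t0 W0) => delta /andP[del0 _].
have [r [m [eps [/andP[r2 r1] _ Hs <- [HK HG]]]]] := dilation_params 0 p0 a0 del0.
have r01 : 0 <= r < 1 by rewrite r1 andbT (le_trans _ r2)// invr_ge0.
have := le_trans (dq_ge_tpot ad r01 Hs mQ sigmaQ sigmaQ QA e0) (dq_limit_le r01 Hs).
move=> H; apply: le_trans (le_trans H _).
  by rewrite lerD2r; apply: ler_wpM2r.
by rewrite lerD2r; apply: ler_wpM2r.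
Qed.

(** The finite energy makes [variation] applicable to the restriction of sigma to E. *)
Lemma energy_limit_le : (energy alpha sigma <= W%:E)%E.
Proof.
have H := @cvg_int_tpot _ _ _ ad sigma sigma.
rewrite /energy -[leLHS](cvg_lim _ H)//; apply: lime_le.
  by apply/cvg_ex; eexists; exact: H.
apply: nearW => n; rewrite bintE; last exact: bmeas_tpot.
by rewrite lee_fin; exact: int_tpot_limit_le.
Qed.

Let mE' : measurable (E : set T). Proof. exact: mE. Qed.
Let bu : bmeas (u : T -> R). Proof. exact: (bmeas_upot ad alpha2 d0 cE finW eqE). Qed.
Let Wu x : 0 <= W - u x.
Proof. by rewrite subr_ge0; exact: (upot_le ad alpha2 d0 cE finW eqE). Qed.
Let bWu : bmeas (fun x : T => W - u x).
Proof. by apply: bmeasB => //; exact: bmeas_cst. Qed.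

Lemma int_green_support_le : \int[sigma]_x ((W - u x) * \1_E x) <= 0.
Proof.
have := variation finW eqE mE' (nu := mrestr sigma mE').
rewrite (robinE finW eqE) /= /mrestr setTI setICl measure0 => /(_ erefl).
have -> : (\int[mrestr sigma mE']_x potential alpha muE x =
    (\int[sigma]_x (u x * \1_E x))%:E)%E.
  rewrite -bint_mrestr//; last by move=> x; exact: upot_ge0.
  rewrite -bintE//; apply: eq_integral => x _.
  exact: (upotE ad alpha2 d0 cE finW eqE).
move=> H; have {}H := H (le_lt_trans (le_trans (energy_mrestr_le alpha sigma mE')
  energy_limit_le) (ltry _)).
have b1 := bmeas_indic (R := R) mE'.
have -> : \int[sigma]_x ((W - u x) * \1_E x) =
    W * fine (sigma E) - \int[sigma]_x (u x * \1_E x).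
  rewrite -bint_indic// -bintZl// -bintB; last 2 first.
  - by apply: bmeasM => //; exact: bmeas_cst.
  - exact: bmeasM.
  by apply: eq_Rintegral => x _; rewrite mulrBl.
by rewrite subr_le0 -lee_fin EFinM [X in (_ * X)%E]fineK ?fin_num_measure.
Qed.

(** A ramp in the distance to E, 0 up to e and 1 from 2 e on. *)
Let chi e x := Num.min 1 (Num.max 0 (e^-1 * edist E x - 1)).

(** As chi vanishes within e of E, chi times W - u can be written with the continuous truncated
    potential. Its averages over the points of Q are at most m_E(X_n), which tends to 0. *)
Lemma int_green_far_le e : 0 < e ->
  \int[sigma]_x ((W - u x) * \1_[set x | 2 * e <= edist E x] x) <= 0.
Proof.
move=> e0; have ei : 0 < e^-1 by rewrite invr_gt0.
have E0 := support_neq0 eqE.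
pose g x := chi e x * (W - tpot alpha e muE x).
have cchi : continuous (chi e).
  apply: cts_min; first exact: cts_cst.
  apply: cts_max; first exact: cts_cst.
  apply: ctsB; last exact: cts_cst.
  by apply: ctsM; [exact: cts_cst|exact: edist_continuous].
have chi0 x : 0 <= chi e x by rewrite le_min ler01 le_max lexx.
have chi1 x : chi e x <= 1 by rewrite ge_min lexx.
have cg : continuous g.
  apply: ctsM => //; apply: ctsB; first exact: cts_cst.
  exact: tpot_continuous.
have gE x : g x = chi e x * (W - u x).
  have [ex|ex] := leP e (edist E x).
    by rewrite /g (upot_tpot ad alpha2 d0 cE finW eqE e0 ex).
  have c0 : chi e x = 0.
    rewrite /chi (max_idPl _) ?(min_idPr _)// subr_le0.
    by rewrite mulrC ler_pdivrMr// mul1r ltW.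
  by rewrite /g c0 !mul0r.
have g0 x : 0 <= g x by rewrite gE mulr_ge0.
have bg : bmeas (g : T -> R).
  apply: bmeasM.
    split; first exact: continuous_measurable_rV.
    by exists 1 => x; rewrite ger0_norm.
  by apply: bmeasB; [exact: bmeas_cst|exact: bmeas_tpot].
have ig : \int[sigma]_x g x <= 0.
  have XmU : mext alpha E muE (@X n) @[n --> U] --> 0.
    by move=> B /Xm; exact: oU.
  apply: (ler_cvg_to (Xsigma cg bg) XmU); apply: nearW => n.
  rewrite /avg /mext; apply: ler_wpM2l; first by rewrite invr_ge0.
  rewrite [leRHS]big_mkcond/=; apply: ler_sum => k _.
  case: ifPn => [_|]; last first.
    rewrite negbK inE => Ex; rewrite gE (_ : chi e (X k) = 0) ?mul0r ?mulr0//.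
    have h := edist_le (X k) Ex; rewrite subrr in h.
    have z : enorm (0 : 'rV[R]_d) = 0 by apply/eqP; rewrite enorm_eq0.
    rewrite z in h; rewrite /chi (max_idPl _) ?(min_idPr _)// subr_le0.
    by apply: le_trans ler01; rewrite pmulr_rle0.
  apply: (@le_trans _ _ (g (X k))).
    by case: (`|X k| <= M); rewrite ?mul1r ?mul0r.
  by rewrite gE ler_piMl.
have mF : measurable ([set x | 2 * e <= edist E x] : set T).
  rewrite (_ : mkset _ = [set x | - edist E x <= - (2 * e)]).
    apply: closed_measurable_rV; apply: cts_closed_le; apply: ctsN.
    exact: edist_continuous.
  by apply/seteqP; split => x /=; rewrite lerN2.
apply: le_trans ig; apply: (@bint_le _ T R sigma _ _ (bmeasM bWu (bmeas_indic mF)) bg) => x.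
rewrite gE indicE; have [/set_mem/= xF|xF] := boolP (x \in _); last first.
  by rewrite mulr0 mulr_ge0.
have c1 : chi e x = 1.
  apply/min_idPl; rewrite le_max; apply/orP; right.
  by rewrite lerBrDr mulrC ler_pdivlMr.
by rewrite c1 mul1r mulr1.
Qed.

Lemma int_green_compl_le : \int[sigma]_x ((W - u x) * \1_(~` E) x) <= 0.
Proof.
have E0 := support_neq0 eqE.
pose F n := [set x : 'rV[R]_d | 2 * n.+1%:R^-1 <= edist E x].
have mF n : measurable (F n : set T).
  rewrite (_ : F n = [set x | - edist E x <= - (2 * n.+1%:R^-1)]).
    apply: closed_measurable_rV; apply: cts_closed_le; apply: ctsN.
    exact: edist_continuous.
  by apply/seteqP; split => x /=; rewrite /F/= lerN2.
have UF : \bigcup_n F n = ~` E.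
  apply/seteqP; split => x.
    move=> [n _ /= nx] Ex; have := le_trans nx (edist_le x Ex).
    rewrite subrr (_ : enorm 0 = 0) ?leNgt ?mulr_gt0//.
    by apply/eqP; rewrite enorm_eq0.
  move=> /(edist_gt0 E0 (compact_closed _ cE)) => /(_ (@norm_hausdorff _ _)) x0.
  have [n _ /(_ n (leqnn n)) nx] := near_natSinv_le (divr_gt0 x0 (ltr0n _ 2)).
  by exists n => //; rewrite /F/= mulrC -ler_pdivlMr.
have mf : measurable_fun setT (fun x : T => (W - u x)%:E).
  by apply/measurable_EFinP; exact: bWu.1.
have H : (\int[sigma]_(x in F n) (W - u x)%:E)%E @[n --> \oo] -->
    (\int[sigma]_(x in ~` E) (W - u x)%:E)%E.
  rewrite -UF; apply: ge0_nondecreasing_set_cvg_integral => //.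
  - move=> n m nm; apply/subsetPset => x /=; apply: le_trans.
    by rewrite ler_pM2l// lef_pV2 ?posrE// ler_nat.
  - by move=> n; apply: measurable_funTS.
  - by move=> n x _; rewrite lee_fin.
rewrite -lee_fin -bint_restrict//; last exact: measurableC.
rewrite -[leLHS](cvg_lim _ H)//; apply: lime_le.
  by apply/cvg_ex; eexists; exact: H.
apply: nearW => n; rewrite bint_restrict// lee_fin.
exact: int_green_far_le.
Qed.

Lemma int_upot_limit_ge : W <= \int[sigma]_x u x.
Proof.
rewrite -subr_le0.
have -> : W - \int[sigma]_x u x = \int[sigma]_x (W - u x).
  rewrite bintB//; last exact: bmeas_cst.
  have one : fine (sigma setT) = 1 by rewrite probability_setT.
  by rewrite bint_cst one mulr1.
rewrite (bint_setC _ mE')// -[leRHS]addr0 lerD ?int_green_support_le//.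
exact: int_green_compl_le.
Qed.

Lemma limit_moments (s : seq 'I_d.+1) :
  \int[sigma]_x stprod s (wgt p) x = \int[muE]_x stprod s (wgt p) x.
Proof.
apply/eqP; rewrite -subr_eq0; apply/eqP; set D := (X in X = 0).
have k0 : 0 < 2 `^ p * (binc p (size s) * 2^-1 ^+ size s).
  by rewrite mulr_gt0 ?powR_gt0// mulr_gt0 ?binc_gt0// exprn_gt0// invr_gt0.
apply: (eq0_of_dilations W0 k0) => delta /andP[del0 del1].
(* The cross term is bounded below at a fixed scale only: e is chosen first, from int u dsigma >= W,
   and r afterwards, depending on e through [a0]. *)
have [e e0 He] : exists2 e, 0 < e & W - delta <= \int[sigma]_x tpot alpha e muE x.
  have := @cvg_int_tpot _ _ _ ad muE sigma.
  have -> : (\int[sigma]_x potential alpha muE x = (\int[sigma]_x u x)%:E)%E.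
    rewrite -bintE//; apply: eq_integral => x _.
    exact: (upotE ad alpha2 d0 cE finW eqE).
  move=> /fine_cvgP[_] /cvgrPdist_le /(_ _ del0) [N _ /(_ N (leqnn N))] /= HN.
  exists N.+1%:R^-1; first by rewrite invr_gt0.
  have {}HN : `|\int[sigma]_x u x - \int[sigma]_x tpot alpha N.+1%:R^-1 muE x| <= delta.
    exact: HN.
  rewrite lerBlDr -lerBlDl; apply: le_trans HN; apply: le_trans (ler_norm _).
  by rewrite lerD2r int_upot_limit_ge.
set t := Rintegral _ _ _ in He.
have t0 : 0 <= t by apply: Rintegral_ge0 => x _; exact: tpot_ge0.
have a0 : 0 <= A ^+ 2 / (2 * e ^+ 2).
  by apply: divr_ge0; [exact: sqr_ge0|apply: mulr_ge0 => //; exact: sqr_ge0].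
have [r [m [eps [/andP[r2 r1] sm Hs epsE [HK HG]]]]] :=
  dilation_params (size s) p0 a0 del0.
have r01 : 0 <= r < 1 by rewrite r1 andbT (le_trans _ r2)// invr_ge0.
have Hsm := dq_ge_tpot ad r01 Hs mQ sigmaQ muQ QA e0.
have Hss := dq_limit_le r01 Hs.
have Hmm := dq_equilibrium_le r01 Hs.
rewrite epsE in Hsm Hss Hmm.
have Hge := dq_ge p0 r01 Ls Lm sm.
rewrite -/D in Hge.
(* Since r >= 1/2, the coefficient of D^2 may be taken independent of delta. *)
have hk : 2 `^ p * (binc p (size s) * 2^-1 ^+ size s) * D ^+ 2 <=
    2 `^ p * (binc p (size s) * r ^+ size s) * D ^+ 2.
  apply: ler_wpM2r; first exact: sqr_ge0.
  apply: ler_wpM2l; first exact: powR_ge0.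
  apply: ler_wpM2l; first by rewrite ltW// binc_gt0.
  by apply: lerXn2r => //; rewrite nnegrE ?invr_ge0// (le_trans _ r2)// invr_ge0.
apply: le_trans hk _; apply: le_trans Hge _.
have hW : ((1 + r) / 2) `^ (- p) * W + delta <= (1 + delta) * W + delta.
  by rewrite lerD2r; apply: ler_wpM2r.
have h1d : 0 <= 1 - delta by rewrite subr_ge0.
have hG : (1 - delta) * (W - delta) - delta <= dq p r m Ls Lm.
  apply: le_trans Hsm; rewrite lerD2r.
  by apply: (le_trans (ler_wpM2l h1d He)); exact: ler_wpM2r.
apply: lerD; last exact: le_trans Hmm hW.
apply: lerB; first exact: le_trans Hss hW.
by rewrite ler_pM2l.
Qed.

Lemma limit_eq_equilibrium (phi : 'rV[R]_d -> R) : continuous phi ->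
  bmeas (phi : T -> R) -> \int[sigma]_x phi x = \int[muE]_x phi x.
Proof. exact: (stereo_dense p0 sigmaQ muQ limit_moments). Qed.

End limit_identification.

Lemma compactly_supported_bmeas {R : realType} {d : nat} (f : 'rV[R]_d -> R) :
  continuous f -> compactly_supported f -> bmeas (f : borel_rV R d -> R).
Proof.
move=> cf csf; split; first exact: continuous_measurable_rV.
have cK : compact [set f x | x in closure [set x | f x != 0]].
  by apply: continuous_compact => //; exact: continuous_subspaceT.
have [C [_ HC]] := compact_bounded cK.
exists (`|C| + 1) => x; have [->|fx] := eqVneq (f x) 0.
  by rewrite normr0 addr_ge0.
apply: HC; first by rewrite (le_lt_trans (ler_norm C))// ltrDl.
by exists x => //; exact: subset_closure.
Qed.

(** * Tightness and conclusion of the direct part *)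

Section direct.
Context {R : realType} {d : nat} (alpha : R).
Notation T := (borel_rV R d).
Hypothesis ad : alpha < d%:R.
Hypothesis alpha2 : alpha <= 2.
Hypothesis d0 : (0 < d)%N.
Context (E : set 'rV[R]_d) (muE : probability T R).
Hypothesis cE : compact E.
Hypothesis finW : (robin alpha E < +oo)%E.
Hypothesis eqE : is_equilibrium alpha E muE.
Implicit Types (x y : 'rV[R]_d).

Notation W := (fine (robin alpha E)).
Notation u := (upot alpha muE).

(** Markov's inequality: each point beyond M lies off E and contributes at least W / 2 to the sum in
    [mext]. *)
Lemma avg_far_le (M : R) n (X : 'I_n -> 'rV[R]_d) :
  (forall x, E x -> `|x| <= M) -> (forall x, M < `|x| -> u x <= W / 2) ->
  avg X (fun x => (M < `|x|)%R%:R) <= 2 / W * mext alpha E muE X.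
Proof.
move=> EM uM; have W0 := robin_gt0 ad alpha2 d0 cE finW eqE.
rewrite /avg /mext [leRHS]mulrCA; apply: ler_wpM2l; first by rewrite invr_ge0.
rewrite mulr_sumr [leRHS]big_mkcond/=; apply: ler_sum => k _.
have h x : 0 <= 2 / W * (W - u x).
  apply: mulr_ge0; first by rewrite divr_ge0// ltW.
  by rewrite subr_ge0; exact: (upot_le ad alpha2 d0 cE finW eqE).
case: ltP => Mx; last by case: ifP.
rewrite ifT; last by apply/negP; rewrite inE => /EM; rewrite leNgt Mx.
have := uM _ Mx; rewrite ler_pdivlMr// [2 / W * _]mulrAC ler_pdivlMr// mul1r; lra.
Qed.

Lemma equilibrium_cvg (X : forall n : nat, 'I_n -> 'rV[R]_d) :
  discrete_energy alpha (X n) @[n --> \oo] --> robin alpha E ->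
  m_ext alpha E muE (X n) @[n --> \oo] --> 0%E ->
  weak_cvg (fun n => counting_measure (X n)) muE.
Proof.
move=> XI Xm phi cphi csphi.
have bphi := compactly_supported_bmeas cphi csphi.
have [_ [C0 phiC0]] := bphi.
pose C := `|C0|; have phiC x : `|phi x| <= C by rewrite (le_trans (phiC0 x))// ler_norm.
have [M [M0 EM uM]] := upot_far ad alpha2 d0 cE finW eqE.
have Xm' : mext alpha E muE (X n) @[n --> \oo] --> 0.
  move: Xm; under eq_fun do rewrite (mextE ad alpha2 d0 cE finW eqE).
  by move=> /fine_cvgP[_].
pose far n := avg (X n) (fun x => (M < `|x|)%R%:R : R).
have far0 : far n @[n --> \oo] --> (0 : R).
  apply: (@squeeze_cvgr _ _ _ _ (fun=> 0) (fun n => 2 / W * mext alpha E muE (X n))).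
  - by apply: nearW => n; rewrite avg_ge0//=; apply: avg_far_le.
  - exact: cvg_cst.
  - rewrite -[X in _ --> X](mulr0 (2 / W)); apply: cvgM => //; exact: cvg_cst.
rewrite bintE//; under eq_fun do rewrite (integral_counting _ bphi.1).
apply: cvg_EFin; first exact: nearW.
under eq_fun do rewrite /=.
(* The measure sigma built below may depend on U; its integral of phi does not. *)
apply: cvg_ultra => U UU oU.
have XQ : avg (X n) (fun x => (`|x| <= M)%R%:R : R) @[n --> U] --> (1 : R).
  rewrite -[X in _ --> X]subr0.
  have : 1 - far n @[n --> U] --> (1 - 0 : R).
    by apply: cvgB; [exact: cvg_cst|move=> B /far0; exact: oU].
  apply: cvg_trans; apply: near_eq_cvg; apply: oU; near=> n.
  have n0 : (0 < n)%N by near: n; exists 1%N.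
  rewrite /far -[X in X - _](avg_cst (X n) 1 n0) -avgB; congr avg; apply/funext => x.
  by rewrite leNgt; case: (_ < _); rewrite ?subrr ?subr0.
have [sigma [sigmaQ Xsigma]] := limit_measure UU XQ.
rewrite -(limit_eq_equilibrium ad alpha2 d0 cE finW eqE _ oU EM XI Xm' sigmaQ
  Xsigma cphi bphi).
(* The points outside Q, a vanishing proportion, change the average of the bounded phi
   negligibly. *)
have near0 : avg (X n) phi - avg (X n) (fun x => (`|x| <= M)%R%:R * phi x) @[n --> U]
    --> (0 : R).
  apply: norm_cvg0; apply: (@squeeze_cvgr _ _ _ _ (fun=> 0) (fun n => C * far n)).
  - apply: nearW => n; rewrite normr_ge0/= -avgB -avgZl.
    have H x : `|phi x - (`|x| <= M)%R%:R * phi x| <= C * (M < `|x|)%R%:R.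
      rewrite [in leRHS]ltNge; case: (`|x| <= M).
        by rewrite mul1r subrr normr0 mulr0.
      by rewrite mul0r subr0 mulr1.
    rewrite ler_norml -avgN; apply/andP; split; apply: avg_le => x;
      by have := H x; rewrite ler_norml => /andP[].
  - exact: cvg_cst.
  - rewrite -[X in _ --> X](mulr0 C); apply: cvgM; first exact: cvg_cst.
    by move=> B /far0; exact: oU.
have avgE n : avg (X n) phi = avg (X n) phi - avg (X n) (fun x => (`|x| <= M)%R%:R * phi x)
    + avg (X n) (fun x => (`|x| <= M)%R%:R * phi x) by rewrite subrK.
rewrite (funext avgE) -[X in _ --> X]add0r.
exact: cvgD near0 (Xsigma _ cphi bphi).
Unshelve. all: by end_near. Qed.

End direct.

Theorem theorem1p1 (R : realType) (d : nat) (alpha : R) (E : set 'rV[R]_d)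
    (muE : probability (borel_rV R d) R) :
  (2 <= d)%N -> 0 < alpha -> alpha <= 2%:R -> alpha < d%:R ->
  compact E -> (robin alpha E < +oo)%E -> is_equilibrium alpha E muE ->
  (forall X : forall n : nat, 'I_n -> 'rV[R]_d,
     discrete_energy alpha (X n) @[n --> \oo] --> robin alpha E ->
     m_ext alpha E muE (X n) @[n --> \oo] --> 0%E ->
     weak_cvg (fun n => counting_measure (X n)) muE) /\
  (forall X : forall n : nat, 'I_n -> 'rV[R]_d,
     weak_cvg (fun n => counting_measure (X n)) muE ->
     m_ext alpha E muE (X n) @[n --> \oo] --> 0%E).
Proof.
move=> d2 _ alpha2 ad cE finW eqE; have d0 : (0 < d)%N by exact: ltnW.
by split=> X; [exact: (equilibrium_cvg ad alpha2 d0)|exact: (mext_cvg0 ad alpha2 d0)].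
Qed.
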